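(* Assume (A1)–(A5) as stated in the context. Let $A>0$ be a constant, $k_n=A\log n$, let $\widehat S_n(\lambda)$ be the set of covariates selected by the lasso with penalty $\lambda$ on $\mathcal D_1$, and let $\Lambda_n=\{\lambda: |\widehat S_n(\lambda)|\le k_n\}$. Fix $\alpha\in(0,1)$. Then: 1. (The true loss overfits.) $\mathbb P(D\subset \widehat S_n(\lambda_* ))\to 1$ as $n\to\infty$, where $\lambda_*=\arg\min_{\lambda\in\Lambda_n}L(\lambda)$. 2. (Cross-validation also overfits.) $\mathbb P(D\subset\widehat S_n(\widehat\lambda))\to1$ as $n\to\infty$, where $\widehat\lambda=\arg\min_{\lambda\in\Lambda_n}\widehat L(\lambda)$. 3. (Type I error is controlled.) $\limsup_{n\to\infty}\mathbb P(D^c\cap\widehat D_n\ne\varnothing)\le\alpha$, where $\widehat D_n$ is the multi-stage selector with level $\alpha$ defined in the context.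
   Context: **Model and standing assumptions.** We observe i.i.d. pairs $(X_i,Y_i)$ with $X_i=(X_{i1},\dots,X_{ip})^T\in\mathbb R^p$, where $p=p_n>n$ and $\beta\in\mathbb R^p$. There are $3n$ observations, split randomly into three groups $\mathcal D_1,\mathcal D_2,\mathcal D_3$ of size $n$ each. $D=\{j:\beta_j\neq0\}$, taken to be $\{1,\dots,s\}$; $S=\{1,\dots,p\}$; $D^c=S\setminus D$; $\psi=\min_{j\in D}|\beta_j|$. The symbol $\subset$ denotes non-strict inclusion. For an $n\times p$ design matrix $X$ (rows $X_i^T$ of one group) and $M\subset S$, $X_M$ is the submatrix of columns indexed by $M$. For a square matrix $C$, $\phi(C)$ and $\Phi(C)$ are its smallest and largest eigenvalues, and $\phi_n(k)=\min_{|M|=k}\phi(\frac1nX_M^TX_M)$, $\Phi_n(k)=\max_{|M|=k}\Phi(\frac1nX_M^TX_M)$. (A1) $Y_i=X_i^T\beta+\varepsilon_i$ with $\varepsilon_i\sim N(0,\sigma^2)$ i.i.d., independent of the covariates. (A2) $p_n\to\infty$ and $p_n\le c_1e^{n^{c_2}}$ for some $c_1>0$, $0\le c_2<1$. (A3) $s=|D|=O(1)$ and $\psi>0$. (Only $p_n$ varies with $n$: $s$, the nonzero coefficients and $\sigma^2$ do not depend on $n$.) (A4) There are positive constants $C_0,C_1,\kappa$ with $\mathbb P(\limsup_{n\to\infty}\Phi_n(n)\le C_0)=1$ and $\mathbb P(\liminf_{n\to\infty}\phi_n(C_1\log n)\ge\kappa)=1$; also $\mathbb P(\phi_n(n)>0)=1$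 for all $n$. (This is for the design matrix of each group.) (A5) $\mathbb E(X_{ij})=0$, $\mathbb E(X_{ij}^2)=1$, and for some $0<B<\infty$, $\mathbb P(|X_{jk}|\le B)=1$. **Lasso screening (stage I, data $\mathcal D_1$).** $\widetilde\beta(\lambda)$ minimizes $\sum_{i\in\mathcal D_1}(Y_i-X_i^T\beta)^2+\lambda\sum_{j=1}^p|\beta_j|$ over $\beta\in\mathbb R^p$, and $\widehat S_n(\lambda)=\{j:\widetilde\beta_j(\lambda)\ne0\}$. $\widehat\beta(\lambda)$ is the least-squares estimator on $\mathcal D_1$ using only the covariates in $\widehat S_n(\lambda)$, extended by $0$ to a vector in $\mathbb R^p$. With $X$ the design matrix of $\mathcal D_1$, the true loss is $L(\lambda)=\frac1n(\widehat\beta(\lambda)-\beta)^TX^TX(\widehat\beta(\lambda)-\beta)$. **Cross-validation (stage II, data $\mathcal D_2$).** $\widehat L(\lambda)=\frac1n\sum_{i\in\mathcal D_2}(Y_i-X_i^T\widehat\beta(\lambda))^2$; $\widehat\lambda$ minimizes $\widehat L$ over $\Lambda_n$; $\widehat S_n=\widehat S_n(\widehat\lambda)$. **Cleaning (stage III, data $\mathcal D_3$).** Let $M=\widehat S_n$, $m=|\widehat S_n|$, and (now with $X,Y$ from $\mathcal D_3$) $\widehat\beta_M=(X_M^TX_M)^{-1}X_M^TY$. For $j\in M$, $T_j=\widehat\beta_{M,j}/\big(\widehat\sigma\sqrt{e_j^T(X_M^TX_M)^{-1}e_j}\big)$ is the usual $t$-statistic, where $e_j$ is the unit vector for coordinate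 $j$ and $\widehat\sigma^2$ is the usual residual variance estimate with $n-m$ degrees of freedom. Then $\widehat D_n=\{j\in\widehat S_n:|T_j|>c_n\}$ with $c_n=z_{\alpha/(2m)}$, where $z_u$ is the upper $u$-quantile of $N(0,1)$: $\mathbb P(Z>z_u)=u$. *)

(* Defs.v *)
From HB Require Import structures.
From mathcomp Require Import all_boot all_order all_fingroup all_algebra.
From mathcomp Require Import all_classical all_reals all_analysis.
Set Implicit Arguments.
Unset Strict Implicit.
Unset Printing Implicit Defensive.
Import Order.TTheory GRing.Theory Num.Theory.
Import numFieldNormedType.Exports.
Local Open Scope classical_set_scope.
Local Open Scope ring_scope.

(* n observations (x, y) of p covariates and a response; as a type of tuples
   and pairs it carries the product Borel sigma-algebra. *)
Notation dataset R n p := (n.-tuple (p.-tuple R * R)).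

Definition mutually_independent d (Omega : measurableType d) (R : realType)
    (P : probability Omega R) (I : finType) (F : I -> set (set Omega)) : Prop :=
  forall (J : {set I}) (A : I -> set Omega),
    (forall i, i \in J -> F i (A i)) ->
    P (\bigcap_(i in [set i | i \in J]) A i) = (\prod_(i in J) P (A i))%E.

Definition independent d (Omega : measurableType d) (R : realType)
    (P : probability Omega R) (F G : set (set Omega)) : Prop :=
  forall A B, F A -> G B -> P (A `&` B) = (P A * P B)%E.

(* A triangular array on one probability space: for each n there are 3n
   observations (covariates, response, noise), and a random permutation that
   splits them into three groups of size n. *)
Record sample d (Omega : measurableType d) (R : realType)
    (P : probability Omega R) (p : nat -> nat) := Sample {
  covariate : forall n, 'I_(3 * n) -> {RV P >-> (p n).-tuple R};
  response : forall n, 'I_(3 * n) -> {RV P >-> R};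
  noise : forall n, 'I_(3 * n) -> {RV P >-> R};
  permutation : forall n, Omega -> 'S_(3 * n) }.

Definition observation d (Omega : measurableType d) (R : realType)
    (P : probability Omega R) (p : nat -> nat) (smp : sample P p) (n : nat)
    (i : 'I_(3 * n)) (w : Omega) : (p n).-tuple R * R :=
  (covariate smp i w, response smp i w).

Definition all_data d (Omega : measurableType d) (R : realType)
    (P : probability Omega R) (p : nat -> nat) (smp : sample P p) (n : nat)
    (w : Omega) : dataset R (3 * n) (p n) :=
  [tuple observation smp i w | i < 3 * n].

(* mxvec_index is a bijection from 'I_3 * 'I_n to 'I_(3 * n); so the three
   groups partition the observations. *)
Definition group_data d (Omega : measurableType d) (R : realType)
    (P : probability Omega R) (p : nat -> nat) (smp : sample P p) (g : 'I_3)
    (n : nat) (w : Omega) : dataset R n (p n) :=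
  [tuple observation smp (permutation smp n w (mxvec_index g i)) w | i < n].

Definition stage1 : 'I_3 := inord 0.
Definition stage2 : 'I_3 := inord 1.
Definition stage3 : 'I_3 := inord 2.

Definition iid_observations d (Omega : measurableType d) (R : realType)
    (P : probability Omega R) (p : nat -> nat) (smp : sample P p) : Prop :=
  forall n,
    mutually_independent P
      (fun i : 'I_(3 * n) => g_sigma_algebra_preimage (observation smp i)) /\
    forall (i j : 'I_(3 * n)) (B : set ((p n).-tuple R * R)), measurable B ->
      P (observation smp i @^-1` B) = P (observation smp j @^-1` B).

Definition random_split d (Omega : measurableType d) (R : realType)
    (P : probability Omega R) (p : nat -> nat) (smp : sample P p) : Prop :=
  forall n (t : 'S_(3 * n)),
    [/\ measurable [set w | permutation smp n w = t],
        P [set w | permutation smp n w = t] = (((3 * n)`!)%:R^-1)%:E &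
        forall E, g_sigma_algebra_preimage (all_data smp n) E ->
          P ([set w | permutation smp n w = t] `&` E) =
          (P [set w | permutation smp n w = t] * P E)%E].

Definition coef (R : realType) (beta : nat -> R) (p : nat) : 'cV[R]_p :=
  \col_j beta j.

Definition supp (R : realType) (p : nat) (b : 'cV[R]_p) : {set 'I_p} :=
  [set j | b j 0 != 0]%SET.

Definition gaussian_linear_model d (Omega : measurableType d) (R : realType)
    (P : probability Omega R) (p : nat -> nat) (smp : sample P p)
    (beta : nat -> R) (sigma : R) : Prop :=
  forall n,
    [/\ forall (i : 'I_(3 * n)) w, response smp i w =
          \sum_(j < p n) tnth (covariate smp i w) j * coef beta (p n) j 0
          + noise smp i w,
        forall (i : 'I_(3 * n)) (B : set R), measurable B ->
          P (noise smp i @^-1` B) = normal_prob 0 sigma B,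
        mutually_independent P
          (fun i : 'I_(3 * n) => g_sigma_algebra_preimage (noise smp i)) &
        independent P
          (g_sigma_algebra_preimage
            (fun w => [tuple noise smp i w | i < 3 * n] : _.-tuple R))
          (g_sigma_algebra_preimage
            (fun w => [tuple covariate smp i w | i < 3 * n]
              : _.-tuple ((p n).-tuple R)))].

Definition dimension_growth (R : realType) (p : nat -> nat) (c1 c2 : R) : Prop :=
  [/\ 0 < c1, 0 <= c2 < 1,
      ((p n)%:R : R) @[n --> \oo] --> +oo &
      forall n, (0 < n)%N -> (p n)%:R <= c1 * expR (n%:R `^ c2)].

(* psi = min_(j in D) |beta_j|, equal to +oo when D is empty. *)
Definition min_signal (R : realType) (beta : nat -> R) (s : nat) : \bar R :=
  ereal_inf [set (`|beta j|)%:E | j in [set j | (j < s)%N]].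

Definition sparse_signal (R : realType) (p : nat -> nat) (beta : nat -> R)
    (s : nat) : Prop :=
  [/\ forall n, (0 < n)%N -> (s <= p n)%N,
      forall j, (beta j != 0) = (j < s)%N &
      (0 < min_signal beta s)%E].

Definition normalized_bounded_covariates d (Omega : measurableType d)
    (R : realType) (P : probability Omega R) (p : nat -> nat) (smp : sample P p)
    (B : R) : Prop :=
  0 < B /\
  forall n (i : 'I_(3 * n)) (j : 'I_(p n)),
    [/\ ('E_P[fun w => tnth (covariate smp i w) j] = 0)%E,
        ('E_P[fun w => (tnth (covariate smp i w) j ^+ 2)%R] = 1)%E &
        P [set w | `|tnth (covariate smp i w) j| <= B] = 1%E].

Definition design (R : realType) n p (dat : dataset R n p) : 'M[R]_(n, p) :=
  \matrix_(i, j) tnth (tnth dat i).1 j.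

Definition responses (R : realType) n p (dat : dataset R n p) : 'cV[R]_n :=
  \col_i (tnth dat i).2.

Definition subcols (R : realType) n p (X : 'M[R]_(n, p)) (M : {set 'I_p}) :
  'M[R]_(n, #|M|) := colsub (fun k : 'I_#|M| => enum_val k) X.

Definition min_eig (R : realType) m (C : 'M[R]_m) : R :=
  inf [set a | eigenvalue C a].

Definition max_eig (R : realType) m (C : 'M[R]_m) : R :=
  sup [set a | eigenvalue C a].

Definition gram (R : realType) n p (X : 'M[R]_(n, p)) (M : {set 'I_p}) :
  'M[R]_#|M| := n%:R^-1 *: ((subcols X M)^T *m subcols X M).

(* phi_n(k) and Phi_n(k); inf and sup range over a finite set, which is
   nonempty as soon as k <= p. *)
Definition min_sparse_eig (R : realType) n p (X : 'M[R]_(n, p)) (k : nat) : R :=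
  inf [set min_eig (gram X M) | M in [set M : {set 'I_p} | #|M| = k]].

Definition max_sparse_eig (R : realType) n p (X : 'M[R]_(n, p)) (k : nat) : R :=
  sup [set max_eig (gram X M) | M in [set M : {set 'I_p} | #|M| = k]].

(* The non-integer size C1 log n is rounded down. *)
Definition sparse_eig_bounds d (Omega : measurableType d) (R : realType)
    (P : probability Omega R) (p : nat -> nat) (smp : sample P p)
    (C0 C1 kappa : R) : Prop :=
  [/\ 0 < C0, 0 < C1, 0 < kappa &
  forall g : 'I_3,
    [/\ \forall w \ae P,
          (limn_esup (fun n =>
            (max_sparse_eig (design (group_data smp g n w)) n)%:E)
            <= C0%:E)%E,
        \forall w \ae P,
          (kappa%:E <= limn_einf (fun n =>
            (min_sparse_eig (design (group_data smp g n w))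
               (Num.truncn (C1 * ln n%:R)))%:E))%E &
        forall n, (0 < n)%N -> \forall w \ae P,
          0 < min_sparse_eig (design (group_data smp g n w)) n]].

Definition is_argmin (R : realType) (T : Type) (A : set T) (f : T -> R)
    (x : T) : Prop :=
  A x /\ forall y, A y -> f x <= f y.

Definition lasso_objective (R : realType) n p (dat : dataset R n p) (lam : R)
    (b : 'cV[R]_p) : R :=
  \sum_i (responses dat i 0 - (design dat *m b) i 0) ^+ 2
  + lam * \sum_j `|b j 0|.

(* Coordinates relative to the enumeration of M. *)
Definition ls_coef (R : realType) n p (dat : dataset R n p) (M : {set 'I_p}) :
  'cV[R]_#|M| :=
  let X := subcols (design dat) M in
  invmx (X^T *m X) *m (X^T *m responses dat).

(* subcols 1%:M M embeds R^M into R^p, with zeros outside M. *)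
Definition ls_fit (R : realType) n p (dat : dataset R n p) (M : {set 'I_p}) :
  'cV[R]_p := subcols 1%:M M *m ls_coef dat M.

Definition true_loss (R : realType) n p (dat : dataset R n p)
    (beta b : 'cV[R]_p) : R :=
  let X := design dat in
  n%:R^-1 * ((b - beta)^T *m X^T *m X *m (b - beta)) 0 0.

Definition prediction_loss (R : realType) n p (dat : dataset R n p)
    (b : 'cV[R]_p) : R :=
  n%:R^-1 * \sum_i (responses dat i 0 - (design dat *m b) i 0) ^+ 2.

(* Lambda_n, for a map lam |-> betat lam computing lasso estimators.
   Negative penalties are excluded. *)
Definition admissible (R : realType) n p (A : R) (betat : R -> 'cV[R]_p) :
  set R :=
  [set lam | 0 <= lam /\ #|supp (betat lam)|%:R <= A * ln (n%:R : R)].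
Arguments admissible {R} n {p} A betat.

Definition residual_variance (R : realType) n p (dat : dataset R n p)
    (M : {set 'I_p}) : R :=
  (\sum_i (responses dat i 0 - (design dat *m ls_fit dat M) i 0) ^+ 2)
  / (n%:R - #|M|%:R).

Definition t_stat (R : realType) n p (dat : dataset R n p) (M : {set 'I_p})
    (k : 'I_#|M|) : R :=
  let X := subcols (design dat) M in
  ls_coef dat M k 0 /
  (Num.sqrt (residual_variance dat M) * Num.sqrt (invmx (X^T *m X) k k)).

(* z_u: the z with P(Z > z) = u for Z standard normal. *)
Definition upper_quantile (R : realType) (u : R) : R :=
  xget 0 [set z | normal_prob 0 1 [set x : R | z < x] = u%:E].

Definition cleaned (R : realType) n p (dat : dataset R n p) (alpha : R)
    (M : {set 'I_p}) : {set 'I_p} :=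
  [set enum_val k | k : 'I_#|M| &
    upper_quantile (alpha / (2 * #|M|%:R)) < `|t_stat dat k| ]%SET.

(* Main.v *)
(* A design with far more than n columns would, with probability bounded below,
   contain n columns whose first k entries all exceed a constant, so that the
   bound on Phi_n(n) forces p_n = O(n). Hence, with t = sqrt n, the projections
   of the noise on all models of size A log n + s have squared norm at most t,
   up to vanishing probability.

   Sparse eigenvalues are bounded below only at size C1 log n, which may be less
   than A log n; so the penalties in Lambda_n are split at L = l n, for a small
   constant l. If lam <= L, the basic inequality controls X (b - beta); since
   the KKT conditions force lam >= l0 sqrt n, it also bounds the l1 norm of b,
   so at most C1 log n coordinates of b - beta exceed a given threshold, and
   the restricted eigenvalue at these coordinates shows that no signal is lost.
   If lam >= L, the KKT conditions bound the size of the selected model by a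
   constant, and a lost signal costs a loss bounded below, whereas the refit at
   lam = L has loss O(t / n). Cross-validation only adds a noise term that the
   second group controls in the same way.

   For the last part, condition on the first two groups. The numerators of the
   t-statistics are exactly Gaussian and the variance estimate is at least
   sigma^2 (1 - n^(-1/4)) up to vanishing probability; the union bound over at
   most A log n statistics then costs alpha + o(1). Probabilities for the random
   split are averages over the values of the permutation. *)
Require Import Defs.
From HB Require Import structures.
From mathcomp Require Import all_boot all_order all_fingroup all_algebra.
From mathcomp Require Import all_classical all_reals all_analysis.
From mathcomp Require Import measurable_realfun.
From mathcomp Require Import ring lra.
Import Order.TTheory GRing.Theory Num.Theory.
Import numFieldNormedType.Exports.
Local Open Scope classical_set_scope.
Local Open Scope ring_scope.
Set Implicit Arguments.
Unset Strict Implicit.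
Unset Printing Implicit Defensive.

(** * Norms and sparse eigenvalues *)

(** The data enter the selection results only through [good_data]: from explicit inequalities the
    conclusions follow deterministically, and the probability of these inequalities is estimated
    separately. The scales are forced. A union over [p ^ k2] models, with [k2] and [ln p] of order
    log n, against projection tails exp (- t / (4 k2 sigma^2)) needs t above a multiple of (log
    n)^3, while a missed coefficient costs order n, so t must be o(n); sqrt n lies between. It is
    also the size of a single correlation [X_j . e], so penalties above l0 sqrt n keep t / lam, and
    with it the l1 norm of the lasso, bounded. Facts on Gaussian quadratic forms come from
    one-dimensional laws only: every linear form in the noise is normal, and the second and fourth
    moments of linear forms control the variance of sums of squares. Conditions on all real vectors
    are tested on rational vectors, because the typical event has to be measurable before Fubini or
    continuity of measure can be applied to it. *)

Definition dotv (R : realType) n (u v : 'cV[R]_n) : R := (u^T *m v) 0 0.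
Notation sqn u := (dotv u u).

Lemma dotvE (R : realType) n (u v : 'cV[R]_n) :
  dotv u v = \sum_i u i 0 * v i 0.
Proof. by rewrite /dotv mxE; apply: eq_bigr => i _; rewrite mxE. Qed.

Lemma dotvC (R : realType) n (u v : 'cV[R]_n) : dotv u v = dotv v u.
Proof. by rewrite !dotvE; apply: eq_bigr => i _; rewrite mulrC. Qed.

Lemma dotvDr (R : realType) n (u v w : 'cV[R]_n) :
  dotv u (v + w) = dotv u v + dotv u w.
Proof. by rewrite /dotv mulmxDr mxE. Qed.

Lemma dotvDl (R : realType) n (u v w : 'cV[R]_n) :
  dotv (v + w) u = dotv v u + dotv w u.
Proof. by rewrite dotvC dotvDr !(dotvC u). Qed.

Lemma dotvZr (R : realType) n (u v : 'cV[R]_n) a :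
  dotv u (a *: v) = a * dotv u v.
Proof. by rewrite /dotv -scalemxAr mxE. Qed.

Lemma dotvZl (R : realType) n (u v : 'cV[R]_n) a :
  dotv (a *: u) v = a * dotv u v.
Proof. by rewrite dotvC dotvZr dotvC. Qed.

Lemma dotvNr (R : realType) n (u v : 'cV[R]_n) : dotv u (- v) = - dotv u v.
Proof. by rewrite -scaleN1r dotvZr mulN1r. Qed.

Lemma dotvNl (R : realType) n (u v : 'cV[R]_n) : dotv (- u) v = - dotv u v.
Proof. by rewrite dotvC dotvNr dotvC. Qed.

Lemma dotvBr (R : realType) n (u v w : 'cV[R]_n) :
  dotv u (v - w) = dotv u v - dotv u w.
Proof. by rewrite dotvDr dotvNr. Qed.

Lemma dotvBl (R : realType) n (u v w : 'cV[R]_n) :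
  dotv (v - w) u = dotv v u - dotv w u.
Proof. by rewrite dotvDl dotvNl. Qed.

Lemma dotv0 (R : realType) n (u : 'cV[R]_n) : dotv u 0 = 0.
Proof. by rewrite /dotv mulmx0 mxE. Qed.

Lemma dotv_mulmx (R : realType) m n (A : 'M[R]_(m, n)) u v :
  dotv u (A *m v) = dotv (A^T *m u) v.
Proof. by rewrite /dotv trmx_mul trmxK mulmxA. Qed.

Lemma sqn_ge0 (R : realType) n (u : 'cV[R]_n) : 0 <= sqn u.
Proof. by rewrite dotvE sumr_ge0// => i _; rewrite -expr2 sqr_ge0. Qed.

Lemma sqn_eq0 (R : realType) n (u : 'cV[R]_n) : (sqn u == 0) = (u == 0).
Proof.
apply/idP/eqP => [|->]; last by rewrite dotv0.
rewrite dotvE psumr_eq0 => [/allP h|i _]; last by rewrite -expr2 sqr_ge0.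
apply/colP => i; rewrite mxE; apply/eqP; rewrite -sqrf_eq0 expr2.
by apply: (implyP (h i _)) => //; rewrite mem_index_enum.
Qed.

Lemma entry_sq_le_sqn (R : realType) n (u : 'cV[R]_n) i : u i 0 ^+ 2 <= sqn u.
Proof.
rewrite dotvE (bigD1 i)//= -expr2 lerDl sumr_ge0// => j _.
by rewrite -expr2 sqr_ge0.
Qed.

Lemma sqnD (R : realType) n (u v : 'cV[R]_n) :
  sqn (u + v) = sqn u + 2 * dotv u v + sqn v.
Proof. by rewrite dotvDr !dotvDl (dotvC v u); ring. Qed.

Lemma sqnB (R : realType) n (u v : 'cV[R]_n) :
  sqn (u - v) = sqn u - 2 * dotv u v + sqn v.
Proof. by rewrite dotvBr !dotvBl (dotvC v u); ring. Qed.

Lemma sqnD_le (R : realType) n (u v : 'cV[R]_n) :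
  sqn (u + v) <= 2 * sqn u + 2 * sqn v.
Proof. by have := sqn_ge0 (u - v); rewrite sqnB sqnD; lra. Qed.

Lemma sqnB_le (R : realType) n (u v : 'cV[R]_n) :
  sqn (u - v) <= 2 * sqn u + 2 * sqn v.
Proof. by have := sqn_ge0 (u + v); rewrite sqnB sqnD; lra. Qed.

Lemma discriminant_le (R : realType) (a b c : R) : 0 <= c ->
  (forall t, 0 <= a + 2 * b * t + c * t ^+ 2) -> b ^+ 2 <= a * c.
Proof.
rewrite le_eqVlt => /predU1P[<- h|c0 h].
  have [->|b0] := eqVneq b 0; first by rewrite expr0n/= mulr0.
  (* With [c = 0] the polynomial is affine, and at this point it equals -1. *)
  have := h (- (a + 1) / (2 * b)); rewrite mul0r addr0 mulrC divfK; last first.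
    by rewrite mulf_neq0// pnatr_eq0.
  lra.
have := h (- b / c).
have -> : a + 2 * b * (- b / c) + c * (- b / c) ^+ 2 = (a * c - b ^+ 2) / c.
  by field; rewrite gt_eqF.
by rewrite pmulr_lge0 ?invr_gt0// subr_ge0.
Qed.

(** The form at [u + t *: v] is a nonnegative quadratic in t, so its discriminant is not positive.
    Semidefiniteness suffices; [rayleigh_min] uses this for a shifted matrix that is not known to be
    definite. *)
Lemma psd_cauchy_schwarz (R : realType) n (S : 'M[R]_n) (u v : 'cV[R]_n) :
  S^T = S -> (forall w, 0 <= dotv w (S *m w)) ->
  dotv u (S *m v) ^+ 2 <= dotv u (S *m u) * dotv v (S *m v).
Proof.
move=> Ss Sp; apply: discriminant_le => // t.
have -> : dotv u (S *m u) + 2 * dotv u (S *m v) * t + dotv v (S *m v) * t ^+ 2 =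
    dotv (u + t *: v) (S *m (u + t *: v)).
  rewrite mulmxDr -scalemxAr !(dotvDr, dotvDl, dotvZl, dotvZr).
  have -> : dotv v (S *m u) = dotv u (S *m v) by rewrite dotv_mulmx Ss dotvC.
  ring.
exact: Sp.
Qed.

Lemma cauchy_schwarz (R : realType) n (u v : 'cV[R]_n) :
  dotv u v ^+ 2 <= sqn u * sqn v.
Proof.
have := @psd_cauchy_schwarz _ _ 1%:M u v; rewrite !mul1mx; apply.
  by rewrite trmx1.
by move=> w; rewrite mul1mx sqn_ge0.
Qed.

(** Each product [v i 0 * v j 0] is at most [sqn v] in absolute value, so the sum of the absolute
    entries is a bound; the extra 1 makes [K] positive even for the zero matrix. *)
Lemma quadratic_bounded (R : realType) n (A : 'M[R]_n) :
  exists2 K, 0 < K & forall v, `|dotv v (A *m v)| <= K * sqn v.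
Proof.
exists (1 + \sum_i \sum_j `|A i j|) => [|v].
  by rewrite ltr_wpDr// sumr_ge0// => i _; rewrite sumr_ge0.
rewrite mulrDl mul1r ler_wpDl ?sqn_ge0// dotvE mulr_suml.
apply: le_trans (ler_norm_sum _ _ _) _; apply: ler_sum => i _.
rewrite mxE mulr_sumr mulr_suml.
apply: le_trans (ler_norm_sum _ _ _) _; apply: ler_sum => j _.
rewrite mulrCA normrM ler_wpM2l// normrM.
have := entry_sq_le_sqn v i; have := entry_sq_le_sqn v j.
rewrite -[v i 0 ^+ 2]real_normK ?num_real// -[v j 0 ^+ 2]real_normK ?num_real//.
by have := sqr_ge0 (`|v i 0| - `|v j 0|); nra.
Qed.

Lemma mulmx_bounded (R : realType) m n (A : 'M[R]_(m, n)) :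
  exists2 K, 0 < K & forall v, sqn (A *m v) <= K * sqn v.
Proof.
have [K K0 h] := quadratic_bounded (A^T *m A); exists K => // v.
apply: le_trans (h v); apply: le_trans (ler_norm _).
by rewrite -mulmxA [leRHS]dotv_mulmx trmxK.
Qed.

(* Where a symmetric C - a%:M is invertible and positive semidefinite, its
   quadratic form is bounded away from 0 on the sphere; hence the infimum a of
   the Rayleigh quotient is an eigenvalue, and no compactness is needed. *)
Lemma rayleigh_min (R : realType) n (C : 'M[R]_n.+1) : C^T = C ->
  exists2 a, eigenvalue C a & forall v, a * sqn v <= dotv v (C *m v).
Proof.
move=> Cs; have [K K0 CK] := quadratic_bounded C.
pose E := [set dotv v (C *m v) | v in [set v | sqn v = 1]].
have E0 : E !=set0.
  exists (dotv (delta_mx 0 0) (C *m delta_mx 0 0)); exists (delta_mx 0 0) => //=.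
  rewrite dotvE (bigD1 0)//= big1 => [|i i0]; rewrite ?mxE ?eqxx ?mulr1 ?addr0//.
  by rewrite (negbTE i0) mul0r.
have Elb : has_lbound E.
  exists (- K) => _ [v /= v1 <-].
  by have := CK v; rewrite v1 mulr1 ler_norml => /andP[].
have Ei : has_inf E by [].
pose a := inf E; have aP v : a * sqn v <= dotv v (C *m v).
  have [->|v0] := eqVneq v 0; first by rewrite mulmx0 !dotv0 mulr0.
  have s0 : 0 < sqn v by rewrite lt_neqAle sqn_ge0 eq_sym sqn_eq0 v0.
  pose r := (Num.sqrt (sqn v))^-1.
  have r2 : r ^+ 2 * sqn v = 1.
    by rewrite exprVn sqr_sqrtr ?sqn_ge0// mulVf// gt_eqF.
  have : a <= dotv (r *: v) (C *m (r *: v)).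
    apply: ge_inf => //; exists (r *: v) => //=.
    by rewrite dotvZl dotvZr mulrA -expr2.
  rewrite -scalemxAr dotvZl dotvZr mulrA -expr2 => h.
  have := ler_wpM2r (ltW s0) h; rewrite mulrAC r2.
  by rewrite mul1r.
exists a => //; rewrite /eigenvalue /eigenspace kermx_eq0 row_free_unit.
apply/negP => Su; pose S := C - a%:M.
have Ss : S^T = S by rewrite /S linearB/= tr_scalar_mx Cs.
have Sq v : dotv v (S *m v) = dotv v (C *m v) - a * sqn v.
  by rewrite mulmxBl mul_scalar_mx dotvBr dotvZr.
have Sp v : 0 <= dotv v (S *m v) by rewrite Sq subr_ge0.
have [K1 K10 SK] := quadratic_bounded S.
have [K2 K20 VK] := mulmx_bounded (invmx S).
have KK : 0 < (K2 * K1)^-1 by rewrite invr_gt0 mulr_gt0.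
(* On the unit sphere, invertibility of [S] gives 1 <= K2 |S v|^2, and Cauchy-Schwarz for the form
   [S] between [S v] and [v] gives |S v|^4 <= K1 |S v|^2 (v . S v). Hence v . S v >= 1 / (K2 K1), so
   the infimum [a] could be raised. *)
suff : a + (K2 * K1)^-1 <= a by rewrite gerDl leNgt KK.
apply: lb_le_inf => // _ [v /= v1 <-].
have qE := Sq v; rewrite v1 mulr1 in qE.
have h1 : 1 <= K2 * sqn (S *m v) by have := VK (S *m v); rewrite mulKmx// v1.
have h2 : sqn (S *m v) ^+ 2 <= K1 * sqn (S *m v) * dotv v (S *m v).
  apply: le_trans (psd_cauchy_schwarz (S *m v) v Ss Sp) _.
  by rewrite ler_wpM2r// (le_trans (ler_norm _) (SK _)).
have s0 : 0 < sqn (S *m v) by have := sqn_ge0 (S *m v); nra.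
have h3 : sqn (S *m v) <= K1 * dotv v (S *m v).
  by rewrite -(ler_pM2l s0) -expr2; apply: le_trans h2 _; rewrite mulrCA mulrA.
have h4 : 1 <= (K2 * K1) * dotv v (S *m v).
  by apply: le_trans h1 _; rewrite -mulrA ler_wpM2l// ltW.
have : (K2 * K1)^-1 <= dotv v (S *m v) by rewrite -div1r ler_pdivrMr ?mulr_gt0 1?mulrC.
by rewrite qE; lra.
Qed.

Lemma eigenvalue_quadratic (R : realType) n (C : 'M[R]_n) a : C^T = C ->
  eigenvalue C a -> exists2 v, 0 < sqn v & dotv v (C *m v) = a * sqn v.
Proof.
move=> Cs /eigenvalueP[v vC v0]; exists v^T.
  by rewrite lt_neqAle sqn_ge0 eq_sym sqn_eq0 trmx_eq0 v0.
by rewrite -[C]Cs -trmx_mul vC linearZ/= dotvZr.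
Qed.

(** The Rayleigh minimum [a] is an eigenvalue and a lower bound of all eigenvalues; the latter is
    needed for [inf] to be meaningful. In dimension 0 both sides vanish. *)
Lemma min_eig_quadratic (R : realType) n (C : 'M[R]_n) v : C^T = C ->
  min_eig C * sqn v <= dotv v (C *m v).
Proof.
case: n C v => [|n] C v Cs.
  by rewrite [v]flatmx0 mulmx0 !dotv0 mulr0.
have [a aC aP] := rayleigh_min Cs.
apply: le_trans (aP v); rewrite ler_wpM2r ?sqn_ge0//.
apply: ge_inf => //; exists a => b /= /(eigenvalue_quadratic Cs)[w w0 wb].
by have := aP w; rewrite wb ler_pM2r.
Qed.

Lemma eigenvalueN (R : realType) n (C : 'M[R]_n) a :
  eigenvalue (- C) a = eigenvalue C (- a).
Proof.
rewrite /eigenvalue /eigenspace !kermx_eq0 -!row_leq_rank -mxrank_opp.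
by rewrite opprB opprK raddfN/= opprK addrC.
Qed.

Lemma max_eig_quadratic (R : realType) n (C : 'M[R]_n) v : C^T = C ->
  dotv v (C *m v) <= max_eig C * sqn v.
Proof.
move=> Cs; have -> : max_eig C = - min_eig (- C).
  rewrite /max_eig /min_eig /inf opprK; congr sup.
  rewrite eqEsubset; split => a /=.
    by move=> aC; exists (- a); rewrite ?opprK//= eigenvalueN opprK.
  by move=> [b /=]; rewrite eigenvalueN => bC <-.
have := @min_eig_quadratic _ _ (- C) v; rewrite linearN/= Cs => /(_ erefl).
by rewrite mulNmx dotvNr; lra.
Qed.

(** Sparse eigenvalues range over sets of size exactly k; enlarging a support to that size makes
    them apply to every sparser vector. *)
Lemma superset_card (T : finType) (A : {set T}) k :
  (#|A| <= k <= #|T|)%N -> exists2 M : {set T}, A \subset M & #|M| = k.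
Proof.
elim: k => [|k IHk] /andP[].
  by rewrite leqn0 => /eqP A0 _; exists A.
rewrite leq_eqVlt => /predU1P[Ak _|Ak kT]; first by exists A.
have [M AM Mk] := IHk (introT andP (conj Ak (ltnW kT))).
have [x xM] : exists x, x \notin M.
  apply/existsP; rewrite -negb_forall; apply/negP => /forallP h.
  by move: kT; rewrite -Mk -cardsT ltnNge subset_leq_card//; apply/fintype.subsetP => x _.
exists (x |: M)%SET; last by rewrite cardsU1 xM Mk.
by apply: fintype.subset_trans AM _; rewrite finset.subsetUr.
Qed.

Definition subvec (R : realType) p (M : {set 'I_p}) (b : 'cV[R]_p) :
  'cV[R]_#|M| := \col_k b (enum_val k) 0.

Lemma supp_out (R : realType) p (b : 'cV[R]_p) (M : {set 'I_p}) j :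
  supp b \subset M -> j \notin M -> b j 0 = 0.
Proof.
move=> /fintype.subsetP bM jM; apply: contraNeq jM => bj.
by apply: bM; rewrite inE.
Qed.

Lemma mulmx_subvec (R : realType) n p (X : 'M[R]_(n, p)) (M : {set 'I_p}) b :
  supp b \subset M -> subcols X M *m subvec M b = X *m b.
Proof.
move=> bM; apply/colP => i; rewrite !mxE (bigID (mem M))/= [X in _ + X]big1.
  by rewrite addr0 [RHS]big_enum_val; apply: eq_bigr => k _; rewrite !mxE.
by move=> j jM; rewrite (supp_out bM jM) mulr0.
Qed.

Lemma sqn_subvec (R : realType) p (M : {set 'I_p}) (b : 'cV[R]_p) :
  supp b \subset M -> sqn (subvec M b) = sqn b.
Proof.
move=> bM; rewrite !dotvE [RHS](bigID (mem M))/= [X in _ + X]big1.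
  by rewrite addr0 [RHS]big_enum_val; apply: eq_bigr => k _; rewrite !mxE.
by move=> j jM; rewrite (supp_out bM jM) mulr0.
Qed.

(** [ls_fit dat M] unfolds to [extend (ls_coef dat M)], so the lemmas on [extend] apply to
    least-squares fits. *)
Definition extend (R : realType) p (M : {set 'I_p}) (v : 'cV[R]_#|M|) :
  'cV[R]_p := subcols 1%:M M *m v.

Lemma mulmx_extend (R : realType) n p (X : 'M[R]_(n, p)) (M : {set 'I_p}) v :
  X *m extend v = subcols X M *m v.
Proof.
rewrite /extend mulmxA; congr (_ *m _); apply/matrixP => i k.
rewrite !mxE (bigD1 (enum_val k))//= big1 => [|j jk]; rewrite !mxE.
  by rewrite eqxx mulr1 addr0.
by rewrite (negbTE jk) mulr0.
Qed.

Lemma extend_in (R : realType) p (M : {set 'I_p}) (v : 'cV[R]_#|M|) k :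
  extend v (enum_val k) 0 = v k 0.
Proof.
rewrite /extend !mxE (bigD1 k)//= big1 => [|j jk]; rewrite !mxE.
  by rewrite eqxx mul1r addr0.
by rewrite (inj_eq enum_val_inj) eq_sym (negbTE jk) mul0r.
Qed.

Lemma extend_out (R : realType) p (M : {set 'I_p}) (v : 'cV[R]_#|M|) j :
  j \notin M -> extend v j 0 = 0.
Proof.
move=> jM; rewrite /extend !mxE big1// => k _; rewrite !mxE.
case: eqP => [jk|_]; last by rewrite mul0r.
by move: jM; rewrite jk enum_valP.
Qed.

Lemma supp_extend (R : realType) p (M : {set 'I_p}) (v : 'cV[R]_#|M|) :
  supp (extend v) \subset M.
Proof.
apply/fintype.subsetP => j; rewrite inE; apply: contraR => jM.
by rewrite extend_out.
Qed.

Lemma sqn_extend (R : realType) p (M : {set 'I_p}) (v : 'cV[R]_#|M|) :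
  sqn (extend v) = sqn v.
Proof.
rewrite -(sqn_subvec (supp_extend v)); congr dotv; apply/colP => k;
by rewrite mxE extend_in.
Qed.

Lemma sym_gram (R : realType) n p (X : 'M[R]_(n, p)) (M : {set 'I_p}) :
  (gram X M)^T = gram X M.
Proof. by rewrite /gram linearZ/= trmx_mul trmxK. Qed.

Lemma gram_quadratic (R : realType) n p (X : 'M[R]_(n, p)) (M : {set 'I_p}) v :
  dotv v (gram X M *m v) = n%:R^-1 * sqn (subcols X M *m v).
Proof.
by rewrite /gram -scalemxAl dotvZr -mulmxA dotv_mulmx trmxK.
Qed.

Lemma min_sparse_eig_le (R : realType) n p (X : 'M[R]_(n, p)) (M : {set 'I_p}) :
  min_sparse_eig X #|M| <= min_eig (gram X M).
Proof.
apply: ge_inf; last by exists M.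
(* The infimum runs over finitely many sets, so the sum of all absolute values, negated, is a crude
   lower bound, as [ge_inf] requires. *)
exists (- \sum_(N : {set 'I_p}) `|min_eig (gram X N)|) => _ [N /= _ <-].
rewrite lerNl (bigD1 N)//=; apply: le_trans (_ : `|min_eig (gram X N)| <= _).
  by rewrite -normrN ler_norm.
by rewrite lerDl sumr_ge0.
Qed.

Lemma max_sparse_eig_ge (R : realType) n p (X : 'M[R]_(n, p)) (M : {set 'I_p}) :
  max_eig (gram X M) <= max_sparse_eig X #|M|.
Proof.
apply: ub_le_sup; last by exists M.
exists (\sum_(N : {set 'I_p}) `|max_eig (gram X N)|) => _ [N /= _ <-].
rewrite (bigD1 N)//=; apply: le_trans (ler_norm _) _.
by rewrite lerDl sumr_ge0.
Qed.

Lemma min_sparse_eig_sqn (R : realType) n p (X : 'M[R]_(n, p)) k b :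
  (0 < n)%N -> (#|supp b| <= k <= p)%N ->
  n%:R * min_sparse_eig X k * sqn b <= sqn (X *m b).
Proof.
move=> n0 kp; have [|M bM <-] := @superset_card _ (supp b) k.
  by rewrite card_ord.
rewrite -(mulmx_subvec _ bM) -(sqn_subvec bM).
have := min_eig_quadratic (subvec M b) (sym_gram X M).
rewrite gram_quadratic -ler_pdivrMl ?invr_gt0 ?ltr0n// invrK; apply: le_trans.
rewrite -mulrA ler_wpM2l// ler_wpM2r ?sqn_ge0//.
exact: min_sparse_eig_le.
Qed.

Lemma max_sparse_eig_sqn (R : realType) n p (X : 'M[R]_(n, p)) k b :
  (0 < n)%N -> (#|supp b| <= k <= p)%N ->
  sqn (X *m b) <= n%:R * max_sparse_eig X k * sqn b.
Proof.
move=> n0 kp; have [|M bM <-] := @superset_card _ (supp b) k.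
  by rewrite card_ord.
rewrite -(mulmx_subvec _ bM) -(sqn_subvec bM).
have := max_eig_quadratic (subvec M b) (sym_gram X M).
rewrite gram_quadratic ler_pdivrMl ?ltr0n// => h; apply: le_trans h _.
rewrite -mulrA ler_wpM2l// ler_wpM2r ?sqn_ge0//.
exact: max_sparse_eig_ge.
Qed.

(** * The lasso and least squares on a typical data set *)

Definition l1norm (R : realType) p (b : 'cV[R]_p) : R := \sum_j `|b j 0|.

Lemma l1norm_ge0 (R : realType) p (b : 'cV[R]_p) : 0 <= l1norm b.
Proof. by rewrite sumr_ge0. Qed.

Lemma sqn_le_l1norm (R : realType) p (b : 'cV[R]_p) :
  sqn b <= l1norm b ^+ 2.
Proof.
rewrite dotvE expr2 {2}/l1norm mulr_sumr; apply: ler_sum => j _.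
rewrite -expr2 -real_normK ?num_real// expr2 ler_wpM2r//.
by rewrite /l1norm (bigD1 j)//= lerDl sumr_ge0.
Qed.

Lemma l1normB (R : realType) p (b c : 'cV[R]_p) :
  l1norm (b - c) <= l1norm b + l1norm c.
Proof.
by rewrite -big_split/=; apply: ler_sum => j _; rewrite !mxE ler_normB.
Qed.

Lemma supp_sub (R : realType) p (b c : 'cV[R]_p) :
  supp (b - c) \subset supp b :|: supp c.
Proof.
apply/fintype.subsetP => j; rewrite !inE !mxE -negb_and; apply: contra.
by move=> /andP[/eqP-> /eqP->]; rewrite subr0.
Qed.

Lemma lasso_objectiveE (R : realType) n p (dat : dataset R n p) lam b :
  lasso_objective dat lam b =
  sqn (responses dat - design dat *m b) + lam * l1norm b.
Proof.
by rewrite /lasso_objective dotvE; congr (_ + _); apply: eq_bigr => i _;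
   rewrite expr2 !mxE.
Qed.

Definition is_lasso (R : realType) n p (X : 'M[R]_(n, p)) (y : 'cV[R]_n)
    (lam : R) (b : 'cV[R]_p) : Prop :=
  forall b', sqn (y - X *m b) + lam * l1norm b <=
             sqn (y - X *m b') + lam * l1norm b'.

(** Compare the objective at [b] and at [b] moved by [t] along coordinate [j]. Both KKT bounds below
    follow by letting [t] tend to 0, without subgradients. *)
Lemma is_lasso_dir (R : realType) n p (X : 'M[R]_(n, p)) y lam b j t :
  is_lasso X y lam b ->
  0 <= t ^+ 2 * sqn (col j X) - 2 * t * (X^T *m (y - X *m b)) j 0
       + lam * (`|b j 0 + t| - `|b j 0|).
Proof.
move=> /(_ (b + t *: delta_mx j 0)).
rewrite mulmxDr opprD addrA -scalemxAr -colE.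
set r := y - X *m b; rewrite (sqnB r) !(dotvZl, dotvZr).
have -> : dotv r (col j X) = (X^T *m r) j 0.
  by rewrite dotvE !mxE; apply: eq_bigr => i _; rewrite !mxE mulrC.
have -> : l1norm (b + t *: delta_mx j 0) =
    l1norm b + (`|b j 0 + t| - `|b j 0|).
  rewrite /l1norm (bigD1 j)//= [in RHS](bigD1 j)//= !mxE !eqxx mulr1.
  rewrite (eq_bigr (fun i => `|b i 0|)); first by ring.
  by move=> i ij; rewrite !mxE (negbTE ij) mulr0 addr0.
by lra.
Qed.

Lemma lasso_kkt_le (R : realType) n p (X : 'M[R]_(n, p)) y lam b j :
  0 <= lam -> is_lasso X y lam b ->
  `|(X^T *m (y - X *m b)) j 0| <= lam / 2.
Proof.
move=> lam0 bP; set g := (X^T *m _) j 0.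
have key t : 0 <= t ^+ 2 * sqn (col j X) - 2 * t * g + lam * `|t|.
  apply: le_trans (is_lasso_dir j t bP) _; rewrite lerD2l ler_wpM2l//.
  by rewrite lerBlDl ler_normD.
have [s c0] : {s | s = sqn (col j X)} * (0 <= sqn (col j X)).
  by split; [exists (sqn (col j X))|exact: sqn_ge0].
have key2 e : 0 < e -> 2 * `|g| <= e * sqn (col j X) + lam.
  move=> e0; rewrite -(ler_pM2l e0).
  have := key e; have := key (- e).
  rewrite normrN (ger0_norm (ltW e0)) sqrrN.
  by case: (lerP 0 g) => [/ger0_norm|/ltr0_norm] ->; nra.
rewrite ler_pdivlMr// mulrC.
apply/ler_addgt0Pr => e e0.
(* This step size makes the quadratic term at most [e]; adding 1 covers a zero column. *)
have := key2 (e / (sqn (col j X) + 1)).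
have c1 : 0 < sqn (col j X) + 1 by lra.
rewrite divr_gt0// => /(_ isT) /le_trans; apply; rewrite addrC lerD2l.
by rewrite mulrAC ler_pdivrMr// ler_pM2l//; lra.
Qed.

(** For a nonzero coordinate, a move towards 0 by at most [|b j 0|] lowers the penalty by exactly
    lam times its length, so optimality forces a correlation of at least lam / 2. *)
Lemma lasso_kkt_ge (R : realType) n p (X : 'M[R]_(n, p)) y lam b j :
  0 <= lam -> is_lasso X y lam b -> j \in supp b ->
  lam / 2 <= `|(X^T *m (y - X *m b)) j 0|.
Proof.
move=> lam0 bP; rewrite inE => bj; set g := (X^T *m _) j 0.
have key t := is_lasso_dir j t bP; rewrite -/g in key.
have c0 := sqn_ge0 (col j X); set c := sqn _ in c0 key.
have b0 : 0 < `|b j 0| by rewrite normr_gt0.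
have key2 e : 0 < e -> e <= `|b j 0| -> lam <= e * c + 2 * `|g|.
  move=> e0 eb; rewrite -(ler_pM2l e0).
  have [bp|bn] := ltrP 0 (b j 0).
    rewrite gtr0_norm// in eb.
    have := key (- e); rewrite (gtr0_norm bp) ger0_norm; last by lra.
    rewrite sqrrN; have := ler_norm g; have := ler_norm (- g); rewrite normrN.
    by nra.
  rewrite ler0_norm// in eb.
  have := key e; rewrite (ler0_norm bn) ler0_norm; last by lra.
  by have := ler_norm g; have := ler_norm (- g); rewrite normrN; nra.
rewrite ler_pdivrMr// mulrC.
apply/ler_addgt0Pr => e e0.
have c1 : 0 < c + 1 by lra.
pose d := Num.min `|b j 0| (e / (c + 1)).
have d0 : 0 < d by rewrite lt_min b0 divr_gt0.
have := key2 d d0; rewrite ge_min lexx => /(_ isT) /le_trans; apply.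
rewrite addrC lerD2l; apply: (@le_trans _ _ (e / (c + 1) * c)).
  by rewrite ler_wpM2r// ge_min lexx orbT.
by rewrite mulrAC ler_pdivrMr// ler_pM2l//; lra.
Qed.

(** The bounds on Phi_n(n) and phi_n(k1) as inequalities for all vectors with supports up to the
    given size; in this form they apply without first enlarging the support. *)
Definition design_bounds (R : realType) n p (X : 'M[R]_(n, p)) (C0 kap : R)
    (k1 : nat) : Prop :=
  (forall b, (#|supp b| <= n)%N -> sqn (X *m b) <= n%:R * C0 * sqn b) /\
  (forall b, (#|supp b| <= k1)%N -> n%:R * kap * sqn b <= sqn (X *m b)).

(* The last clause keeps the KKT conditions from holding with a small penalty. *)
Definition noise_bounds (R : realType) n p (X : 'M[R]_(n, p)) (e : 'cV[R]_n)
    (c tau t : R) (k2 : nat) : Prop :=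
  [/\ sqn e <= tau * n%:R,
      forall b, (#|supp b| <= k2)%N ->
        dotv e (X *m b) ^+ 2 <= t * sqn (X *m b) &
      exists2 N : {set 'I_p}, (#|N| <= n)%N &
        c * n%:R ^+ 2 <= \sum_(j in N) (X^T *m e) j 0 ^+ 2].

(** The transpose of a matrix has the same operator norm: with [v] the restriction of [X^T *m r] to
    [N], the sum S equals both [sqn v] and (X v) . r, so Cauchy-Schwarz gives S^2 <= n C0 S
    |r|^2. *)
Lemma tr_design_bound (R : realType) n p (X : 'M[R]_(n, p)) C0 kap k1
    (N : {set 'I_p}) r : design_bounds X C0 kap k1 -> 0 <= C0 ->
  (#|N| <= n)%N ->
  \sum_(j in N) (X^T *m r) j 0 ^+ 2 <= n%:R * C0 * sqn r.
Proof.
move=> [g1 _] C00 Nn; set S := \sum_(j in N) _.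
pose v : 'cV[R]_p := \col_j (if j \in N then (X^T *m r) j 0 else 0).
have vN : supp v \subset N.
  by apply/fintype.subsetP => j; rewrite !inE !mxE; case: ifP => // _ /eqP.
have SE : S = dotv v (X^T *m r).
  rewrite dotvE (bigID (mem N))/= [X in _ + X]big1 ?addr0 => [|j /negbTE jN].
    by apply: eq_bigr => j jN; rewrite [v j 0]mxE jN expr2.
  by rewrite [v j 0]mxE jN mul0r.
have SE2 : S = sqn v.
  rewrite dotvE (bigID (mem N))/= [X in _ + X]big1 ?addr0 => [|j /negbTE jN].
    by apply: eq_bigr => j jN; rewrite [v j 0]mxE jN expr2.
  by rewrite mxE jN mul0r.
have := cauchy_schwarz (X *m v) r.
rewrite -{1}[X]trmxK -dotv_mulmx -SE => h.
have S0 : 0 <= S by rewrite SE2 sqn_ge0.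
have := g1 v (leq_trans (subset_leq_card vN) Nn); rewrite -SE2 => h2.
have : S ^+ 2 <= n%:R * C0 * S * sqn r.
  by apply: le_trans h _; rewrite ler_wpM2r// sqn_ge0.
have [->|Sn0] := eqVneq S 0; first by rewrite !mulr_ge0// sqn_ge0.
rewrite mulrAC expr2 ler_pM2r// lt_neqAle S0 andbT eq_sym//.
Qed.

(** The basic inequality: compare with the candidate [beta], whose residual is [e], and cancel
    [sqn e]. *)
Lemma lasso_basic (R : realType) n p (X : 'M[R]_(n, p)) (e : 'cV[R]_n)
    (beta b : 'cV[R]_p) lam : is_lasso X (X *m beta + e) lam b ->
  sqn (X *m (b - beta)) <=
  2 * dotv e (X *m (b - beta)) + lam * (l1norm beta - l1norm b).
Proof.
move=> /(_ beta).
have -> : X *m beta + e - X *m b = e - X *m (b - beta).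
  by rewrite mulmxBr opprB addrA (addrC e).
have -> : X *m beta + e - X *m beta = e by rewrite addrAC subrr add0r.
by rewrite sqnB; lra.
Qed.

Lemma threshold_card (R : realType) p (h : 'cV[R]_p) (H th : R) (k : nat) :
  0 < th -> l1norm h <= H -> H / th <= k%:R ->
  (#|[set j | (th <= `|h j 0|)%R]%SET| <= k)%N.
Proof.
move=> th0 hH Hk; rewrite -(ler_nat R); apply: le_trans Hk.
rewrite ler_pdivlMr// (le_trans _ hH)// mulr_natl -sumr_const.
rewrite [leRHS](bigID (mem [set j | th <= `|h j 0|]%SET))/=.
rewrite -[leLHS]addr0 lerD ?sumr_ge0//.
by apply: ler_sum => j; rewrite inE.
Qed.

(* The coordinates of h above the threshold th are at most k1 in number, so
   the restricted eigenvalue applies to them; the others have squared norm at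
   most th * H and are controlled by the largest sparse eigenvalue. *)
Lemma missed_signal_bound (R : realType) n p (X : 'M[R]_(n, p)) C0 kap k1
    (h : 'cV[R]_p) (H th psi : R) j :
  design_bounds X C0 kap k1 -> 0 <= C0 -> 0 <= kap ->
  (#|supp h| <= n)%N ->
  0 < th -> l1norm h <= H -> H / th <= k1%:R ->
  th <= psi -> psi <= `|h j 0| ->
  n%:R * kap * psi ^+ 2 <= 2 * sqn (X *m h) + 2 * (n%:R * C0 * (th * H)).
Proof.
move=> [g1 g2] C00 kap0 hn th0 hH Hk thp ph.
pose T := [set j | th <= `|h j 0|]%SET.
pose u : 'cV[R]_p := \col_i (if i \in T then h i 0 else 0).
have uk : (#|supp u| <= k1)%N.
  apply: leq_trans (threshold_card th0 hH Hk); apply: subset_leq_card.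
  apply/fintype.subsetP => i; rewrite [i \in supp u]inE mxE.
  by case: ifP => // _ /eqP.
have wE i : (h - u) i 0 = if i \in T then 0 else h i 0.
  by rewrite !mxE; case: ifP; rewrite ?subrr ?subr0.
have wn : (#|supp (h - u)| <= n)%N.
  apply: leq_trans hn; apply: subset_leq_card; apply/fintype.subsetP => i.
  by rewrite [i \in _]inE wE [in X in _ -> X]inE; case: ifP => // _ /eqP.
have psi0 : 0 <= psi by lra.
have u1 : psi ^+ 2 <= sqn u.
  apply: le_trans (entry_sq_le_sqn u j).
  rewrite mxE inE (le_trans thp ph) -[leRHS]real_normK ?num_real//.
  by rewrite lerXn2r ?nnegrE.
have H0 : 0 <= H by apply: le_trans hH; exact: l1norm_ge0.
have w1 : sqn (h - u) <= th * H.
  apply: le_trans (_ : th * l1norm h <= _); last by rewrite ler_pM2l.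
  rewrite dotvE mulr_sumr; apply: ler_sum => i _; rewrite wE inE.
  case: (lerP th) => [_|hi]; first by rewrite mul0r mulr_ge0// ltW.
  rewrite -expr2 -real_normK ?num_real// expr2 ler_wpM2r// ltW//.
have n0 : 0 <= n%:R :> R by rewrite ler0n.
have e1 := g2 _ uk; have e2 := g1 _ wn.
have e3 := sqnB_le (X *m h) (X *m (h - u)).
rewrite -mulmxBr subKr in e3.
have e4 : n%:R * kap * psi ^+ 2 <= n%:R * kap * sqn u.
  by rewrite ler_wpM2l// mulr_ge0.
have e5 : n%:R * C0 * sqn (h - u) <= n%:R * C0 * (th * H).
  by rewrite ler_wpM2l// mulr_ge0.
by lra.
Qed.

Lemma card_suppB_le (R : realType) p (b beta : 'cV[R]_p) k s : (#|supp b| <= k)%N ->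
  (#|supp beta| <= s)%N -> (#|supp (b - beta)%R| <= k + s)%N.
Proof.
move=> bk bs; apply: leq_trans (subset_leq_card (supp_sub _ _)) _.
by rewrite cardsU (leq_trans (leq_subr _ _))// leq_add.
Qed.

Lemma le_of_sqr (R : realType) (x y : R) : 0 <= y -> x ^+ 2 <= y ^+ 2 -> x <= y.
Proof. by move=> y0 xy; rewrite leNgt; apply/negP => yx; nra. Qed.

(** Suppose lam < l0. On the columns in [N] the KKT conditions bound the correlations with the
    residual [e - X *m h] by lam / 2, and [tr_design_bound] bounds those with [X *m h], whose norm
    the basic inequality controls. Their sum is too small for the lower bound c n^2 on the
    correlations with [e]. *)
Lemma lasso_penalty_lower_bound (R : realType) n p (X : 'M[R]_(n, p)) C0 kap k1
    (e : 'cV[R]_n) c tau t k2 (beta b : 'cV[R]_p) lam B1 l0 :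
  design_bounds X C0 kap k1 -> noise_bounds X e c tau t k2 ->
  is_lasso X (X *m beta + e) lam b -> 0 <= C0 -> 0 <= lam -> 0 <= t ->
  (#|supp (b - beta)%R| <= k2)%N -> l1norm beta <= B1 ->
  l0 ^+ 2 / 2 + 2 * C0 * (4 * t + 2 * l0 * B1) < n%:R * c -> (0 < n)%N ->
  sqn (X *m (b - beta)) <= 4 * t + 2 * lam * B1 /\
  lam * (l1norm b - B1) <= t /\ l0 <= lam.
Proof.
move=> gX [g3 g4 [N Nn g5]] bP C00 lam0 t0 hk b1 num n0.
have bas := lasso_basic bP; have a2 := g4 _ hk.
set h := b - beta in bas a2 hk *; set a := sqn (X *m h) in bas a2 *.
set w := dotv e (X *m h) in bas a2.
have a0 : 0 <= a by exact: sqn_ge0.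
(* From w^2 <= t a, two uses of the inequality between means: this one leaves half of [a] and bounds
   the prediction error; [w3] absorbs all of [a] and leaves the bound on the l1 norm. *)
have w2 : 2 * w <= 2 * t + a / 2.
  have : (2 * w) ^+ 2 <= (2 * t + a / 2) ^+ 2.
    by have := sqr_ge0 (2 * t - a / 2); lra.
  by apply: le_of_sqr; lra.
have w3 : 2 * w <= t + a.
  have : (2 * w) ^+ 2 <= (t + a) ^+ 2 by have := sqr_ge0 (t - a); lra.
  by apply: le_of_sqr; lra.
have bb0 := l1norm_ge0 b.
have lb : lam * l1norm beta <= lam * B1 by rewrite ler_wpM2l.
have lb0 : 0 <= lam * l1norm b by rewrite mulr_ge0.
have aE : a <= 4 * t + 2 * lam * B1 by lra.
split=> //; split; first by lra.
rewrite leNgt; apply/negP => laml0.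
have B10 : 0 <= B1 by apply: le_trans b1; exact: l1norm_ge0.
have S1 : \sum_(j in N) (X^T *m (e - X *m h)) j 0 ^+ 2 <= n%:R * (lam ^+ 2 / 4).
  apply: le_trans (_ : \sum_(j in N) lam ^+ 2 / 4 <= _).
    apply: ler_sum => j _; have := lasso_kkt_le j lam0 bP.
    have -> : X *m beta + e - X *m b = e - X *m h.
      by rewrite mulmxBr opprB addrA (addrC e).
    rewrite ler_norml => /andP[]; set g := (X^T *m _) j 0 => ga gb.
    by nra.
  by rewrite sumr_const -[_ *+ #|N|]mulr_natl ler_wpM2r ?ler_nat// divr_ge0// sqr_ge0.
have S2 := tr_design_bound (X *m h) gX C00 Nn.
have S3 : \sum_(j in N) (X^T *m e) j 0 ^+ 2 <=
    2 * (\sum_(j in N) (X^T *m (e - X *m h)) j 0 ^+ 2) +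
    2 * (\sum_(j in N) (X^T *m (X *m h)) j 0 ^+ 2).
  rewrite !mulr_sumr -big_split/=; apply: ler_sum => j _.
  have -> : (X^T *m e) j 0 = (X^T *m (e - X *m h)) j 0 + (X^T *m (X *m h)) j 0.
    by rewrite mulmxBr !mxE subrK.
  by have := sqr_ge0 ((X^T *m (e - X *m h)) j 0 - (X^T *m (X *m h)) j 0); nra.
have n1 : 0 < n%:R :> R by rewrite ltr0n.
have S4 : n%:R * C0 * a <= n%:R * (C0 * (4 * t + 2 * lam * B1)).
  by rewrite -mulrA ler_pM2l// ler_wpM2l.
have S5 : c * n%:R ^+ 2 <= n%:R * (lam ^+ 2 / 2 + 2 * C0 * (4 * t + 2 * lam * B1)).
  by move: S1 S2 S3 S4 g5; rewrite -/a; lra.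
rewrite (_ : c * n%:R ^+ 2 = n%:R * (n%:R * c)) in S5; last by ring.
rewrite ler_pM2l// in S5.
have l1 : lam ^+ 2 <= l0 ^+ 2 by rewrite lerXn2r ?nnegrE//; lra.
have l2 : C0 * (lam * B1) <= C0 * (l0 * B1) by rewrite ler_wpM2l// ler_wpM2r// ltW.
by move: S5 num; lra.
Qed.

(** Since t <= T1 l0 <= T1 lam, the l1 norm of [b] is at most B1 + T1 and that of [b - beta] at most
    2 B1 + T1. A missed coordinate has error at least psi, and [missed_signal_bound] then
    contradicts the smallness of the prediction error. *)
Lemma lasso_keeps_signal (R : realType) n p (X : 'M[R]_(n, p)) (C0 kap : R) k1
    (e : 'cV[R]_n) (c tau t : R) k2 (beta b : 'cV[R]_p)
    (lam L B1 l0 T1 th psi : R) :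
  design_bounds X C0 kap k1 -> noise_bounds X e c tau t k2 ->
  is_lasso X (X *m beta + e) lam b ->
  0 <= C0 -> 0 <= kap -> 0 <= lam <= L -> 0 <= t -> (0 < n)%N ->
  (#|supp (b - beta)%R| <= k2)%N -> (k2 <= n)%N -> l1norm beta <= B1 ->
  (forall j, j \in supp beta -> psi <= `|beta j 0|) ->
  l0 ^+ 2 / 2 + 2 * C0 * (4 * t + 2 * l0 * B1) < n%:R * c ->
  0 < l0 -> t <= T1 * l0 ->
  0 < th -> (2 * B1 + T1) / th <= k1%:R -> th <= psi ->
  2 * (4 * t + 2 * L * B1) + 2 * (n%:R * C0 * (th * (2 * B1 + T1)))
    < n%:R * kap * psi ^+ 2 ->
  supp beta \subset supp b.
Proof.
move=> gX ge bP C00 kap0 /andP[lam0 lamL] t0 n0 hk k2n b1 bpsi num l00 tT th0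
  Hk thpsi num2.
have [aE [lB laml0]] := lasso_penalty_lower_bound gX ge bP C00 lam0 t0 hk b1 num n0.
apply/fintype.subsetP => j jb; apply: contraT => jn.
have hj : psi <= `|(b - beta) j 0|.
  by rewrite !mxE (supp_out (fintype.subxx _) jn) sub0r normrN bpsi.
have lam1 : 0 < lam by lra.
have B10 : 0 <= B1 by apply: le_trans b1; exact: l1norm_ge0.
have l1b : l1norm b <= B1 + T1.
  rewrite leNgt; apply/negP => lt1.
  have : l0 * T1 < lam * (l1norm b - B1).
    have T10 : 0 <= T1 by nra.
    by apply: le_lt_trans (_ : lam * T1 < _); [rewrite ler_wpM2r|rewrite ltr_pM2l//; lra].
  by lra.
have hH : l1norm (b - beta) <= 2 * B1 + T1.
  by apply: le_trans (l1normB _ _) _; lra.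
have := missed_signal_bound gX C00 kap0 (leq_trans hk k2n) th0 hH Hk thpsi hj.
have : lam * B1 <= L * B1 by rewrite ler_wpM2r.
by lra.
Qed.

(** Each selected column has correlation at least L / 2 with the residual, and [tr_design_bound]
    limits how many can: the residual is no longer than the response, as comparison with the zero
    vector shows. *)
Lemma lasso_sparse (R : realType) n p (X : 'M[R]_(n, p)) (C0 kap : R) k1
    (e : 'cV[R]_n) (tau : R) (beta b : 'cV[R]_p) (lam L B1 : R) (K : nat) :
  design_bounds X C0 kap k1 -> sqn e <= tau * n%:R ->
  is_lasso X (X *m beta + e) lam b ->
  0 <= C0 -> 0 <= L <= lam -> (#|supp beta| <= n)%N -> l1norm beta <= B1 ->
  (K < n)%N ->
  4 * (n%:R * C0 * (2 * (n%:R * C0 * B1 ^+ 2) + 2 * (tau * n%:R)))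
    < K.+1%:R * L ^+ 2 ->
  (#|supp b| <= K)%N.
Proof.
move=> gX ge bP C00 /andP[L0 Llam] bn b1 Kn num; rewrite leqNgt; apply/negP => Kb.
have lam0 : 0 <= lam by lra.
(* Only K + 1 selected columns are kept, because [tr_design_bound] accepts at most n of them and the
   selected set may be larger. *)
have [N [Nb NK]] : exists N : {set 'I_p}, N \subset supp b /\ #|N| = K.+1.
  pose r := take K.+1 (enum (supp b)).
  have ru : uniq r by rewrite take_uniq// enum_uniq.
  exists [set x in r]; split.
    apply/fintype.subsetP => x; rewrite inE => /mem_take.
    by rewrite mem_enum.
  by rewrite cardsE (card_uniqP ru) size_takel// -cardE.
have NN : (#|N| <= n)%N by rewrite NK.
have S1 := tr_design_bound (X *m beta + e - X *m b) gX C00 NN.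
have S2 : K.+1%:R * (L ^+ 2 / 4) <=
    \sum_(j in N) (X^T *m (X *m beta + e - X *m b)) j 0 ^+ 2.
  rewrite -NK mulr_natl -sumr_const; apply: ler_sum => j jN.
  have := lasso_kkt_ge lam0 bP (fintype.subsetP Nb _ jN).
  rewrite -[X in _ -> _ <= X]real_normK ?num_real// => h.
  by nra.
have S3 : sqn (X *m beta + e - X *m b) <= sqn (X *m beta + e).
  have := bP 0; rewrite mulmx0 subr0.
  have -> : l1norm (0 : 'cV[R]_p) = 0.
    by rewrite /l1norm big1// => i _; rewrite mxE normr0.
  by have : 0 <= lam * l1norm b by [rewrite mulr_ge0// l1norm_ge0]; lra.
have S4 := sqnD_le (X *m beta) e.
have [g1 _] := gX; have S5 := g1 _ bn.
have n1 : 0 <= n%:R * C0 :> R by rewrite mulr_ge0.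
have S6 : n%:R * C0 * sqn beta <= n%:R * C0 * B1 ^+ 2.
  rewrite ler_wpM2l// (le_trans (sqn_le_l1norm _))// lerXn2r ?nnegrE ?l1norm_ge0//.
  by apply: le_trans b1; exact: l1norm_ge0.
have S7 : n%:R * C0 * sqn (X *m beta + e - X *m b) <=
    n%:R * C0 * (2 * (n%:R * C0 * B1 ^+ 2) + 2 * (tau * n%:R)).
  by rewrite ler_wpM2l//; lra.
by lra.
Qed.

(** * Least squares on a selected model *)

Lemma ls_normal_equations (R : realType) n p (dat : dataset R n p)
    (M : {set 'I_p}) v :
  let X := design dat in
  (subcols X M)^T *m subcols X M \in unitmx -> supp v \subset M ->
  dotv (responses dat - X *m ls_fit dat M) (X *m v) = 0.
Proof.
move=> X Xu vM; rewrite -(mulmx_subvec X vM) dotv_mulmx.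
rewrite /ls_fit mulmxA mulmxBr -!mulmxA.
rewrite -[X in subcols _ _ *m X]/(_ *m _) -[subcols 1%:M M *m _]/(extend _).
rewrite mulmx_extend /ls_coef -/X !mulmxA mulmxV// mul1mx subrr.
by rewrite /dotv trmx0 mul0mx mxE.
Qed.

(** When the model contains the signal, the error vector [g] is supported in the model, so the
    residual [e - X *m g] is orthogonal to [X *m g]. Thus |X g|^2 = e . X g, and the hypothesis
    turns this into a bound by t. *)
Lemma ls_overfit_bound (R : realType) n p (dat : dataset R n p)
    (M : {set 'I_p}) (beta : 'cV[R]_p) e t :
  let X := design dat in 0 <= t ->
  responses dat = X *m beta + e ->
  (subcols X M)^T *m subcols X M \in unitmx -> supp beta \subset M ->
  dotv e (X *m (ls_fit dat M - beta)) ^+ 2 <=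
    t * sqn (X *m (ls_fit dat M - beta)) ->
  sqn (X *m (ls_fit dat M - beta)) <= t.
Proof.
move=> X t0 yE Xu bM; set g := ls_fit dat M - beta => eg.
have gM : supp g \subset M.
  apply: fintype.subset_trans (supp_sub _ _) _; rewrite finset.subUset bM andbT.
  exact: supp_extend.
have := ls_normal_equations Xu gM.
have -> : responses dat - design dat *m ls_fit dat M = e - X *m g.
  by rewrite yE mulmxBr opprB addrA (addrC e).
rewrite dotvBl => /eqP; rewrite subr_eq0 => /eqP egE.
have := sqn_ge0 (X *m g); move: eg; rewrite -/X egE.
have [-> //|s0] := eqVneq (sqn (X *m g)) 0.
rewrite expr2 => h h0.
by rewrite -(@ler_pM2r _ (sqn (X *m g)))// lt_neqAle eq_sym s0.
Qed.

(* The eigenvalue and noise bounds hold up to sizes k1 and k2. Penalties below L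
   lose no signal, those above L select at most K covariates, and those in
   Lambda_n are at least l0; th is the threshold at which b - beta is cut. *)
Record tuning (R : realType) (n k1 k2 s K : nat)
    (C0 kap c tau t L B1 l0 T1 th psi bound : R) : Prop := Tuning {
  tn_n : (0 < n)%N;
  tn_C0 : 0 <= C0;
  tn_kap : 0 < kap;
  tn_t : 0 <= t;
  tn_L : 0 <= L;
  tn_l0 : 0 < l0;
  tn_th : 0 < th;
  tn_psi : th <= psi;
  tn_k2n : (k2 <= n)%N;
  tn_size : forall m : nat, m%:R <= bound -> (m + s <= k2)%N;
  tn_K : K%:R <= bound;
  tn_Kn : (K < n)%N;
  tn_Kk1 : (K + s <= k1)%N;
  tn_sparse : 4 * (n%:R * C0 * (2 * (n%:R * C0 * B1 ^+ 2) + 2 * (tau * n%:R)))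
    < K.+1%:R * L ^+ 2;
  tn_penalty : l0 ^+ 2 / 2 + 2 * C0 * (4 * t + 2 * l0 * B1) < n%:R * c;
  tn_T1 : t <= T1 * l0;
  tn_k1 : (2 * B1 + T1) / th <= k1%:R;
  tn_signal : 2 * (4 * t + 2 * L * B1) + 2 * (n%:R * C0 * (th * (2 * B1 + T1)))
    < n%:R * kap * psi ^+ 2;
  tn_loss : 2 * (3 * t + 2 * (C0 * t / kap)) < n%:R * kap * psi ^+ 2 }.

Definition good_data (R : realType) n p (dat : dataset R n p)
    (beta : 'cV[R]_p) (k1 k2 : nat) (C0 kap c tau t : R) : Prop :=
  let X := design dat in
  [/\ design_bounds X C0 kap k1,
      noise_bounds X (responses dat - X *m beta) c tau t k2 &
      forall M : {set 'I_p}, (#|M| <= n)%N ->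
        (subcols X M)^T *m subcols X M \in unitmx].

Definition signal_bounds (R : realType) p (beta : 'cV[R]_p) (s : nat)
    (B1 psi : R) : Prop :=
  [/\ (#|supp beta| <= s)%N, l1norm beta <= B1 &
      forall j, j \in supp beta -> psi <= `|beta j 0|].

(** * Overfitting of both selections on fixed data sets *)

Section Deterministic.
Variables (R : realType) (n p : nat) (d1 d2 : dataset R n p).
Variables (beta : 'cV[R]_p) (betat : R -> 'cV[R]_p).
Variables (k1 k2 s K : nat) (C0 kap c tau t L B1 l0 T1 th psi A : R).
Hypothesis tun :
  tuning n k1 k2 s K C0 kap c tau t L B1 l0 T1 th psi (A * ln n%:R).
Hypothesis sig : signal_bounds beta s B1 psi.
Hypothesis gd1 : good_data d1 beta k1 k2 C0 kap c tau t.
Hypothesis lasso :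
  forall lam, 0 <= lam -> is_argmin setT (lasso_objective d1 lam) (betat lam).

Let X := design d1.
Let e := responses d1 - X *m beta.

Let yE : responses d1 = X *m beta + e.
Proof. by rewrite /e addrC subrK. Qed.

Let lassoP lam : 0 <= lam -> is_lasso X (X *m beta + e) lam (betat lam).
Proof.
move=> /lasso[_ h] b'; have := h b' I.
by rewrite !lasso_objectiveE -/X yE.
Qed.

Let card_le m : m%:R <= A * ln n%:R -> (m + s <= k2)%N := tn_size tun (m := m).

Let adm_card lam : admissible n A betat lam ->
  (#|supp (betat lam)| + s <= k2)%N.
Proof. by move=> [_ /card_le]. Qed.

Lemma small_penalty_keeps lam : admissible n A betat lam -> lam <= L ->
  supp beta \subset supp (betat lam).
Proof.
move=> adm lamL; have [sz b1 bpsi] := sig; have [gX ge _] := gd1.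
have [lam0 _] := adm.
apply: (lasso_keeps_signal gX ge (lassoP lam0) (tn_C0 tun) (ltW (tn_kap tun)) _
  (tn_t tun) (tn_n tun) _ (tn_k2n tun) b1 bpsi (tn_penalty tun) (tn_l0 tun)
  (tn_T1 tun) (tn_th tun) (tn_k1 tun) (tn_psi tun) (tn_signal tun)).
  by rewrite lam0.
exact: leq_trans (card_suppB_le (leqnn _) sz) (adm_card adm).
Qed.

Lemma large_penalty_sparse lam : L <= lam -> (#|supp (betat lam)| <= K)%N.
Proof.
move=> Llam; have [sz b1 bpsi] := sig; have [gX [g3 _ _] _] := gd1.
have L0 := tn_L tun.
have Ks := card_le (tn_K tun).
apply: (lasso_sparse (L := L) gX g3 (lassoP _) (tn_C0 tun) _ _ b1 _ (tn_sparse tun)).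
- exact: le_trans Llam.
- by rewrite L0.
- by apply: leq_trans sz _; apply: leq_trans (tn_k2n tun);
    apply: leq_trans Ks; rewrite leq_addl.
- exact: tn_Kn tun.
Qed.

Lemma ls_error_card (M : {set 'I_p}) : (#|M| <= K)%N ->
  (#|supp (ls_fit d1 M - beta)%R| <= K + s)%N.
Proof.
have [sz _ _] := sig => MK; apply: card_suppB_le => //.
exact: leq_trans (subset_leq_card (supp_extend _)) MK.
Qed.

(** At a missed coordinate the refit is 0, so the error there is a full coefficient; its support has
    at most K + s <= k1 elements, so the restricted eigenvalue applies. The design is a parameter
    because the true loss uses the first group and cross-validation the second. *)
Lemma underfit_lower_bound (X' : 'M[R]_(n, p)) (M : {set 'I_p}) :
  design_bounds X' C0 kap k1 -> (#|M| <= K)%N -> ~~ (supp beta \subset M) ->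
  n%:R * kap * psi ^+ 2 <= sqn (X' *m (ls_fit d1 M - beta)).
Proof.
move=> [_ g2] MK /fintype.subsetPn[j jb jM]; have [_ _ bpsi] := sig.
have kap0 : 0 <= n%:R * kap by rewrite mulr_ge0// ltW// (tn_kap tun).
apply: le_trans (g2 _ (leq_trans (ls_error_card MK) (tn_Kk1 tun))).
rewrite ler_wpM2l//; apply: le_trans (entry_sq_le_sqn _ j).
have -> : (ls_fit d1 M - beta) j 0 = - beta j 0.
  by rewrite mxE [ls_fit _ _ _ _]extend_out// add0r mxE.
rewrite sqrrN -[leRHS]real_normK ?num_real// lerXn2r ?nnegrE ?bpsi//.
by apply: le_trans (tn_psi tun); exact: ltW (tn_th tun).
Qed.

(** The penalty [L] belongs to both ranges at once: its model has at most [K] covariates, hence is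
    admissible, and it loses no signal. It is the competitor for both minimizers. *)
Lemma reference_admissible : admissible n A betat L.
Proof.
split; first exact: tn_L tun.
by apply: le_trans (tn_K tun); rewrite ler_nat large_penalty_sparse.
Qed.

Let M0 := supp (betat L).

Lemma reference_error_bound : sqn (X *m (ls_fit d1 M0 - beta)) <= t.
Proof.
have [gX [_ g4 _] gu] := gd1.
have MK : (#|M0| <= K)%N by exact: large_penalty_sparse.
apply: (ls_overfit_bound (tn_t tun) yE).
- by apply: gu; apply: leq_trans MK _; exact: ltnW (tn_Kn tun).
- exact: small_penalty_keeps reference_admissible _.
- apply: g4; apply: leq_trans (ls_error_card MK) _.
  exact: card_le (tn_K tun).
Qed.

Lemma true_lossE b : true_loss d1 beta b = n%:R^-1 * sqn (X *m (b - beta)).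
Proof. by rewrite /true_loss /dotv trmx_mul !mulmxA. Qed.

Lemma missing_penalty lam : admissible n A betat lam ->
  ~~ (supp beta \subset supp (betat lam)) -> (#|supp (betat lam)| <= K)%N.
Proof.
move=> adm miss; apply: large_penalty_sparse; rewrite leNgt.
by apply: contra miss => /ltW; exact: small_penalty_keeps.
Qed.

Lemma true_loss_overfits lam :
  is_argmin (admissible n A betat)
    (fun lam => true_loss d1 beta (ls_fit d1 (supp (betat lam)))) lam ->
  supp beta \subset supp (betat lam).
Proof.
move=> [adm /(_ _ reference_admissible)]; rewrite !true_lossE => le_loss.
apply: contraT => miss; have [gX _ _] := gd1.
have := underfit_lower_bound gX (missing_penalty adm miss) miss.
have n0 : 0 < (n%:R : R) by rewrite ltr0n (tn_n tun).
have := tn_loss tun; have := reference_error_bound; move: le_loss.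
rewrite ler_pM2l ?invr_gt0//.
(* [tn_loss] is calibrated for cross-validation; for the true loss its last term is simply
   dropped. *)
have : 0 <= C0 * t / kap.
  by rewrite !mulr_ge0 ?invr_ge0 ?(tn_C0 tun) ?(tn_t tun)// ltW// (tn_kap tun).
have := tn_t tun.
by rewrite -/X -/M0; lra.
Qed.

Hypothesis gd2 : good_data d2 beta k1 k2 C0 kap c tau t.

Let X2 := design d2.
Let e2 := responses d2 - X2 *m beta.

Lemma prediction_lossE b : prediction_loss d2 b =
  n%:R^-1 * (sqn e2 - 2 * dotv e2 (X2 *m (b - beta)) + sqn (X2 *m (b - beta))).
Proof.
rewrite /prediction_loss -sqnB dotvE; congr (_ * _).
apply: eq_bigr => i _; rewrite expr2; congr (_ * _);
by rewrite /e2 mulmxBr !mxE; ring.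
Qed.

(** With x and y the errors on the second design of the chosen and of the reference refit,
    minimality reads x - 2 wx <= y - 2 wy, where wx^2 <= t x and wy^2 <= t y. Hence x / 2 <= 3 t + 2
    y. The error y is carried over from the first design through the coefficients: t bounds n kap
    |g0|^2, so y <= C0 t / kap. This is the origin of the constant in [tn_loss]. *)
Lemma cross_validation_overfits lam :
  is_argmin (admissible n A betat)
    (fun lam => prediction_loss d2 (ls_fit d1 (supp (betat lam)))) lam ->
  supp beta \subset supp (betat lam).
Proof.
move=> [adm /(_ _ reference_admissible)]; rewrite !prediction_lossE.
have n0 : 0 < (n%:R : R) by rewrite ltr0n (tn_n tun).
rewrite ler_pM2l ?invr_gt0// => le_loss.
apply: contraT => miss; have [gX2 [_ g4 _] _] := gd2; have [gX _ _] := gd1.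
have MK := missing_penalty adm miss.
have x0 := underfit_lower_bound gX2 MK miss.
have card2 (M : {set 'I_p}) : (#|M| <= K)%N -> (#|supp (ls_fit d1 M - beta)%R| <= k2)%N.
  by move=> /ls_error_card /leq_trans -> //; exact: card_le (tn_K tun).
have w1 := g4 _ (card2 _ MK).
have MK0 : (#|M0| <= K)%N by exact: large_penalty_sparse.
have w2 := g4 _ (card2 _ MK0).
rewrite -/X2 -/e2 in w1 w2 le_loss x0; move: le_loss w1 w2 x0.
set g := ls_fit d1 (supp (betat lam)) - beta.
set g0 := ls_fit d1 M0 - beta.
set x := sqn (X2 *m g); set y := sqn (X2 *m g0).
set wx := dotv e2 (X2 *m g); set wy := dotv e2 (X2 *m g0).
move=> le_loss w1 w2 xlow.
have t0 := tn_t tun.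
have xp : 0 <= x := sqn_ge0 _; have yp : 0 <= y := sqn_ge0 _.
have wx1 : 2 * wx <= 2 * t + x / 2.
  by apply: le_of_sqr; [lra|have := sqr_ge0 (2 * t - x / 2); lra].
have wy1 : - (2 * wy) <= t + y.
  by apply: le_of_sqr; [lra|have := sqr_ge0 (t - y); lra].
have kap0 := tn_kap tun.
have y1 : y <= C0 * t / kap.
  have [G1 _] := gX2; have [_ G2] := gX.
  have h1 : y <= n%:R * C0 * sqn g0.
    by apply: G1; apply: leq_trans (card2 _ MK0) (tn_k2n tun).
  have h2 : n%:R * kap * sqn g0 <= t.
    apply: le_trans reference_error_bound; apply: G2.
    exact: leq_trans (ls_error_card MK0) (tn_Kk1 tun).
  rewrite ler_pdivlMr//; apply: le_trans (_ : (n%:R * C0 * sqn g0) * kap <= _).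
    by rewrite ler_wpM2r// ltW.
  have -> : n%:R * C0 * sqn g0 * kap = C0 * (n%:R * kap * sqn g0) by ring.
  by rewrite ler_wpM2l// (tn_C0 tun).
have := tn_loss tun.
by lra.
Qed.

End Deterministic.

(** * Independence *)

(** The measurability proof is an argument of this alias, so that a bare function can be given the
    bundled structure required by [distribution] and [image_measure]. *)
Definition as_mfun d1 d2 (T1 : measurableType d1) (T2 : measurableType d2)
  (f : T1 -> T2) (mf : measurable_fun setT f) := f.

HB.instance Definition _ d1 d2 (T1 : measurableType d1) (T2 : measurableType d2)
  (f : T1 -> T2) (mf : measurable_fun setT f) :=
  isMeasurableFun.Build _ _ _ _ (as_mfun mf) mf.

Definition indep_funs d d1 d2 (Omega : measurableType d) (R : realType)
    (P : probability Omega R) (T1 : measurableType d1) (T2 : measurableType d2)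
    (f : Omega -> T1) (g : Omega -> T2) : Prop :=
  forall A B, measurable A -> measurable B ->
    P (f @^-1` A `&` g @^-1` B) = (P (f @^-1` A) * P (g @^-1` B))%E.

Lemma measurable_preimage d1 d2 (T1 : measurableType d1) (T2 : measurableType d2)
    (f : T1 -> T2) A :
  measurable_fun setT f -> measurable A -> measurable (f @^-1` A).
Proof. by move=> mf mA; rewrite -[X in measurable X]setTI; exact: mf. Qed.

Definition image_measure d1 d2 (T1 : measurableType d1) (T2 : measurableType d2)
  (R : realType) (m : {measure set T1 -> \bar R}) (X : {mfun T1 >-> T2}) :=
  pushforward m X.

Section ImageMeasure.
Context d1 d2 (T1 : measurableType d1) (T2 : measurableType d2) (R : realType).
Variables (m : {measure set T1 -> \bar R}) (X : {mfun T1 >-> T2}).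

Let image0 : image_measure m X set0 = 0%E.
Proof. exact: measure0. Qed.

Let image_ge0 A : (0 <= image_measure m X A)%E.
Proof. exact: measure_ge0. Qed.

Let image_sigma_additive : semi_sigma_additive (image_measure m X).
Proof. exact: measure_semi_sigma_additive. Qed.

HB.instance Definition _ := isMeasure.Build _ _ _ (image_measure m X)
  image0 image_ge0 image_sigma_additive.

End ImageMeasure.

(** Both sides are finite measures in [A]; they agree on a generating class that is closed under
    intersection and contains the whole space, hence everywhere. *)
Lemma indep_generated d d' (Omega : measurableType d) (R : realType)
    (P : probability Omega R) (T : measurableType d') (f : Omega -> T)
    (G : set (set T)) (E : set Omega) :
  @measurable _ T = <<s G >> -> setI_closed G -> G setT ->
  measurable_fun setT f -> measurable E ->
  (forall A, G A -> P (f @^-1` A `&` E) = (P (f @^-1` A) * P E)%E) ->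
  forall A, measurable A -> P (f @^-1` A `&` E) = (P (f @^-1` A) * P E)%E.
Proof.
move=> mG GI GT mf mE GE A mA.
have fE : P E \is a fin_num := fin_num_measure P E mE.
have r0 : (0 <= fine (P E))%R by rewrite fine_ge0.
pose m1 := image_measure (mrestr P mE) (as_mfun mf).
pose m2 := mscale (NngNum r0) (image_measure P (as_mfun mf)).
have m2E B : m2 B = (P (f @^-1` B) * P E)%E.
  by rewrite /m2 /mscale/= fineK// muleC.
have /(_ R) := measure_unique G (fun=> setT) mG GI (fun=> GT).
rewrite bigcup_const; last by exists 0%N.
move=> /(_ erefl m1 m2); rewrite -m2E; apply => //.
- by move=> B GB; apply: etrans (GE _ GB) _; exact: esym (m2E B).
- move=> _; rewrite [X in (X < _)%E](_ : _ = P E).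
  2: by rewrite /= /image_measure /pushforward /mrestr/= setTI.
  by rewrite ltey_eq fE.
Qed.

Definition rectangle d (T : measurableType d) n (A : 'I_n -> set T) :
  set (n.-tuple T) := [set x | forall i, A i (tnth x i)].

Definition rectangles d (T : measurableType d) n : set (set (n.-tuple T)) :=
  [set rectangle A | A in [set A | forall i, measurable (A i)]].

Lemma measurable_rectangle d (T : measurableType d) n (A : 'I_n -> set T) :
  (forall i, measurable (A i)) -> measurable (rectangle A).
Proof.
move=> mA; have -> : rectangle A = \bigcap_i (fun x => tnth x i) @^-1` A i.
  by apply/seteqP; split => x h i; [move=> _|]; exact: h.
apply: fin_bigcap_measurable => // i _.
exact: measurable_preimage (measurable_tnth _) (mA i).
Qed.

Lemma rectangles_generate d (T : measurableType d) n :
  @measurable _ (n.-tuple T) = <<s @rectangles d T n >>.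
Proof.
apply/seteqP; split => [|A].
  apply: smallest_sub; first exact: smallest_sigma_algebra.
  case: n => [|n]; first by rewrite big_ord0.
  rewrite -bigcup_mkord_ord; apply: bigcup_sub => i _ _ [A mA <-].
  apply: sub_sigma_algebra.
  exists (fun j => if j == inord i then A else setT).
    by move=> j; case: ifP.
  apply/seteqP; split => x /= h.
    by split => //; have := h (inord i); rewrite eqxx.
  by move=> j; case: ifP => // /eqP ->; case: h.
apply: smallest_sub; first exact: sigma_algebra_measurable.
by move=> _ [B mB <-]; exact: measurable_rectangle.
Qed.

Lemma rectanglesI d (T : measurableType d) n :
  setI_closed (@rectangles d T n).
Proof.
move=> _ _ [A mA <-] [B mB <-]; exists (fun i => A i `&` B i).
  by move=> i; exact: measurableI.
apply/seteqP; split => x /=; first by move=> h; split => i; case: (h i).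
by move=> [hA hB] i; split; [exact: hA|exact: hB].
Qed.

Lemma rectanglesT d (T : measurableType d) n :
  @rectangles d T n setT.
Proof. by exists (fun=> setT) => //; apply/seteqP; split. Qed.

(** Selection along an index map rather than a subset: single coordinates, tails of lists, groups of
    observations and pairs of groups are all instances. *)
Definition subtuple (T : Type) m n (x : 'I_n -> T) (f : 'I_m -> 'I_n) :
  m.-tuple T := [tuple x (f i) | i < m].

Lemma measurable_subtuple d d' (Omega : measurableType d) (T : measurableType d')
    m n (X : 'I_n -> Omega -> T) (f : 'I_m -> 'I_n) :
  (forall i, measurable_fun setT (X i)) ->
  measurable_fun setT (fun w => subtuple (X ^~ w) f).
Proof.
move=> mX; apply/measurable_fun_tnthP => i /=.
rewrite (_ : _ \o _ = X (f i)); first exact: mX.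
by apply/funext => w /=; rewrite tnth_mktuple.
Qed.

(** On rectangles both events are intersections of events for single coordinates over the disjoint
    images of [f] and [g], so mutual independence factors them. [indep_generated] then extends the
    identity to all measurable sets, one side at a time. *)
Lemma indep_subtuples d d' (Omega : measurableType d) (R : realType)
    (P : probability Omega R) (T : measurableType d') n
    (X : 'I_n -> Omega -> T) m l (f : 'I_m -> 'I_n) (g : 'I_l -> 'I_n) :
  (forall i, measurable_fun setT (X i)) ->
  mutually_independent P (fun i => g_sigma_algebra_preimage (X i)) ->
  (forall i j, f i != g j) ->
  indep_funs P (fun w => subtuple (X ^~ w) f) (fun w => subtuple (X ^~ w) g).
Proof.
move=> mX iX fg.
have mf := measurable_subtuple f mX; have mg := measurable_subtuple g mX.
pose F := fun w => subtuple (X ^~ w) f; pose G := fun w => subtuple (X ^~ w) g.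
have rect A B : rectangles A -> rectangles B ->
    P (F @^-1` A `&` G @^-1` B) = (P (F @^-1` A) * P (G @^-1` B))%E.
  move=> [A' mA' <-] [B' mB' <-].
  pose J1 := [set f i | i : 'I_m]%SET; pose J2 := [set g i | i : 'I_l]%SET.
  (* [f] and [g] need not be injective, so the constraint on coordinate [j] is the intersection of
     the sides over its whole fibre. *)
  pose C j : set T := if j \in J1 then \bigcap_(i in [set i | f i = j]) A' i
    else \bigcap_(i in [set i | g i = j]) B' i.
  have J12 : [disjoint J1 & J2]%B.
    rewrite -setI_eq0; apply/eqP/setP => j; rewrite !inE; apply/negbTE.
    apply/negP => /andP[/imsetP[i _ ->] /imsetP[k _] fgk].
    by have := fg i k; rewrite fgk eqxx.
  have FE : F @^-1` rectangle A' = \bigcap_(j in [set j | j \in J1]) X j @^-1` C j.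
    apply/seteqP; split => w /= h.
      move=> j /= jJ; rewrite /C jJ => i /= fi; have := h i.
      by rewrite tnth_mktuple fi.
    move=> i; have fJ : f i \in J1 by exact: imset_f.
    by have := h (f i) fJ; rewrite /C/= fJ tnth_mktuple => /(_ i erefl).
  have GE : G @^-1` rectangle B' = \bigcap_(j in [set j | j \in J2]) X j @^-1` C j.
    have gJ1 j : j \in J2 -> (j \in J1) = false.
      by move=> jJ; apply/negbTE; move: J12; rewrite disjoint_sym => /disjointFr ->.
    apply/seteqP; split => w /= h.
      move=> j /= jJ; rewrite /C gJ1// => i /= gi; have := h i.
      by rewrite tnth_mktuple gi.
    move=> i; have gJ : g i \in J2 by exact: imset_f.
    by have := h (g i) gJ; rewrite /C/= gJ1// tnth_mktuple => /(_ i erefl).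
  have mC j : measurable (C j).
    by rewrite /C; case: ifP => _; apply: fin_bigcap_measurable => // i _.
  have hC (J : {set 'I_n}) j : j \in J -> g_sigma_algebra_preimage (X j) (X j @^-1` C j).
    by move=> _; exists (C j) => //; rewrite setTI.
  have FGE : F @^-1` rectangle A' `&` G @^-1` rectangle B' =
      \bigcap_(j in [set j | j \in (J1 :|: J2)%SET]) X j @^-1` C j.
    rewrite FE GE; apply/seteqP; split => w /=.
      move=> [h1 h2] j; rewrite /= inE => /orP[|]; [exact: h1|exact: h2].
    by move=> h; split => j /= jJ; apply: h; rewrite /= inE jJ ?orbT.
  rewrite FGE FE GE !iX; [|exact: hC|exact: hC|exact: hC].
  rewrite -bigU//=; apply: eq_bigl => j; rewrite !inE//.
move=> A B mA mB; rewrite setIC muleC.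
apply: (indep_generated (rectangles_generate _ _) (@rectanglesI _ _ _)
  (rectanglesT _ _)) => //; first exact: measurable_preimage.
move=> B' rB'; rewrite setIC muleC.
apply: (indep_generated (rectangles_generate _ _) (@rectanglesI _ _ _)
  (rectanglesT _ _)) => //; last by move=> A' rA'; exact: rect.
apply: measurable_preimage => //.
by case: rB' => B0 mB0 <-; exact: measurable_rectangle.
Qed.

(** Independence on rectangles identifies the joint law with the product measure, whose value on [E]
    is the integral of the measures of its sections. *)
Lemma indep_fubini d d1 d2 (Omega : measurableType d) (R : realType)
    (P : probability Omega R) (T1 : measurableType d1) (T2 : measurableType d2)
    (f : Omega -> T1) (g : Omega -> T2) (mf : measurable_fun setT f)
    (E : set (T1 * T2)) :
  measurable_fun setT g -> indep_funs P f g -> measurable E ->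
  P [set w | E (f w, g w)] =
  (\int[distribution P (as_mfun mf)]_x P (g @^-1` xsection E x))%E.
Proof.
move=> mg fg mE.
have mfg : measurable_fun setT (fun w => (f w, g w)).
  exact/measurable_fun_pairP.
have := @product_measure_unique _ _ _ _ _
  (distribution P (as_mfun mf)) (distribution P (as_mfun mg))
  (distribution P (as_mfun mfg)).
move=> /(_ fg E mE) E1; exact: esym E1.
Qed.

(** This takes the place of conditional probability: a bound that holds uniformly with the first
    variable frozen survives integration over it. *)
Lemma indep_bound d d1 d2 (Omega : measurableType d) (R : realType)
    (P : probability Omega R) (T1 : measurableType d1) (T2 : measurableType d2)
    (f : Omega -> T1) (g : Omega -> T2) (E : set (T1 * T2)) (r : R) :
  measurable_fun setT f -> measurable_fun setT g -> indep_funs P f g ->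
  measurable E -> (forall x, (P [set w | E (x, g w)] <= r%:E)%E) ->
  (P [set w | E (f w, g w)] <= r%:E)%E.
Proof.
move=> mf mg fg mE Er; rewrite (indep_fubini mf mg fg mE).
have -> : r%:E = (\int[distribution P (as_mfun mf)]_x (cst r%:E) x)%E.
  rewrite /= integral_cst//.
  by rewrite [X in (_ * X)%E]probability_setT mule1.
apply: ge0_le_integral => //.
- have := measurable_fun_xsection (distribution P (as_mfun mg)) mE.
  by apply.
- move=> x _; apply: le_trans (Er x); rewrite le_eqVlt; apply/orP; left.
  apply/eqP; congr (P _); apply/seteqP; split => w /=; rewrite /xsection/= inE//.
Qed.

(** * Gaussian linear forms *)

(** The Radon-Nikodym derivative of the normal law has the same integrals over measurable sets as
    the explicit density, so the two agree almost everywhere. *)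
Lemma ge0_integral_normal (R : realType) (m s : R) (f : R -> \bar R) :
  measurable_fun setT f -> (forall x, 0 <= f x)%E ->
  (\int[normal_prob m s]_x f x =
   \int[lebesgue_measure]_x (f x * (normal_pdf m s x)%:E))%E.
Proof.
move=> mf f0; pose mu := @lebesgue_measure R.
have dom := @normal_prob_dominates R m s.
rewrite -(Radon_Nikodym_SigmaFinite.change_of_variables dom f0 measurableT mf).
have mp : measurable_fun setT (fun x => (normal_pdf m s x)%:E).
  by apply/measurable_EFinP; exact: measurable_normal_pdf.
have rn := Radon_Nikodym_SigmaFinite.f_integrable dom.
have aeq : ae_eq mu setT (Radon_Nikodym_SigmaFinite.f (normal_prob m s) mu)
    (fun x => (normal_pdf m s x)%:E).
  apply: integral_ae_eq => // E _ mE.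
  by rewrite -(Radon_Nikodym_SigmaFinite.f_integral dom).
apply: ge0_ae_eq_integral => //.
- by apply: emeasurable_funM => //; exact: measurable_int rn.
- by apply: emeasurable_funM.
- by move=> x _; rewrite mule_ge0// Radon_Nikodym_SigmaFinite.f_ge0.
- by move=> x _; rewrite mule_ge0// lee_fin normal_pdf_ge0.
- by apply: filterS aeq => x /= fx Ix; rewrite /= fx.
Qed.

Lemma preimage_affine_itv (R : realType) (a b u v : R) : a != 0 ->
  lebesgue_measure ((fun x => a * x + b) @^-1` `]u, v]%classic)
  = (if u < v then (`|a|^-1 * (v - u))%:E else 0%E).
Proof.
move=> a0; have [a1|a1] := ltrP 0 a.
  rewrite (_ : _ @^-1` _ = `](u - b) / a, (v - b) / a]%classic); last first.
    apply/seteqP; split => x /=; rewrite !in_itv/= ltr_pdivrMr// ler_pdivlMr//;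
    by rewrite mulrC => /andP[h1 h2]; apply/andP; split; lra.
  rewrite lebesgue_measure_itv/= lte_fin ltr_pM2r ?invr_gt0// ltrD2r.
  rewrite gtr0_norm//; case: ifP => // _; rewrite EFinN -EFinB; congr (_%:E).
  by field.
have {}a1 : a < 0 by rewrite lt_neqAle a0.
rewrite (_ : _ @^-1` _ = `[(v - b) / a, (u - b) / a[%classic); last first.
  apply/seteqP; split => x /=; rewrite !in_itv/= ler_ndivrMr// ltr_ndivlMr//;
  by rewrite mulrC => /andP[h1 h2]; apply/andP; split; lra.
rewrite lebesgue_measure_itv/= lte_fin ltr_nM2r ?invr_lt0// ltrD2r.
rewrite ltr0_norm//; case: ifP => // _; rewrite EFinN -EFinB; congr (_%:E).
by field.
Qed.

Lemma measurable_affine (R : realType) (a b : R) :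
  measurable_fun setT (fun x : R => a * x + b).
Proof. by apply: measurable_funD => //; exact: measurable_funM. Qed.

(** The rescaled image measure agrees with Lebesgue measure on half-open intervals, which determines
    it. *)
Lemma lebesgue_measure_affine (R : realType) (a b : R) (A : set R) : a != 0 ->
  measurable A ->
  (`|a|%:E * lebesgue_measure ((fun x => (a * x + b)%R) @^-1` A) = lebesgue_measure A)%E.
Proof.
move=> a0 mA; pose f : R -> measurableTypeR R := fun x => a * x + b.
have mf : measurable_fun [set: measurableTypeR R] f by exact: measurable_affine.
have r0 : (0 <= `|a|)%R by [].
pose m := mscale (NngNum r0) (image_measure (@lebesgue_measure R) (as_mfun mf)).
transitivity (m A); first by [].
apply/esym; apply: (@lebesgue_measure_unique _ m) => //= _ [[u v]] _ <-.
rewrite /m /mscale/= /image_measure /pushforward/= /as_mfun /f.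
have := @preimage_affine_itv R a b u v a0 => /= ->.
rewrite lebesgue_measure_itv/= lte_fin; case: ifP => _; last by rewrite mule0.
by rewrite -EFinM mulrA divff ?normr_eq0// mul1r EFinB.
Qed.

Lemma ge0_integral_affine (R : realType) (a b : R) (f : R -> \bar R) : a != 0 ->
  measurable_fun setT f -> (forall x, 0 <= f x)%E ->
  (`|a|%:E * \int[lebesgue_measure]_x f (a * x + b)%R =
   \int[lebesgue_measure]_x f x)%E.
Proof.
move=> a0 mf f0; pose g : R -> measurableTypeR R := fun x => a * x + b.
have mg : measurable_fun [set: measurableTypeR R] g by exact: measurable_affine.
have r0 : (0 <= `|a|)%R by [].
have mfg : measurable_fun [set: measurableTypeR R] (f \o g).
  exact: measurableT_comp.
pose m := mscale (NngNum r0) (image_measure (@lebesgue_measure R) (as_mfun mg)).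
transitivity (\int[m]_x f x)%E; last first.
  by apply: eq_measure_integral => A mA _; exact: lebesgue_measure_affine.
rewrite ge0_integral_mscale//=; congr (_ * _)%E.
by rewrite [RHS]ge0_integral_pushforward// => x _; exact: f0.
Qed.

Lemma normal_pdf_scale (R : realType) (s a x : R) : 0 < s -> a != 0 ->
  normal_pdf 0 s x = `|a| * normal_pdf 0 (`|a| * s) (a * x).
Proof.
move=> s0 a0; have as0 : `|a| * s != 0 by rewrite mulf_neq0 ?normr_eq0// gt_eqF.
rewrite !normal_pdfE ?gt_eqF//; last by rewrite mulr_gt0 ?normr_gt0.
rewrite /normal_peak /normal_fun mulrA; congr (_ * expR _).
  move: (@pi R) => c.
  have -> : (`|a| * s) ^+ 2 * c *+ 2 = `|a| ^+ 2 * (s ^+ 2 * c *+ 2) by ring.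
  rewrite sqrtrM ?sqr_ge0// sqrtr_sqr normr_id.
  by rewrite invfM mulrA divff ?normr_eq0// mul1r.
rewrite !subr0 !exprMn real_normK ?num_real//; field.
by rewrite a0 gt_eqF.
Qed.

Lemma normal_prob_scale (R : realType) (s a : R) (B : set R) : 0 < s -> a != 0 ->
  measurable B ->
  normal_prob 0 s ((fun x => a * x) @^-1` B) = normal_prob 0 (`|a| * s) B.
Proof.
move=> s0 a0 mB.
have ma : measurable_fun setT (fun x : R => a * x) by exact: measurable_funM.
have mp u : measurable_fun setT (fun x : R => (normal_pdf 0 u x)%:E).
  by apply/measurable_EFinP; exact: measurable_normal_pdf.
have E C u : measurable C ->
    normal_prob 0 u C = (\int[lebesgue_measure]_x ((normal_pdf 0 u x)%:E * (\1_C x)%:E))%E.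
  move=> mC; rewrite /normal_prob integral_mkcond; apply: eq_integral => x _.
  rewrite patchE indicE; case: ifP => xC; by rewrite ?mule1 ?mule0.
rewrite !E//; last exact: measurable_preimage.
rewrite -[RHS](@ge0_integral_affine _ a 0)//.
- rewrite -ge0_integralZl//=.
  + apply: eq_integral => x _; rewrite (normal_pdf_scale x s0 a0) EFinM -muleA !addr0.
    congr (_ * (_ * _%:E))%E; rewrite !indicE; congr (_%:R).
  + apply: emeasurable_funM.
      apply: (measurableT_comp (mp _)); exact: measurable_affine.
    apply/measurable_EFinP; apply: measurableT_comp (measurable_affine a 0).
    exact: measurable_indic.
  + by move=> x _; rewrite mule_ge0// lee_fin ?normal_pdf_ge0.
- apply: emeasurable_funM => //.
  by apply/measurable_EFinP; exact: measurable_indic.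
- by move=> x; rewrite mule_ge0// lee_fin ?normal_pdf_ge0.
Qed.

(** Completing the square in x: the joint density of X and X + Y at (x, z) is the density of the sum
    at z times the conditional density of X given that sum. The last factor integrates to 1 in x. *)
Lemma normal_pdf_mul (R : realType) (s1 s2 x z : R) : 0 < s1 -> 0 < s2 ->
  let s := Num.sqrt (s1 ^+ 2 + s2 ^+ 2) in
  normal_pdf 0 s1 x * normal_pdf 0 s2 (z - x) =
  normal_pdf 0 s z * normal_pdf (z * s1 ^+ 2 / s ^+ 2) (s1 * s2 / s) x.
Proof.
move=> s10 s20 s.
have s2E : s ^+ 2 = s1 ^+ 2 + s2 ^+ 2 by rewrite sqr_sqrtr// addr_ge0// sqr_ge0.
have s0 : 0 < s by rewrite sqrtr_gt0 addr_gt0// exprn_gt0.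
have s'0 : 0 < s1 * s2 / s by rewrite divr_gt0// mulr_gt0.
rewrite !normal_pdfE ?gt_eqF// /normal_peak /normal_fun.
move: (@pi R) (@pi_ge0 R) => c c0.
rewrite mulrACA [RHS]mulrACA -!expRD; congr (_ * expR _).
  rewrite -!invfM -!sqrtrM; first last.
  - by rewrite mulrn_wge0// mulr_ge0 ?sqr_ge0.
  - by rewrite mulrn_wge0// mulr_ge0 ?sqr_ge0.
  congr (Num.sqrt _)^-1.
  by field; rewrite gt_eqF.
rewrite s2E; set q := s1 ^+ 2 + s2 ^+ 2.
have q0 : q != 0 by rewrite /q -s2E gt_eqF// exprn_gt0.
have -> : (s1 * s2 / s) ^+ 2 = s1 ^+ 2 * s2 ^+ 2 / q by rewrite !exprMn exprVn s2E.
rewrite /q in q0 *; field.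
by rewrite q0 !gt_eqF.
Qed.

Definition has_law d (Omega : measurableType d) (R : realType)
    (P : probability Omega R) (X : Omega -> R) (mu : set R -> \bar R) : Prop :=
  forall B, measurable B -> P (X @^-1` B) = mu B.

Lemma integral_law d (Omega : measurableType d) (R : realType)
    (P : probability Omega R) (X : Omega -> R) (mX : measurable_fun setT X) s
    (f : R -> \bar R) :
  has_law P X (normal_prob 0 s) -> measurable_fun setT f ->
  (forall x, 0 <= f x)%E ->
  (\int[distribution P (as_mfun mX)]_x f x = \int[normal_prob 0 s]_x f x)%E.
Proof.
move=> lX mf f0.
pose mX' : measurable_fun [set: Omega] (X : Omega -> measurableTypeR R) := mX.
rewrite ge0_integral_distribution//.
transitivity (\int[distribution P (as_mfun mX')]_x f x)%E.
  by rewrite ge0_integral_distribution.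
by apply: eq_measure_integral => A mA _; exact: lX.
Qed.

Lemma normal_add d (Omega : measurableType d) (R : realType)
    (P : probability Omega R) (X Y : Omega -> R) (s1 s2 : R) :
  0 < s1 -> 0 < s2 -> measurable_fun setT X -> measurable_fun setT Y ->
  indep_funs P X Y ->
  has_law P X (normal_prob 0 s1) -> has_law P Y (normal_prob 0 s2) ->
  has_law P (fun w => X w + Y w) (normal_prob 0 (Num.sqrt (s1 ^+ 2 + s2 ^+ 2))).
Proof.
move=> s10 s20 mX mY XY lX lY B mB; set s := Num.sqrt _.
pose leb := @lebesgue_measure R.
have madd : measurable_fun setT (fun z : R * R => z.1 + z.2).
  by apply: measurable_funD.
have mE : measurable ((fun z : R * R => z.1 + z.2) @^-1` B).
  exact: measurable_preimage.
have := indep_fubini mX mY XY mE => /= ->.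
have mp m u : measurable_fun setT (fun x : R => (normal_pdf m u x)%:E).
  by apply/measurable_EFinP; exact: measurable_normal_pdf.
have mI : measurable_fun setT (fun z : R => (\1_B z)%:E : \bar R).
  by apply/measurable_EFinP; exact: measurable_indic.
have mpz x : measurable_fun setT (fun z : R => (normal_pdf 0 s2 (z - x))%:E).
  by apply: (measurableT_comp (mp 0 s2)); exact: measurable_funB.
have mpx z : measurable_fun setT (fun x : R => (normal_pdf 0 s2 (z - x))%:E).
  by apply: (measurableT_comp (mp 0 s2)); exact: measurable_funB.
have inner x : P (Y @^-1` xsection ((fun z : R * R => z.1 + z.2) @^-1` B) x) =
    (\int[leb]_z ((\1_B z)%:E * (normal_pdf 0 s2 (z - x))%:E))%E.
  have mBx : measurable ((fun y => 1 * y + x) @^-1` B).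
    exact: measurable_preimage (measurable_affine 1 x) mB.
  have -> : xsection ((fun z : R * R => z.1 + z.2) @^-1` B) x =
      ((fun y => 1 * y + x) @^-1` B).
    by apply/seteqP; split => y /=; rewrite /xsection/= inE/= mul1r addrC.
  rewrite lY// /normal_prob integral_mkcond.
  rewrite -[RHS](@ge0_integral_affine _ 1 x)//.
  - rewrite normr1 mul1e; apply: eq_integral => y _.
    rewrite patchE indicE.
    have -> : (y \in (fun y0 : R => 1 * y0 + x) @^-1` B) = (1 * y + x \in B).
      by apply/idP/idP; rewrite !inE.
    rewrite addrK mul1r.
    by case: ifP; rewrite ?mul1e ?mul0e.
  - exact: emeasurable_funM.
  - by move=> z; rewrite mule_ge0// lee_fin ?normal_pdf_ge0.
under eq_integral do rewrite inner.
have mjoint : measurable_fun setT (fun z : R * R =>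
    ((\1_B z.2)%:E * (normal_pdf 0 s2 (z.2 - z.1))%:E * (normal_pdf 0 s1 z.1)%:E)%E).
  apply: emeasurable_funM; first apply: emeasurable_funM.
  - exact: (measurableT_comp mI).
  - by apply: (measurableT_comp (mp 0 s2)); exact: measurable_funB.
  - exact: (measurableT_comp (mp 0 s1)).
have joint0 z : (0 <= (\1_B z.2)%:E * (normal_pdf 0 s2 (z.2 - z.1))%:E *
    (normal_pdf 0 s1 z.1)%:E :> \bar R)%E.
  by rewrite !mule_ge0// lee_fin ?normal_pdf_ge0.
have mF : measurable_fun setT (fun x : R => \int[leb]_z ((\1_B z)%:E *
    (normal_pdf 0 s2 (z - x))%:E))%E.
  have := @measurable_fun_fubini_tonelli_F _ _ _ _ _ leb (fun z : R * R =>
    ((\1_B z.2)%:E * (normal_pdf 0 s2 (z.2 - z.1))%:E)%E); apply.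
    apply: emeasurable_funM; first exact: (measurableT_comp mI).
    by apply: (measurableT_comp (mp 0 s2)); exact: measurable_funB.
  by move=> z; rewrite mule_ge0// lee_fin ?normal_pdf_ge0.
have F0 (x : R) : (0 <= \int[leb]_z ((\1_B z)%:E *
    (normal_pdf 0 s2 (z - x))%:E))%E.
  by apply: integral_ge0 => z _; rewrite mule_ge0// lee_fin ?normal_pdf_ge0.
transitivity (\int[leb]_x \int[leb]_z ((\1_B z)%:E *
    (normal_pdf 0 s2 (z - x))%:E * (normal_pdf 0 s1 x)%:E))%E.
  transitivity (\int[normal_prob 0 s1]_x \int[leb]_z ((\1_B z)%:E *
    (normal_pdf 0 s2 (z - x))%:E))%E.
    exact: integral_law lX mF F0.
  rewrite ge0_integral_normal.
  - apply: eq_integral => x _; rewrite ge0_integralZr//.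
    + by apply: emeasurable_funM; [exact: mI|exact: mpz].
    + by move=> z _; rewrite mule_ge0// lee_fin ?normal_pdf_ge0.
    + by rewrite lee_fin normal_pdf_ge0.
  - exact: mF.
  - exact: F0.
(* After the exchange of integrals, [normal_pdf_mul] leaves a normal density in x under the inner
   integral. *)
have := @fubini_tonelli _ _ _ _ _ leb leb _ mjoint joint0 => /= ->.
rewrite /normal_prob [RHS]integral_mkcond; apply: eq_integral => z _.
transitivity (\int[leb]_x (((\1_B z) * normal_pdf 0 s z)%:E *
  (normal_pdf (z * s1 ^+ 2 / s ^+ 2) (s1 * s2 / s) x)%:E))%E.
  apply: eq_integral => x _; rewrite -!EFinM; congr (_%:E).
  rewrite -mulrA (mulrC (normal_pdf 0 s2 _)) normal_pdf_mul// -/s.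
  by rewrite mulrA.
rewrite ge0_integralZl//.
- rewrite integral_normal_pdf mule1 patchE indicE; case: ifP => _.
    by rewrite mul1r.
  by rewrite mul0r.
- exact: mp.
- by move=> x _; rewrite lee_fin normal_pdf_ge0.
- by rewrite lee_fin mulr_ge0// normal_pdf_ge0.
Qed.

Lemma indep_funs_comp d d1 d2 d3 d4 (Omega : measurableType d) (R : realType)
    (P : probability Omega R) (T1 : measurableType d1) (T2 : measurableType d2)
    (U1 : measurableType d3) (U2 : measurableType d4)
    (f : Omega -> T1) (g : Omega -> T2) (h : T1 -> U1) (k : T2 -> U2) :
  measurable_fun setT h -> measurable_fun setT k ->
  indep_funs P f g -> indep_funs P (h \o f) (k \o g).
Proof.
move=> mh mk fg A B mA mB.
exact: fg (measurable_preimage mh mA) (measurable_preimage mk mB).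
Qed.

Lemma has_law_scale d (Omega : measurableType d) (R : realType)
    (P : probability Omega R) (X : Omega -> R) (s a : R) : 0 < s -> a != 0 ->
  has_law P X (normal_prob 0 s) ->
  has_law P (fun w => a * X w) (normal_prob 0 (`|a| * s)).
Proof.
move=> s0 a0 lX B mB.
rewrite -(normal_prob_scale s0 a0 mB) -lX//.
by apply: measurable_preimage => //; exact: measurable_funM.
Qed.

Section GaussianNoise.
Context d (Omega : measurableType d) (R : realType) (P : probability Omega R).
Variables (n : nat) (X : 'I_n -> Omega -> R) (sigma : R).
Hypothesis sigma0 : 0 < sigma.
Hypothesis mX : forall i, measurable_fun setT (X i).
Hypothesis indepX :
  mutually_independent P (fun i => g_sigma_algebra_preimage (X i)).
Hypothesis lawX : forall i, has_law P (X i) (normal_prob 0 sigma).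

(** Induction on the list of indices. Zero coefficients are split off, since [normal_add] requires
    two positive standard deviations. *)
Lemma gaussian_combination_seq (a : 'I_n -> R) (r : seq 'I_n) : uniq r ->
  0 < \sum_(i <- r) a i ^+ 2 ->
  has_law P (fun w => \sum_(i <- r) a i * X i w)
    (normal_prob 0 (sigma * Num.sqrt (\sum_(i <- r) a i ^+ 2))).
Proof.
elim: r => [|x r IHr] /=; first by rewrite big_nil ltxx.
move=> /andP[xr ur]; have [ax0|ax0] := eqVneq (a x) 0.
  rewrite big_cons ax0 expr0n/= add0r => q0.
  rewrite (_ : (fun w => _) = fun w => \sum_(i <- r) a i * X i w); first exact: IHr.
  by apply/funext => w; rewrite big_cons ax0 mul0r add0r.
move=> _; set q := \sum_(i <- r) a i ^+ 2.
have lx : has_law P (fun w => a x * X x w) (normal_prob 0 (`|a x| * sigma)).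
  exact: has_law_scale.
(* All remaining coefficients vanish, so the head alone carries the law. *)
have [q0|q0] := eqVneq q 0.
  rewrite big_cons -/q q0 addr0 sqrtr_sqr mulrC.
  rewrite (_ : (fun w => _) = fun w => a x * X x w)//.
  apply/funext => w; rewrite big_cons [X in _ + X]big_seq big1 ?addr0// => i ir.
  have : a i ^+ 2 == 0.
    move: q0 => /eqP; rewrite /q psumr_eq0; last by move=> j _; exact: sqr_ge0.
    by move=> /allP /(_ i ir).
  by rewrite sqrf_eq0 => /eqP ->; rewrite mul0r.
have {}q0 : 0 < q by rewrite lt_neqAle eq_sym q0 sumr_ge0// => i _; exact: sqr_ge0.
have := @normal_add _ _ _ P (fun w => a x * X x w)
  (fun w => \sum_(i <- r) a i * X i w) (`|a x| * sigma) (sigma * Num.sqrt q).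
have s10 : 0 < `|a x| * sigma by rewrite mulr_gt0 ?normr_gt0.
have s20 : 0 < sigma * Num.sqrt q by rewrite mulr_gt0 ?sqrtr_gt0.
move=> /(_ s10 s20).
have ms : measurable_fun setT (fun w => \sum_(i <- r) a i * X i w).
  by apply: measurable_sum => i; exact: measurable_funM.
have mx : measurable_fun setT (fun w => a x * X x w) by exact: measurable_funM.
move=> /(_ mx ms).
have -> : (fun w => \sum_(i <- (x :: r)) a i * X i w) =
    (fun w => a x * X x w + \sum_(i <- r) a i * X i w).
  by apply/funext => w; rewrite big_cons.
have -> : sigma * Num.sqrt (\sum_(i <- (x :: r)) a i ^+ 2) =
    Num.sqrt ((`|a x| * sigma) ^+ 2 + (sigma * Num.sqrt q) ^+ 2).
  rewrite big_cons -/q !exprMn real_normK ?num_real// sqr_sqrtr ?ltW//.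
  have -> : a x ^+ 2 * sigma ^+ 2 + sigma ^+ 2 * q = sigma ^+ 2 * (a x ^+ 2 + q).
    by ring.
  by rewrite sqrtrM ?sqr_ge0// sqrtr_sqr gtr0_norm.
apply; [|exact: lx|exact: IHr].
(* The head and the tail of the list are written as functions of two subtuples with disjoint index
   sets. *)
pose f : 'I_1 -> 'I_n := fun=> x.
pose g : 'I_(size r) -> 'I_n := tnth (in_tuple r).
have fg i j : f i != g j.
  by apply: contra xr => /eqP; rewrite /f => ->; exact: (mem_tnth j (in_tuple r)).
have := indep_subtuples mX indepX fg.
pose h1 (t : 1.-tuple R) := a x * tnth t ord0.
pose h2 (t : (size r).-tuple R) := \sum_(j < size r) a (g j) * tnth t j.
have mh1 : measurable_fun setT h1.
  by apply: measurable_funM => //; exact: measurable_tnth.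
have mh2 : measurable_fun setT h2.
  by apply: measurable_sum => j; apply: measurable_funM => //; exact: measurable_tnth.
move=> /(indep_funs_comp mh1 mh2).
rewrite (_ : h1 \o _ = fun w => a x * X x w); last first.
  by apply/funext => w; rewrite /h1/= tnth_mktuple.
rewrite (_ : h2 \o _ = fun w => \sum_(i <- r) a i * X i w)//.
apply/funext => w; rewrite /h2/= [RHS]big_tnth; apply: eq_bigr => j _.
by rewrite tnth_mktuple.
Qed.

End GaussianNoise.

(** * Gaussian quadratic forms *)

Lemma expR_ge_quadratic (R : realType) (v : R) : 0 <= v ->
  1 + v + v ^+ 2 / 2 <= expR v.
Proof.
move=> v0; have -> : 1 + v + v ^+ 2 / 2 = series (exp_coeff v) 3.
  rewrite /series/= !big_nat_recr//= big_nil /exp_coeff/=.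
  by rewrite -[(1 + 1)%R]/2%N -[2`!]/2%N -[1`!]/1%N -[0`!]/1%N expr0 expr1; field.
apply: (nondecreasing_cvgn_le _ (@is_cvg_series_exp_coeff _ v)).
apply: nondecreasing_series => k _ _; exact: exp_coeff_ge0.
Qed.

Lemma measurable_normalE (R : realType) (m s : R) :
  measurable_fun setT (fun x : R => (normal_pdf m s x)%:E).
Proof. by apply/measurable_EFinP; exact: measurable_normal_pdf. Qed.

(** With r = sqrt (1 - c), the integrand times the density is 1 / r times the density of a normal
    law with standard deviation s / r. The moment bounds and the tail bound below are all read off
    from this transform. *)
Lemma normal_exp_sq (R : realType) (s c : R) : 0 < s -> c < 1 ->
  (\int[normal_prob 0 s]_x (expR (c * x ^+ 2 / (2 * s ^+ 2)))%:E =
   ((Num.sqrt (1 - c))^-1)%:E)%E.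
Proof.
move=> s0 c1; set r := Num.sqrt (1 - c).
have r0 : 0 < r by rewrite sqrtr_gt0 subr_gt0.
have r2 : r ^+ 2 = 1 - c by rewrite sqr_sqrtr// subr_ge0 ltW.
have mx : measurable_fun setT (fun x : R => expR (c * x ^+ 2 / (2 * s ^+ 2))).
  apply: measurableT_comp => //; apply: measurable_funM => //.
  by apply: measurable_funM => //; exact: measurable_funX.
rewrite ge0_integral_normal; first last.
- by move=> x; rewrite lee_fin expR_ge0.
- exact/measurable_EFinP.
transitivity (\int[lebesgue_measure]_x (r^-1%:E * (normal_pdf 0 (s / r) x)%:E))%E.
  apply: eq_integral => x _; rewrite -!EFinM; congr (_%:E).
  rewrite !normal_pdfE ?gt_eqF ?divr_gt0// /normal_peak /normal_fun.
  move: (@pi R) (@pi_ge0 R) => q q0.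
  rewrite [LHS]mulrCA -expRD [RHS]mulrA; congr (_ * expR _).
    have -> : s ^+ 2 * q *+ 2 = r ^+ 2 * ((s / r) ^+ 2 * q *+ 2).
      by field; rewrite gt_eqF.
    by rewrite sqrtrM ?sqr_ge0// sqrtr_sqr gtr0_norm// invfM.
  rewrite !subr0 expr_div_n r2; field.
  by rewrite !gt_eqF// subr_gt0.
rewrite ge0_integralZl//.
- by rewrite integral_normal_pdf mule1.
- exact: measurable_normalE.
- by move=> x _; rewrite lee_fin normal_pdf_ge0.
- by rewrite lee_fin invr_ge0 ltW.
Qed.

Lemma integral_normal_cst (R : realType) (s r : R) :
  (\int[normal_prob 0 s]_x (r%:E) = r%:E)%E.
Proof.
have -> : (fun _ : R => r%:E) = cst r%:E by [].
by rewrite integral_cst// [X in (_ * X)%E]probability_setT mule1.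
Qed.

Lemma le_of_le_add (R : realType) (a b C : R) : 0 <= C ->
  (forall e, 0 < e -> e <= 1/2 -> a <= b + C * e) -> a <= b.
Proof.
move=> C0 h; apply/ler_addgt0Pr => e e0.
pose f := Num.min (1/2) (e / (C + 1)).
have C1 : 0 < C + 1 by lra.
have f0 : 0 < f by rewrite lt_min; apply/andP; split; [lra|exact: divr_gt0].
apply: le_trans (h f f0 _) _; first by rewrite ge_min lexx.
rewrite lerD2l; apply: (@le_trans _ _ (C * (e / (C + 1)))).
  by rewrite ler_wpM2l// ge_min lexx orbT.
by rewrite mulrA ler_pdivrMr// mulrDr mulr1 mulrC lerDl ltW.
Qed.

Lemma measurable_powE (R : realType) k (a : R) :
  measurable_fun setT (fun x : R => (a * x ^+ k)%:E).
Proof.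
by apply/measurable_EFinP; apply: measurable_funM => //; exact: measurable_funX.
Qed.

Lemma measurable_exp_sqE (R : realType) (a b : R) :
  measurable_fun setT (fun x : R => (expR (a * x ^+ 2 / b))%:E).
Proof.
apply/measurable_EFinP; apply: measurableT_comp => //.
apply: measurable_funM => //.
by apply: measurable_funM => //; exact: measurable_funX.
Qed.

(** Integrating 1 - v <= exp (- v) with v = e x^2 / (2 s^2) gives 1 <= (1 + e)^(-1/2) + (e / 2) (m /
    s^2); letting e tend to 0 gives m >= s^2. *)
Lemma normal_moment2_ge (R : realType) (s : R) : 0 < s ->
  ((s ^+ 2)%:E <= \int[normal_prob 0 s]_x (x ^+ 2)%:E)%E.
Proof.
move=> s0; set I2 := (\int[_]_x _)%E.
have I20 : (0 <= I2)%E by apply: integral_ge0 => x _; rewrite lee_fin sqr_ge0.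
have [I2y|] := eqVneq I2 +oo%E; first by rewrite I2y leey.
rewrite -ltey -ge0_fin_numE// => I2fin.
have [m I2E] : exists m, I2 = m%:E by exists (fine I2); rewrite fineK.
rewrite I2E lee_fin; rewrite I2E lee_fin in I20.
suff : 1 <= m / s ^+ 2 by rewrite ler_pdivlMr ?mul1r// exprn_gt0.
apply: (@le_of_le_add _ _ _ (3/4)); first by lra.
move=> e e0 e1.
have key : (1 <= (Num.sqrt (1 + e))^-1 + e / 2 * (m / s ^+ 2)).
  rewrite -lee_fin EFinD.
  rewrite (_ : e / 2 * (m / s ^+ 2) = (e / (2 * s ^+ 2)) * m); last first.
    by field; rewrite gt_eqF.
  have := @normal_exp_sq _ s (- e) s0; rewrite opprK => /(_ ltac:(lra)) E1.
  rewrite EFinM -I2E -E1.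
  rewrite -ge0_integralZl//; first last.
  - by rewrite lee_fin divr_ge0// ?ltW// mulr_gt0// exprn_gt0.
  - by move=> x _; rewrite lee_fin sqr_ge0.
  - have := @measurable_powE R 2 1.
    by under eq_fun do rewrite mul1r.
  rewrite -ge0_integralD//; first last.
  - exact: measurable_powE.
  - by move=> x _; rewrite lee_fin mulr_ge0 ?sqr_ge0// divr_ge0// ?ltW// mulr_gt0// exprn_gt0.
  - exact: measurable_exp_sqE.
  rewrite -(@integral_normal_cst _ s 1); apply: ge0_le_integral => //.
  - apply: emeasurable_funD; [exact: measurable_exp_sqE|exact: measurable_powE].
  - move=> x _; rewrite lee_fin.
    have := expR_ge1Dx (- e * x ^+ 2 / (2 * s ^+ 2)).
    have -> : - e * x ^+ 2 / (2 * s ^+ 2) = - (e / (2 * s ^+ 2) * x ^+ 2).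
      by field; rewrite gt_eqF.
    by lra.
set r := Num.sqrt (1 + e) in key *.
have r2 : r ^+ 2 = 1 + e by rewrite sqr_sqrtr//; lra.
have r0 : 0 < r by rewrite sqrtr_gt0; lra.
(* The second-order Taylor polynomial of (1 + e)^(-1/2), an upper bound because the next term is
   negative; the claim is checked after squaring. *)
have rle : r^-1 <= 1 - e / 2 + 3 / 8 * e ^+ 2.
  rewrite -div1r ler_pdivrMr//.
  have q0 : 0 < 1 - e / 2 + 3 / 8 * e ^+ 2 by nra.
  set q := 1 - e / 2 + 3 / 8 * e ^+ 2 in q0 *.
  have : 1 ^+ 2 <= (q * r) ^+ 2.
    rewrite exprMn r2 expr1n /q.
    have -> : (1 - e / 2 + 3 / 8 * e ^+ 2) ^+ 2 * (1 + e) =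
      1 + e ^+ 3 * (5 / 8 - 15 / 64 * e + 9 / 64 * e ^+ 2) by field.
    by rewrite lerDl mulr_ge0// ?exprn_ge0 ?ltW//; nra.
  rewrite expr1n; have : 0 < q * r by rewrite mulr_gt0.
  by move: (q * r) => y y0 y1; nra.
have h2 : 1 - 3 / 4 * e <= m / s ^+ 2.
  by rewrite -(@ler_pM2l _ (e / 2)); [nra|lra].
by lra.
Qed.

(** Integrate 1 + v + v^2 / 2 <= exp v with v = e x^2 / (2 s^2). The second moment is at least s^2,
    so its term cancels the e / 2 in the expansion of (1 - e)^(-1/2), and the terms of order e^2
    give 3 s^4 in the limit. *)
Lemma normal_moment4_le (R : realType) (s : R) : 0 < s ->
  (\int[normal_prob 0 s]_x (x ^+ 4)%:E <= (3 * s ^+ 4)%:E)%E.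
Proof.
move=> s0; set I4 := (\int[_]_x _)%E.
have I40 : (0 <= I4)%E by apply: integral_ge0 => x _; rewrite lee_fin exprn_even_ge0.
have m2 := normal_moment2_ge s0; set I2 := (\int[_]_x _)%E in m2.
have key e : 0 < e -> e < 1 ->
    (1%:E + ((e / (2 * s ^+ 2))%:E * I2 + (e ^+ 2 / (8 * s ^+ 4))%:E * I4) <=
     ((Num.sqrt (1 - e))^-1)%:E)%E.
  move=> e0 e1; rewrite -(@normal_exp_sq _ s)// -[X in (X + _)%E](@integral_normal_cst _ s 1).
  have c0 : 0 <= e / (2 * s ^+ 2) by rewrite divr_ge0// ?ltW// mulr_gt0// exprn_gt0.
  have c1 : 0 <= e ^+ 2 / (8 * s ^+ 4).
    by rewrite divr_ge0// ?ltW ?exprn_gt0// mulr_gt0// exprn_gt0.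
  have mp k : measurable_fun setT (fun x : R => (x ^+ k)%:E).
    by apply/measurable_EFinP; exact: measurable_funX.
  rewrite -!ge0_integralZl//; first last.
  - by move=> x _; rewrite lee_fin exprn_even_ge0.
  - exact: mp.
  - by move=> x _; rewrite lee_fin exprn_even_ge0.
  - exact: mp.
  rewrite -ge0_integralD//; first last.
  - exact: measurable_powE.
  - by move=> x _; rewrite lee_fin mulr_ge0// exprn_even_ge0.
  - exact: measurable_powE.
  - by move=> x _; rewrite lee_fin mulr_ge0// sqr_ge0.
  rewrite -ge0_integralD//; first last.
  - by apply: emeasurable_funD; exact: measurable_powE.
  - by move=> x _; rewrite lee_fin addr_ge0// mulr_ge0// exprn_even_ge0.
  apply: ge0_le_integral => //.
  - by move=> x _; rewrite lee_fin !addr_ge0// mulr_ge0// exprn_even_ge0.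
  - by apply: emeasurable_funD => //; apply: emeasurable_funD; exact: measurable_powE.
  - by exact: measurable_exp_sqE.
  move=> x _; rewrite lee_fin.
  have v0 : 0 <= e * x ^+ 2 / (2 * s ^+ 2).
    apply: divr_ge0; first by rewrite mulr_ge0 ?sqr_ge0// ltW.
    by rewrite mulr_ge0 ?sqr_ge0.
  apply: le_trans (expR_ge_quadratic v0).
  rewrite le_eqVlt; apply/orP; left; apply/eqP; field.
  by rewrite gt_eqF.
have I2f : (0 <= I2)%E by apply: integral_ge0 => x _; rewrite lee_fin sqr_ge0.
have key2 e : 0 < e -> e < 1 ->
    (1%:E + ((e / (2 * s ^+ 2))%:E * (s ^+ 2)%:E + (e ^+ 2 / (8 * s ^+ 4))%:E * I4) <=
     ((Num.sqrt (1 - e))^-1)%:E)%E.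
  move=> e0 e1; apply: le_trans (key e e0 e1).
  rewrite leeD2l// leeD2r// lee_wpmul2l// lee_fin divr_ge0// ?ltW//.
  by rewrite mulr_gt0// exprn_gt0.
have [I4y|] := eqVneq I4 +oo%E.
  have := key2 (1/2); rewrite I4y => /(_ ltac:(lra) ltac:(lra)).
  rewrite gt0_muley ?lte_fin ?divr_gt0 ?mulr_gt0 ?exprn_gt0//; try lra.
rewrite -ltey -ge0_fin_numE// => I4fin.
have [m I4E] : exists m, I4 = m%:E by exists (fine I4); rewrite fineK.
rewrite I4E lee_fin; rewrite I4E lee_fin in I40.
suff : m / s ^+ 4 <= 3 by rewrite ler_pdivrMr ?exprn_gt0.
apply: (@le_of_le_add _ _ _ 16); first by lra.
move=> e e0 e1.
have := key2 e e0 ltac:(lra); rewrite I4E -!EFinM -!EFinD lee_fin.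
have -> : e / (2 * s ^+ 2) * s ^+ 2 = e / 2 by field; rewrite gt_eqF.
have -> : e ^+ 2 / (8 * s ^+ 4) * m = e ^+ 2 / 8 * (m / s ^+ 4).
  by field; rewrite gt_eqF.
set r := Num.sqrt (1 - e).
have r2 : r ^+ 2 = 1 - e by rewrite sqr_sqrtr//; lra.
have r0 : 0 < r by rewrite sqrtr_gt0; lra.
(* The Taylor polynomial of (1 - e)^(-1/2) with the cubic term enlarged to 2 e^3, which covers the
   remainder for e <= 1/2. Divided by e^2 / 8, it becomes the 16 e above. *)
have rle : r^-1 <= 1 + e / 2 + 3 / 8 * e ^+ 2 + 2 * e ^+ 3.
  rewrite -div1r ler_pdivrMr//.
  have q0 : 0 < 1 + e / 2 + 3 / 8 * e ^+ 2 + 2 * e ^+ 3.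
    have := exprn_gt0 3 e0; nra.
  set q := 1 + e / 2 + 3 / 8 * e ^+ 2 + 2 * e ^+ 3 in q0 *.
  have : 1 ^+ 2 <= (q * r) ^+ 2.
    rewrite exprMn r2 expr1n /q.
    have -> : (1 + e / 2 + 3 / 8 * e ^+ 2 + 2 * e ^+ 3) ^+ 2 * (1 - e) =
      1 + e ^+ 3 * (27/8 - 143 / 64 * e - 41 / 64 * e ^+ 2 + 5/2 * e ^+ 3 - 4 * e ^+ 4) by field.
    rewrite lerDl mulr_ge0// ?exprn_ge0 ?ltW//.
    have h2 : e ^+ 2 <= 1/4 by nra.
    have h3 : 0 <= e ^+ 3 by rewrite exprn_ge0// ltW.
    have h4 : e ^+ 4 <= 1/16 by rewrite (_ : e ^+ 4 = e ^+ 2 * e ^+ 2); [nra|ring].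
    lra.
  rewrite expr1n; have : 0 < q * r by rewrite mulr_gt0.
  by move: (q * r) => y y0 y1; nra.
move=> h; rewrite -(@ler_pM2l _ (e ^+ 2 / 8)); last by rewrite divr_gt0// exprn_gt0.
have -> : e ^+ 2 / 8 * (3 + 16 * e) = 3 / 8 * e ^+ 2 + 2 * e ^+ 3 by field.
lra.
Qed.

(** Markov's inequality for exp (x^2 / (4 s^2)), whose mean is sqrt 2 by [normal_exp_sq] at c =
    1/2. *)
Lemma normal_tail (R : realType) (s t : R) : 0 < s -> 0 <= t ->
  (normal_prob 0 s [set x | (t < `|x|)%R] <=
   (Num.sqrt 2 * expR (- (t ^+ 2 / (4 * s ^+ 2))))%:E)%E.
Proof.
move=> s0 t0; set A := [set x | _].
have mA : measurable (A : set (measurableTypeR R)).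
  have : measurable_fun setT (fun x : R => `|x|) by exact: normr_measurable.
  move=> /(_ measurableT `]t, +oo[%classic (measurable_itv _)).
  rewrite setTI; congr measurable; apply/seteqP; split => x /=;
  by rewrite in_itv/= andbT.
set E := expR (- (t ^+ 2 / (4 * s ^+ 2))).
have -> : normal_prob 0 s A = (\int[normal_prob 0 s]_x (\1_A x)%:E)%E.
  by rewrite integral_indic// setIT.
have half : 1 / 2 < 1 :> R by lra.
have := normal_exp_sq s0 half.
have -> : (Num.sqrt (1 - 1 / 2))^-1 = Num.sqrt 2 :> R.
  by rewrite -sqrtrV; [congr Num.sqrt; field|lra].
move=> I; rewrite mulrC EFinM -I -ge0_integralZl//; first last.
- by rewrite lee_fin expR_ge0.
- exact: measurable_exp_sqE.
apply: ge0_le_integral => //.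
- by apply/measurable_EFinP; exact: measurable_indic.
- apply: emeasurable_funM => //; exact: measurable_exp_sqE.
move=> x _; rewrite -EFinM lee_fin indicE; case: (boolP (x \in A)) => xA; last first.
  by rewrite mulr_ge0// expR_ge0.
rewrite -expRD -[leLHS]expR0 ler_expR.
move/set_mem: xA => /= tx.
have -> : - (t ^+ 2 / (4 * s ^+ 2)) + 1 / 2 * x ^+ 2 / (2 * s ^+ 2) =
   (x ^+ 2 - t ^+ 2) / (4 * s ^+ 2) by field; rewrite gt_eqF.
apply: divr_ge0; last by rewrite mulr_ge0 ?sqr_ge0.
rewrite subr_ge0.
by rewrite -[x ^+ 2]real_normK ?num_real// lerXn2r ?nnegrE// ltW.
Qed.

(** Joint Gaussianity with covariance sigma^2 times the identity, stated through one-dimensional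
    projections. The zero form is constant and is excluded. *)
Definition gaussian_family d (Omega : measurableType d) (R : realType)
    (P : probability Omega R) n (X : 'I_n -> Omega -> R) (sigma : R) : Prop :=
  (forall i, measurable_fun setT (X i)) /\
  forall a : 'cV[R]_n, 0 < sqn a ->
    has_law P (fun w => \sum_i a i 0 * X i w)
      (normal_prob 0 (sigma * Num.sqrt (sqn a))).

Section GaussianFamily.
Context d (Omega : measurableType d) (R : realType) (P : probability Omega R).
Variables (n : nat) (X : 'I_n -> Omega -> R) (sigma : R).
Hypothesis sigma0 : 0 < sigma.
Hypothesis GX : gaussian_family P X sigma.

Definition lin (a : 'cV[R]_n) (w : Omega) : R := \sum_i a i 0 * X i w.

Lemma measurable_lin a : measurable_fun setT (lin a).
Proof. by apply: measurable_sum => i; apply: measurable_funM => //; exact: GX.1. Qed.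

Lemma linD a b w : lin (a + b) w = lin a w + lin b w.
Proof. by rewrite /lin -big_split/=; apply: eq_bigr => i _; rewrite mxE mulrDl. Qed.

Lemma linB a b w : lin (a - b) w = lin a w - lin b w.
Proof.
by rewrite /lin -sumrB; apply: eq_bigr => i _; rewrite !mxE mulrBl.
Qed.

Lemma lin0 w : lin 0 w = 0.
Proof. by rewrite /lin big1// => i _; rewrite mxE mul0r. Qed.

Lemma integral_lin (a : 'cV[R]_n) (f : R -> \bar R) : 0 < sqn a ->
  measurable_fun setT f -> (forall x, 0 <= f x)%E ->
  (\int[P]_w f (lin a w) =
   \int[normal_prob 0 (sigma * Num.sqrt (sqn a))]_x f x)%E.
Proof.
move=> a0 mf f0; rewrite -(integral_law (measurable_lin a) (GX.2 _ a0) mf f0).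
by rewrite ge0_integral_distribution.
Qed.

Lemma lin_moment2_ge (a : 'cV[R]_n) :
  ((sigma ^+ 2 * sqn a)%:E <= \int[P]_w (lin a w ^+ 2)%:E)%E.
Proof.
have [a0|] := eqVneq (sqn a) 0.
  by rewrite a0 mulr0; apply: integral_ge0 => w _; rewrite lee_fin sqr_ge0.
move=> a1; have a0 : 0 < sqn a by rewrite lt_neqAle eq_sym a1 sqn_ge0.
rewrite (integral_lin (f := fun x => (x ^+ 2)%:E))//.
- apply: le_trans (normal_moment2_ge _); last by rewrite mulr_gt0// sqrtr_gt0.
  by rewrite exprMn sqr_sqrtr// sqn_ge0.
- by apply/measurable_EFinP; exact: measurable_funX.
- by move=> x; rewrite lee_fin sqr_ge0.
Qed.

Let mu4 := (\int[normal_prob 0 sigma]_x (x ^+ 4)%:E)%E.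

Let mu4E : exists2 m : R, mu4 = m%:E & 0 <= m <= 3 * sigma ^+ 4.
Proof.
have h0 : (0 <= mu4)%E.
  by apply: integral_ge0 => x _; rewrite lee_fin exprn_even_ge0.
have h1 := normal_moment4_le sigma0; rewrite -/mu4 in h1.
have f4 : mu4 \is a fin_num by rewrite ge0_fin_numE// (le_lt_trans h1)// ltry.
exists (fine mu4); rewrite ?fineK//.
by rewrite -!lee_fin fineK// h0 h1.
Qed.

(** An equality rather than a bound, because the polarization below subtracts fourth moments; [mu4]
    is estimated only after the cancellation. *)
Lemma lin_moment4 (a : 'cV[R]_n) :
  (\int[P]_w (lin a w ^+ 4)%:E = (sqn a ^+ 2)%:E * mu4)%E.
Proof.
have mp : measurable_fun setT (fun x : R => (x ^+ 4)%:E).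
  by apply/measurable_EFinP; exact: measurable_funX.
have p0 (x : R) : (0 <= (x ^+ 4)%:E)%E by rewrite lee_fin exprn_even_ge0.
have [a0|] := eqVneq (sqn a) 0.
  have /eqP -> : a == 0 by rewrite -sqn_eq0 a0.
  rewrite dotv0 expr0n/= mul0e integral0_eq// => w _.
  by rewrite lin0 expr0n.
move=> a1; have a0 : 0 < sqn a by rewrite lt_neqAle eq_sym a1 sqn_ge0.
rewrite (integral_lin (f := fun x => (x ^+ 4)%:E))//.
set r := Num.sqrt (sqn a); have r0 : 0 < r by rewrite sqrtr_gt0.
have -> : sqn a ^+ 2 = r ^+ 4 by rewrite -(@sqr_sqrtr _ (sqn a)) ?ltW// -exprM.
have mr : measurable_fun [set: measurableTypeR R]
    (fun x : measurableTypeR R => r * x : measurableTypeR R).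
  exact: measurable_funM.
transitivity (\int[distribution (normal_prob 0 sigma) (as_mfun mr)]_x (x ^+ 4)%:E)%E.
  apply: eq_measure_integral => A mA _; rewrite mulrC -{1}(gtr0_norm r0).
  by apply/esym; apply: normal_prob_scale => //; rewrite gt_eqF.
rewrite ge0_integral_distribution//= -ge0_integralZl//.
by apply: eq_integral => x _; rewrite -EFinM exprMn.
Qed.

Variables (J : finType) (b : J -> 'cV[R]_n).

Let Q w := \sum_j lin (b j) w ^+ 2.
Let V := \sum_j sqn (b j).

Let measurable_Q : measurable_fun setT Q.
Proof.
by apply: measurable_sum => j; apply: measurable_funX; exact: measurable_lin.
Qed.

Let Q0 w : 0 <= Q w.
Proof. by apply: sumr_ge0 => j _; exact: sqr_ge0. Qed.

Let EQ_ge : ((sigma ^+ 2 * V)%:E <= \int[P]_w (Q w)%:E)%E.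
Proof.
under eq_integral do rewrite /Q -sumEFin.
rewrite ge0_integral_sum//; first last.
- by move=> j w _; rewrite lee_fin sqr_ge0.
- by move=> j; apply/measurable_EFinP; apply: measurable_funX; exact: measurable_lin.
by rewrite /V mulr_sumr -sumEFin; apply: lee_sum => j _; exact: lin_moment2_ge.
Qed.

(* Polarization: the fourth moments of the linear forms b_j + b_k and
   b_j - b_k determine E (b_j . X)^2 (b_k . X)^2. *)
Let EQ2_le : (\int[P]_w (Q w ^+ 2)%:E <=
  (sigma ^+ 4 * (V ^+ 2 + 2 * \sum_j \sum_k dotv (b j) (b k) ^+ 2))%:E)%E.
Proof.
have [m m4 /andP[m0 m3]] := mu4E.
have mp a : measurable_fun setT (fun w => (lin a w ^+ 4)%:E).
  by apply/measurable_EFinP; apply: measurable_funX; exact: measurable_lin.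
have mp2 (c : R) a : measurable_fun setT (fun w => (c * lin a w ^+ 4)%:E).
  apply/measurable_EFinP; apply: measurable_funM => //.
  by apply: measurable_funX; exact: measurable_lin.
have p0 a w : (0 <= (lin a w ^+ 4)%:E)%E by rewrite lee_fin exprn_even_ge0.
pose f (jk : J * J) w := lin (b jk.1 + b jk.2) w ^+ 4 + lin (b jk.1 - b jk.2) w ^+ 4.
pose g (jk : J * J) w := 2 * lin (b jk.1) w ^+ 4 + 2 * lin (b jk.2) w ^+ 4.
have f0 jk w : 0 <= f jk w by rewrite addr_ge0// exprn_even_ge0.
have g0 jk w : 0 <= g jk w by rewrite addr_ge0// mulr_ge0// exprn_even_ge0.
have mf jk : measurable_fun setT (f jk).
  by apply: measurable_funD; apply: measurable_funX; exact: measurable_lin.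
have mg jk : measurable_fun setT (g jk).
  by apply: measurable_funD; apply: measurable_funM => //; apply: measurable_funX;
    exact: measurable_lin.
(* Summed over pairs, (x + y)^4 + (x - y)^4 = 12 x^2 y^2 + 2 x^4 + 2 y^4. The fourth powers stay on
   the left, so that only nonnegative functions are integrated. *)
have QE w : 12 * Q w ^+ 2 + \sum_jk g jk w = \sum_jk f jk w.
  rewrite /Q expr2 mulr_suml mulr_sumr -[X in _ + X](pair_bigA _ (fun j k => g (j, k) w)).
  rewrite -[RHS](pair_bigA _ (fun j k => f (j, k) w))/= -big_split/=.
  apply: eq_bigr => j _; rewrite mulr_sumr mulr_sumr -big_split/=.
  by apply: eq_bigr => k _; rewrite /f /g/= linD linB; ring.
have intf jk : (\int[P]_w (f jk w)%:E =
    (m * (sqn (b jk.1 + b jk.2) ^+ 2 + sqn (b jk.1 - b jk.2) ^+ 2))%:E)%E.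
  under eq_integral do rewrite /f EFinD.
  rewrite ge0_integralD// !lin_moment4 m4 -!EFinM -EFinD; congr (_%:E); ring.
have intg jk : (\int[P]_w (g jk w)%:E =
    (m * (2 * sqn (b jk.1) ^+ 2 + 2 * sqn (b jk.2) ^+ 2))%:E)%E.
  under eq_integral do rewrite /g EFinD.
  rewrite ge0_integralD//; first last.
  - by move=> w _; rewrite lee_fin mulr_ge0// exprn_even_ge0.
  - by move=> w _; rewrite lee_fin mulr_ge0// exprn_even_ge0.
  under eq_integral do rewrite EFinM.
  rewrite ge0_integralZl//.
  under [X in (_ + X)%E]eq_integral do rewrite EFinM.
  rewrite ge0_integralZl// !lin_moment4 m4 -!EFinM -EFinD; congr (_%:E); ring.
have mQ2 : measurable_fun setT (fun w => (12 * Q w ^+ 2)%:E).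
  apply/measurable_EFinP; apply: measurable_funM => //.
  exact: measurable_funX.
have : ((12%:E * \int[P]_w (Q w ^+ 2)%:E) + \int[P]_w (\sum_jk g jk w)%:E =
    \int[P]_w (\sum_jk f jk w)%:E)%E.
  rewrite -ge0_integralZl//; first last.
  - by move=> w _; rewrite lee_fin sqr_ge0.
  - by apply/measurable_EFinP; exact: measurable_funX.
  rewrite -ge0_integralD//; first last.
  - by apply/measurable_EFinP; apply: measurable_sum.
  - by move=> w _; rewrite lee_fin sumr_ge0.
  - by move=> w _; rewrite lee_fin mulr_ge0// sqr_ge0.
  by apply: eq_integral => w _; rewrite -EFinM -EFinD QE.
have sumint (h : J * J -> Omega -> R) : (forall jk, measurable_fun setT (h jk)) ->
    (forall jk w, 0 <= h jk w) ->
    (\int[P]_w (\sum_jk h jk w)%:E = \sum_jk \int[P]_w (h jk w)%:E)%E.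
  move=> mh h0; under eq_integral do rewrite -sumEFin.
  rewrite ge0_integral_sum//.
    by move=> jk; apply/measurable_EFinP.
  by move=> jk w _; rewrite lee_fin.
rewrite !sumint//; under [X in (_ + X)%E = _]eq_bigr do rewrite intg.
under [X in _ = X -> _]eq_bigr do rewrite intf.
rewrite [(\sum_i _)%R in X in X = _]sumEFin sumEFin.
have : (0 <= \int[P]_w (Q w ^+ 2)%:E)%E.
  by apply: integral_ge0 => w _; rewrite lee_fin sqr_ge0.
case: (\int[P]_w (Q w ^+ 2)%:E)%E => [i||]// _; last first.
  by rewrite gt0_muley// addye.
rewrite -EFinM -EFinD => -[intE]; rewrite lee_fin.
have {intE} : 12 * i = \sum_jk m * (sqn (b jk.1 + b jk.2) ^+ 2 + sqn (b jk.1 - b jk.2) ^+ 2)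
   - \sum_jk m * (2 * sqn (b jk.1) ^+ 2 + 2 * sqn (b jk.2) ^+ 2).
  by move: intE; lra.
rewrite -sumrB.
rewrite (eq_bigr (fun jk : J * J => m * (4 * (sqn (b jk.1) * sqn (b jk.2)) +
   8 * dotv (b jk.1) (b jk.2) ^+ 2))); last first.
  by move=> jk _; rewrite sqnD sqnB; ring.
rewrite -mulr_sumr big_split/= -!mulr_sumr.
rewrite -(pair_bigA _ (fun j k => sqn (b j) * sqn (b k)))/=.
rewrite -(pair_bigA _ (fun j k => dotv (b j) (b k) ^+ 2))/=.
have -> : \sum_j \sum_k sqn (b j) * sqn (b k) = V ^+ 2.
  rewrite expr2 {1}/V mulr_suml; apply: eq_bigr => j _.
  by rewrite mulr_sumr.
set D := \sum_j \sum_k _.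
have D0 : 0 <= D by apply: sumr_ge0 => j _; apply: sumr_ge0 => k _; exact: sqr_ge0.
have V0 : 0 <= V ^+ 2 by exact: sqr_ge0.
move=> intE.
have : m * (4 * V ^+ 2 + 8 * D) <= 3 * sigma ^+ 4 * (4 * V ^+ 2 + 8 * D).
  by rewrite ler_wpM2r// addr_ge0// mulr_ge0.
lra.
Qed.

(** Chebyshev with the variance bound 2 sigma^4 D. Expanding E (Q - c)^2 takes an upper bound on E
    Q^2 and a lower bound on E Q, and these are the two one-sided estimates above. *)
Lemma quadratic_chebyshev (r : R) : 0 < r ->
  (P [set w | (r <= `|\sum_j lin (b j) w ^+ 2 - sigma ^+ 2 * \sum_j sqn (b j)|)%R] <=
   (2 * sigma ^+ 4 * (\sum_j \sum_k dotv (b j) (b k) ^+ 2) / r ^+ 2)%:E)%E.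
Proof.
move=> r0; set c := sigma ^+ 2 * _; set D := \sum_j \sum_k _; set A := [set w | _].
have V0 : 0 <= V by apply: sumr_ge0 => j _; exact: sqn_ge0.
have c0 : 0 <= c by rewrite mulr_ge0// sqr_ge0.
have c2 : 0 <= 2 * c by rewrite mulr_ge0.
have mQc : measurable_fun setT (fun w => Q w - c) by exact: measurable_funB.
have mA : measurable A.
  have := measurable_preimage (measurableT_comp (@normr_measurable R setT) mQc)
    (measurable_itv `[r, +oo[).
  by congr measurable; apply/seteqP; split => w /=; rewrite in_itv/= andbT.
have mQ2 : measurable_fun setT (fun w => (Q w ^+ 2)%:E).
  by apply/measurable_EFinP; exact: measurable_funX.
have mQE : measurable_fun setT (fun w => (Q w)%:E) by exact/measurable_EFinP.
have mS : measurable_fun setT (fun w => ((Q w - c) ^+ 2)%:E).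
  by apply/measurable_EFinP; exact: measurable_funX.
have S0 w : (0 <= ((Q w - c) ^+ 2)%:E)%E by rewrite lee_fin sqr_ge0.
have I2f : (\int[P]_w (Q w ^+ 2)%:E)%E \is a fin_num.
  rewrite ge0_fin_numE ?(le_lt_trans EQ2_le)// ?ltry//.
  by apply: integral_ge0 => w _; rewrite lee_fin sqr_ge0.
have EB : (\int[P]_w ((Q w - c) ^+ 2)%:E <= (2 * sigma ^+ 4 * D)%:E)%E.
  (* The expansion of the square, with the cross term moved to the left so that all integrands are
     nonnegative. *)
  have h : (\int[P]_w ((Q w - c) ^+ 2)%:E + (2 * c)%:E * \int[P]_w (Q w)%:E =
      \int[P]_w (Q w ^+ 2)%:E + (c ^+ 2)%:E)%E.
    rewrite -ge0_integralZl//; first last.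
    - by move=> w _; rewrite lee_fin.
    have -> : (c ^+ 2)%:E = (\int[P]_w (cst (c ^+ 2)%:E w))%E.
      by rewrite integral_cst// [X in (_ * X)%E]probability_setT mule1.
    rewrite -!ge0_integralD//; first last.
    - by apply: emeasurable_funM.
    - by move=> w _; rewrite mule_ge0// lee_fin.
    - by move=> w _; rewrite lee_fin sqr_ge0.
    - by move=> w _; rewrite lee_fin sqr_ge0.
    by apply: eq_integral => w _; rewrite /cst -!EFinD; congr (_%:E); ring.
  have h1 : (\int[P]_w ((Q w - c) ^+ 2)%:E + (2 * c)%:E * c%:E <=
      (sigma ^+ 4 * (V ^+ 2 + 2 * D))%:E + (c ^+ 2)%:E)%E.
    apply: le_trans (_ : _ <= \int[P]_w (Q w ^+ 2)%:E + (c ^+ 2)%:E)%E _; last first.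
      by rewrite leeD2r// EQ2_le.
    rewrite -h leeD2l// lee_wpmul2l// lee_fin.
  rewrite -EFinM -EFinD -leeBrDr// -EFinB in h1.
  apply: le_trans h1 _; rewrite lee_fin /c -/V; lra.
have : ((r ^+ 2)%:E * P A <= \int[P]_w ((Q w - c) ^+ 2)%:E)%E.
  have -> : P A = (\int[P]_w (\1_A w)%:E)%E by rewrite integral_indic// setIT.
  rewrite -ge0_integralZl//; first last.
  - by rewrite lee_fin sqr_ge0.
  - by apply/measurable_EFinP; exact: measurable_indic.
  apply: ge0_le_integral => //.
  - by move=> w _; rewrite -EFinM lee_fin mulr_ge0// sqr_ge0.
  - apply/measurable_EFinP; apply: measurable_funM => //; exact: measurable_indic.
  move=> w _; rewrite -EFinM lee_fin indicE; case: (boolP (w \in A)) => wA; last first.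
    by rewrite mulr0 sqr_ge0.
  rewrite mulr1 -[leRHS]real_normK ?num_real// lerXn2r ?nnegrE// ?(ltW r0)//.
  by move/set_mem: wA.
move=> /le_trans /(_ EB) h.
by rewrite mulrC EFinM lee_pdivlMl// exprn_gt0.
Qed.

End GaussianFamily.

(** * Hat matrices *)

Section HatMatrix.
Variables (R : realType) (n k : nat) (S : 'M[R]_(n, k)).
Hypothesis Su : S^T *m S \in unitmx.

Definition hat : 'M[R]_n := S *m invmx (S^T *m S) *m S^T.

Lemma hat_sym : hat^T = hat.
Proof.
by rewrite /hat !trmx_mul trmxK trmx_inv trmx_mul trmxK mulmxA.
Qed.

Lemma hat_mul : hat *m S = S.
Proof. by rewrite /hat -!mulmxA mulVmx// mulmx1. Qed.

Lemma hat_idem : hat *m hat = hat.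
Proof. by rewrite {2}/hat !mulmxA hat_mul. Qed.

Lemma hat_trace : \tr hat = k%:R.
Proof.
by rewrite /hat -mulmxA mxtrace_mulC -mulmxA mulVmx// mxtrace1.
Qed.

Lemma hatC i j : hat i j = hat j i.
Proof. by rewrite -[in LHS]hat_sym [LHS]mxE. Qed.

Lemma sum_sqn_hat : \sum_i sqn (col i hat) = k%:R.
Proof.
rewrite -hat_trace; apply: eq_bigr => i _.
rewrite -[in RHS]hat_idem dotvE mxE; apply: eq_bigr => j _.
by rewrite [col _ _ _ _]mxE (hatC i j).
Qed.

Lemma hat_entry (e : 'cV[R]_n) i : (hat *m e) i 0 = dotv (col i hat) e.
Proof.
by rewrite dotvE mxE; apply: eq_bigr => j _; rewrite [col _ _ _ _]mxE (hatC i j).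
Qed.

Lemma sqn_hat_sum (e : 'cV[R]_n) :
  sqn (hat *m e) = \sum_i dotv (col i hat) e ^+ 2.
Proof. by rewrite dotvE; apply: eq_bigr => i _; rewrite hat_entry expr2. Qed.

Lemma sqn_hat (e : 'cV[R]_n) : sqn (hat *m e) = dotv e (hat *m e).
Proof. by rewrite [LHS]dotv_mulmx hat_sym mulmxA hat_idem dotvC. Qed.

Lemma sqn_residual (e : 'cV[R]_n) : sqn (e - hat *m e) = sqn e - sqn (hat *m e).
Proof. rewrite sqnB -sqn_hat; ring. Qed.

Lemma dotv_hat_le (e : 'cV[R]_n) v :
  dotv e (S *m v) ^+ 2 <= sqn (hat *m e) * sqn (S *m v).
Proof.
have -> : dotv e (S *m v) = dotv (hat *m e) (S *m v).
  by rewrite -[in RHS]hat_sym -dotv_mulmx mulmxA hat_mul.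
exact: cauchy_schwarz.
Qed.

(** The vector whose product with the response is the i-th least-squares coefficient. Its squared
    norm is the diagonal entry in the denominator of the t-statistic. *)
Definition coef_form (i : 'I_k) : 'cV[R]_n :=
  S *m invmx (S^T *m S) *m delta_mx i 0.

Lemma dotv_delta (v : 'cV[R]_k) i : dotv v (delta_mx i 0) = v i 0.
Proof. by rewrite /dotv -colE !mxE. Qed.

Lemma coef_formP (e : 'cV[R]_n) i :
  (invmx (S^T *m S) *m (S^T *m e)) i 0 = dotv (coef_form i) e.
Proof.
rewrite -dotv_delta [RHS]dotvC /coef_form dotv_mulmx.
by rewrite trmx_mul trmx_inv trmx_mul trmxK mulmxA.
Qed.

Lemma sqn_coef_form i : sqn (coef_form i) = invmx (S^T *m S) i i.
Proof.
rewrite -coef_formP /coef_form !mulmxA -2!mulmxA mulmxA.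
by rewrite -[_ *m S^T *m S]mulmxA mulVmx// mul1mx -colE mxE.
Qed.

Lemma sqn_coef_form_gt0 i : 0 < sqn (coef_form i).
Proof.
rewrite lt_def sqn_ge0 andbT; apply/negP => /eqP h0.
have: coef_form i = 0 by apply/eqP; rewrite -sqn_eq0 h0.
move=> /(congr1 (mulmx S^T)); rewrite mulmx0 /coef_form !mulmxA.
rewrite mulmxV// mul1mx => /matrixP/(_ i 0).
by rewrite !mxE !eqxx => /eqP; rewrite oner_eq0.
Qed.

End HatMatrix.

(** * Least squares when the model contains the signal *)

Section Overfit.
Variables (R : realType) (n p : nat) (dat : dataset R n p) (M : {set 'I_p}).
Variables (beta : 'cV[R]_p) (e : 'cV[R]_n).
Let S := subcols (design dat) M.
Hypothesis Su : S^T *m S \in unitmx.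
Hypothesis yE : responses dat = design dat *m beta + e.
Hypothesis betaM : supp beta \subset M.

Lemma ls_coef_overfit :
  ls_coef dat M = subvec M beta + invmx (S^T *m S) *m (S^T *m e).
Proof.
rewrite /ls_coef -/S yE -(mulmx_subvec _ betaM) -/S !mulmxDr.
by rewrite [S^T *m (_ *m _)]mulmxA [invmx _ *m (S^T *m S *m _)]mulmxA mulVmx// mul1mx.
Qed.

Lemma residual_variance_overfit :
  residual_variance dat M = (sqn e - sqn (hat S *m e)) / (n%:R - #|M|%:R).
Proof.
rewrite /residual_variance; congr (_ / _).
rewrite -sqn_residual// dotvE; apply: eq_bigr => i _; rewrite -expr2.
have -> : e - hat S *m e = responses dat - design dat *m ls_fit dat M.
  rewrite -/(extend _) mulmx_extend -/S ls_coef_overfit mulmxDr.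
  rewrite (mulmx_subvec _ betaM) yE opprD addrACA subrr add0r.
  by rewrite /hat !mulmxA.
by rewrite !mxE.
Qed.

(** A null coefficient is estimated by a pure noise term. Dividing by n - m instead of n only
    enlarges the variance estimate, so [v] bounds it from below and a rejection makes the linear
    form exceed a nonrandom threshold. *)
Lemma t_stat_reject k (c v : R) : 0 <= c -> 0 <= v ->
  (#|M| < n)%N -> enum_val k \notin supp beta ->
  v * n%:R <= sqn e - sqn (hat S *m e) ->
  c < `|t_stat dat k| ->
  c * Num.sqrt v * Num.sqrt (sqn (coef_form S k)) < `|dotv (coef_form S k) e|.
Proof.
move=> c0 v0 Mn kb vn; rewrite /t_stat -/S ls_coef_overfit.
rewrite mxE coef_formP//.
have -> : subvec M beta k 0 = 0.
  by rewrite mxE; move: kb; rewrite inE negbK => /eqP.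
rewrite add0r -sqn_coef_form// residual_variance_overfit.
set V := _ / (n%:R - _).
have nM : 0 < n%:R - #|M|%:R :> R by rewrite subr_gt0 ltr_nat.
have vV : v <= V.
  rewrite ler_pdivlMr//; apply: le_trans vn.
  by apply: ler_wpM2l => //; rewrite lerBlDr lerDl ler0n.
have sq0 : 0 < Num.sqrt (sqn (coef_form S k)).
  by rewrite sqrtr_gt0 sqn_coef_form_gt0.
(* Here the square root is 0 and division by 0 yields 0, so the statistic is 0 and cannot exceed
   [c]. *)
have [V0|V0] := leP V 0.
  by rewrite (ler0_sqrtr V0) mul0r invr0 mulr0 normr0 ltNge c0.
have sV : 0 < Num.sqrt V by rewrite sqrtr_gt0.
rewrite normrM normfV (gtr0_norm (mulr_gt0 sV sq0)).
rewrite ltr_pdivlMr ?mulr_gt0// mulrA => h; apply: le_lt_trans h.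
rewrite ler_pM2r// ler_wpM2l// ler_sqrt//; exact: ltW.
Qed.

End Overfit.

Section Comparison.
Context d (T : measurableType d) (R : realType) (f g : T -> R).
Hypotheses (mf : measurable_fun setT f) (mg : measurable_fun setT g).

Lemma measurable_le_set : measurable [set w | f w <= g w].
Proof.
have := measurable_fun_ler mf mg measurableT (Y := [set true]) I.
by rewrite setTI.
Qed.

Lemma measurable_lt_set : measurable [set w | f w < g w].
Proof.
have := measurable_fun_ltr mf mg measurableT (Y := [set true]) I.
by rewrite setTI.
Qed.

End Comparison.

Section UnionBound.
Context d (Omega : measurableType d) (R : realType) (P : probability Omega R).
Variables (I : finType) (J : {set I}) (A : I -> set Omega).
Hypothesis mA : forall i, measurable (A i).

Lemma exists_in_bigcup :
  [set w | exists2 i, i \in J & A i w] = \big[setU/set0]_(i in J) A i.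
Proof.
apply/seteqP; split=> w /=.
  by case=> i iJ Ai; rewrite -bigcup_seq_cond; exists i => //=;
    rewrite mem_index_enum.
by rewrite -bigcup_seq_cond => -[i /=] /andP[_ iJ] Ai; exists i.
Qed.

Lemma measurable_exists_in : measurable [set w | exists2 i, i \in J & A i w].
Proof. by rewrite exists_in_bigcup; apply: bigsetU_measurable. Qed.

Lemma exists_in_bound (r : R) : (forall i, i \in J -> P (A i) <= r%:E)%E ->
  (P [set w | exists2 i, i \in J & A i w] <= (#|J|%:R * r)%:E)%E.
Proof.
move=> h; rewrite exists_in_bigcup.
have -> : (#|J|%:R * r)%:E = (\sum_(i in J) r%:E)%E.
  by rewrite sumEFin sumr_const mulr_natl.
suff : measurable (\big[setU/set0]_(i in J) A i) /\
  (P (\big[setU/set0]_(i in J) A i) <= \sum_(i in J) r%:E)%E by case.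
elim/big_ind2 : _ => [|E1 x1 E2 x2 [m1 h1] [m2 h2]|i iJ].
- by rewrite measure0.
- split; first exact: measurableU.
  by apply: le_trans (measureU2 _ m1 m2) _; apply: leeD.
- by split; [exact: mA|exact: h].
Qed.
End UnionBound.

Section GaussianHat.
Context d (Omega : measurableType d) (R : realType) (P : probability Omega R).
Variables (n : nat) (X : 'I_n -> Omega -> R) (sigma : R).
Hypothesis sigma0 : 0 < sigma.
Hypothesis GX : gaussian_family P X sigma.

Definition noise_vector (w : Omega) : 'cV[R]_n := \col_i X i w.

Lemma lin_dotv a w : lin X a w = dotv a (noise_vector w).
Proof. by rewrite dotvE; apply: eq_bigr => i _; rewrite mxE. Qed.

Lemma measurable_lin_gt a r : measurable [set w | r < `|lin X a w|].
Proof.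
have mf : measurable_fun setT (fun w => `|lin X a w|).
  by apply: measurableT_comp; [exact: normr_measurable|exact: measurable_lin GX a].
exact: measurable_lt_set.
Qed.

Lemma lin_tail a t : 0 <= t ->
  (P [set w | (t * Num.sqrt (sqn a) < `|lin X a w|)%R] <=
   (Num.sqrt 2 * expR (- (t ^+ 2 / (4 * sigma ^+ 2))))%:E)%E.
Proof.
move=> t0; have [a0|a0] := eqVneq (sqn a) 0.
  have -> : [set w | t * Num.sqrt (sqn a) < `|lin X a w|] = set0.
    apply/seteqP; split=> w //=; rewrite a0 sqrtr0 mulr0.
    have /eqP -> : a == 0 by rewrite -sqn_eq0 a0.
    by rewrite lin0 normr0 ltxx.
  by rewrite measure0 lee_fin mulr_ge0 ?sqrtr_ge0 ?expR_ge0.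
have a1 : 0 < sqn a by rewrite lt_def a0 sqn_ge0.
have q0 : 0 < Num.sqrt (sqn a) by rewrite sqrtr_gt0.
have mB : measurable [set x : R | t * Num.sqrt (sqn a) < `|x|].
  by apply: measurable_lt_set => //; exact: normr_measurable.
rewrite [leLHS](GX.2 a a1 _ mB).
apply: le_trans (normal_tail _ _) _; [by rewrite mulr_gt0|by rewrite mulr_ge0 ?sqrtr_ge0|].
rewrite lee_fin ler_wpM2l ?sqrtr_ge0// ler_expR lerN2.
rewrite [X in _ <= X](_ : _ = t ^+ 2 / (4 * sigma ^+ 2))//.
by field; rewrite (gt_eqF sigma0) (gt_eqF q0).
Qed.

Lemma measurable_sum_lin_sq (J : finType) (b : J -> 'cV[R]_n) :
  measurable_fun setT (fun w => \sum_j lin X (b j) w ^+ 2).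
Proof.
apply: measurable_sum => j; apply: measurable_funX; exact: measurable_lin GX _.
Qed.

(* The squared norms of the rows a of the hat matrix sum to k, so some row has
   (a . e)^2 > (t / k) |a|^2. *)
Lemma hat_tail k (S : 'M[R]_(n, k)) t : S^T *m S \in unitmx -> 0 <= t ->
  measurable [set w | t < sqn (hat S *m noise_vector w)] /\
  (P [set w | (t < sqn (hat S *m noise_vector w))%R] <=
   (n%:R * (Num.sqrt 2 * expR (- (t / (4 * k%:R * sigma ^+ 2)))))%:E)%E.
Proof.
move=> Su t0.
have mE : measurable [set w | t < sqn (hat S *m noise_vector w)].
  apply: measurable_lt_set => //.
  under eq_fun do rewrite sqn_hat_sum//; under eq_fun do under eq_bigr do rewrite -lin_dotv.
  exact: measurable_sum_lin_sq.
split=> //.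
set r := Num.sqrt (t / k%:R).
have r2 : r ^+ 2 = t / k%:R by rewrite sqr_sqrtr// divr_ge0.
have r0 : 0 <= r by rewrite sqrtr_ge0.
have := @exists_in_bound _ _ _ P _ [set: 'I_n]%SET
  (fun i => [set w | r * Num.sqrt (sqn (col i (hat S))) < `|lin X (col i (hat S)) w|])
  (fun i => measurable_lin_gt _ _)
  (Num.sqrt 2 * expR (- (r ^+ 2 / (4 * sigma ^+ 2)))) (fun i _ => lin_tail _ r0).
rewrite cardsT card_ord r2.
have -> : t / (4 * k%:R * sigma ^+ 2) = t / k%:R / (4 * sigma ^+ 2).
  by rewrite -[RHS]mulrA -invfM [k%:R * (_ * _)]mulrCA [4 * (_ * _)]mulrA.
apply: le_trans; apply: le_measure; rewrite ?inE//.
  by apply: measurable_exists_in => i; exact: measurable_lin_gt.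
move=> w /=; rewrite sqn_hat_sum// => tw.
apply: contrapT => hn.
have hi i : dotv (col i (hat S)) (noise_vector w) ^+ 2 <= r ^+ 2 * sqn (col i (hat S)).
  rewrite -lin_dotv -real_normK ?num_real//.
  rewrite -[sqn _]sqr_sqrtr ?sqn_ge0// -exprMn.
  rewrite ler_pXn2r// ?nnegrE ?normr_ge0// ?mulr_ge0 ?sqrtr_ge0//.
  rewrite leNgt; apply/negP => h; by apply: hn; exists i; [exact: finset.in_setT|exact: h].
have : t < r ^+ 2 * k%:R.
  rewrite -(sum_sqn_hat Su) mulr_sumr; apply: lt_le_trans tw _.
  exact: ler_sum.
rewrite r2; have [->|k0] := eqVneq (k%:R : R) 0.
  by rewrite mulr0 ltNge t0.
by rewrite divfK// ltxx.
Qed.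

End GaussianHat.

(** * The noise on a fixed design *)

(** A measurable event outside which [noise_bounds] holds: sparse vectors are replaced by
    projections onto models of exactly [k2] columns, and the set [N] is fixed as the first n
    columns. *)
Definition noise_bad (R : realType) n p (X : 'M[R]_(n, p)) (e : 'cV[R]_n)
    (c tau t : R) (k2 : nat) : Prop :=
  [\/ tau * n%:R < sqn e,
      exists2 M : {set 'I_p}, M \in [set M : {set 'I_p} | #|M| == k2]%SET &
        t < sqn (hat (subcols X M) *m e) |
      \sum_(j : 'I_p | (j < n)%N) (X^T *m e) j 0 ^+ 2 < c * n%:R ^+ 2].

Lemma card_ord_lt n p : (n <= p)%N -> #|[set j : 'I_p | (j < n)%N]%SET| = n.
Proof.
move=> np; rewrite -sum1_card (eq_bigl (fun j : 'I_p => (j < n)%N)); last by move=> j; rewrite inE.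
by rewrite (big_ord_narrow np) sum1_card card_ord.
Qed.

Lemma noise_not_bad (R : realType) n p (X : 'M[R]_(n, p)) (e : 'cV[R]_n)
    (c tau t : R) (k2 : nat) :
  (k2 <= n <= p)%N ->
  (forall M : {set 'I_p}, (#|M| <= n)%N ->
    (subcols X M)^T *m subcols X M \in unitmx) ->
  ~ noise_bad X e c tau t k2 -> noise_bounds X e c tau t k2.
Proof.
move=> /andP[k2n np] Xu nb; split.
- by rewrite leNgt; apply/negP => h; apply: nb; apply: Or31.
- move=> b bk; have [|M bM Mk] := @superset_card _ (supp b) k2.
    by rewrite bk card_ord (leq_trans k2n).
  have MU : (subcols X M)^T *m subcols X M \in unitmx by apply: Xu; rewrite Mk.
  rewrite -(mulmx_subvec _ bM).
  apply: le_trans (dotv_hat_le MU _ _) _; rewrite ler_wpM2r ?sqn_ge0//.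
  by rewrite leNgt; apply/negP => h; apply: nb; apply: Or32; exists M => //; rewrite inE Mk.
- exists [set j : 'I_p | (j < n)%N]%SET; first by rewrite card_ord_lt.
  rewrite leNgt; apply/negP => h; apply: nb; apply: Or33.
  by rewrite (eq_bigl (fun j : 'I_p => (j < n)%N)) in h => // j; rewrite inE.
Qed.

Section NoiseProbability.
Context d (Omega : measurableType d) (R : realType) (P : probability Omega R).
Variables (n p : nat) (Z : 'I_n -> Omega -> R) (sigma : R).
Hypothesis sigma0 : 0 < sigma.
Hypothesis GZ : gaussian_family P Z sigma.
Hypothesis n0 : (0 < n)%N.
Let e w := noise_vector Z w.

Lemma measurable_sqn_noise : measurable_fun setT (fun w => sqn (e w)).
Proof.
rewrite (_ : (fun w => _) = fun w => \sum_(j < n) lin Z (delta_mx j 0) w ^+ 2).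
  exact: (measurable_sum_lin_sq GZ).
apply/funext => w; rewrite dotvE; apply: eq_bigr => j _.
by rewrite lin_dotv dotvC dotv_delta expr2.
Qed.

Lemma sqn_noise_chebyshev r : 0 < r ->
  (P [set w | (r <= `|sqn (e w) - sigma ^+ 2 * n%:R|)%R] <=
   (2 * sigma ^+ 4 * n%:R / r ^+ 2)%:E)%E.
Proof.
move=> r0; have := quadratic_chebyshev sigma0 GZ (fun j : 'I_n => delta_mx j 0) r0.
have sq1 (j k : 'I_n) : dotv (delta_mx j 0 : 'cV[R]_n) (delta_mx k 0) = (j == k)%:R.
  by rewrite dotv_delta mxE eqxx andbT eq_sym.
have -> : \sum_(j < n) \sum_(k < n)
    dotv (delta_mx j 0 : 'cV[R]_n) (delta_mx k 0) ^+ 2 = n%:R :> R.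
  rewrite -[in RHS](card_ord n) -sum1_card natr_sum; apply: eq_bigr => j _.
  rewrite (bigD1 j)//= sq1 eqxx expr1n big1 ?addr0// => k kj.
  by rewrite sq1 eq_sym (negbTE kj) expr0n.
move=> h; apply: le_trans h; rewrite le_eqVlt; apply/orP; left; apply/eqP; congr (P _).
apply/seteqP; split=> w /=;
  (have -> : \sum_(j < n) lin Z (delta_mx j 0) w ^+ 2 = sqn (e w);
   [by rewrite dotvE; apply: eq_bigr => j _; rewrite lin_dotv dotvC dotv_delta expr2|]);
  (have -> : \sum_(j < n) sqn (delta_mx j 0 : 'cV[R]_n) = n%:R;
   [by rewrite -[in RHS](card_ord n) -sum1_card natr_sum; apply: eq_bigr => j _;
     rewrite sq1 eqxx|]) => //.
Qed.

Variables (X : 'M[R]_(n, p)) (C0 kap : R) (k1 k2 : nat) (t : R).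
Hypothesis bounds : design_bounds X C0 kap k1.
Hypothesis k10 : (0 < k1)%N.
Hypothesis C00 : 0 <= C0.
Hypothesis kap0 : 0 < kap.
Hypothesis np : (n <= p)%N.
Hypothesis k2n : (k2 <= n)%N.
Hypothesis t0 : 0 <= t.
Hypothesis Xu : forall M : {set 'I_p}, (#|M| <= n)%N ->
    (subcols X M)^T *m subcols X M \in unitmx.

(** [tau * n] is twice the expectation of [sqn e]. The first n columns have squared norm at least n
    kap each, so their squared correlations with the noise have total mean at least sigma^2 kap n^2;
    [c] takes half of this. *)
Let tau := 2 * sigma ^+ 2.
Let c := sigma ^+ 2 * kap / 2.

Lemma measurable_tr_noise :
  measurable_fun setT (fun w => \sum_(j : 'I_p | (j < n)%N) (X^T *m e w) j 0 ^+ 2).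
Proof.
rewrite (_ : (fun w => _) = fun w =>
  \sum_(j < n) lin Z (col (widen_ord np j) X) w ^+ 2).
  exact: (measurable_sum_lin_sq GZ).
apply/funext => w; rewrite (big_ord_narrow np); apply: eq_bigr => j _.
rewrite lin_dotv dotvE mxE; congr (_ ^+ 2); apply: eq_bigr => i _.
by rewrite !mxE.
Qed.

Lemma supp_delta (j : 'I_p) : supp (delta_mx j 0 : 'cV[R]_p) = [set j]%SET.
Proof.
by apply/setP => i; rewrite !inE mxE eqxx andbT; case: (i == j); rewrite /= ?oner_eq0 ?eqxx.
Qed.

Lemma sqn_col_bounds j : n%:R * kap <= sqn (col j X) <= n%:R * C0.
Proof.
have s1 : sqn (delta_mx j 0 : 'cV[R]_p) = 1 by rewrite dotv_delta mxE !eqxx.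
have [b1 b2] := bounds.
have := b1 (delta_mx j 0); have := b2 (delta_mx j 0).
by rewrite supp_delta cards1 s1 !mulr1 -colE => -> // -> //.
Qed.

(** For each j, [tr_design_bound] gives sum_k (b_j . b_k)^2 <= n C0 |b_j|^2 <= (n C0)^2, so the
    variance is of order n^3, while the mean sigma^2 V is at least of order n^2. Chebyshev at half
    the mean leaves order 1 / n. *)
Lemma tr_noise_chebyshev :
  (P [set w | (\sum_(j : 'I_p | (j < n)%N) (X^T *m e w) j 0 ^+ 2 < c * n%:R ^+ 2)%R]
   <= (8 * C0 ^+ 2 / (kap ^+ 2 * n%:R))%:E)%E.
Proof.
pose b (j : 'I_n) := col (widen_ord np j) X.
pose V := \sum_(j < n) sqn (b j).
have nR : 0 < n%:R :> R by rewrite ltr0n.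
have V1 : n%:R ^+ 2 * kap <= V.
  have -> : n%:R ^+ 2 * kap = \sum_(j < n) n%:R * kap.
    by rewrite sumr_const card_ord -[RHS]mulr_natl expr2 mulrA.
  by apply: ler_sum => j _; have /andP[] := sqn_col_bounds (widen_ord np j).
pose r := sigma ^+ 2 * V / 2.
have V0 : 0 < V by apply: lt_le_trans V1; rewrite mulr_gt0// exprn_gt0.
have r0 : 0 < r by rewrite /r divr_gt0// mulr_gt0// exprn_gt0.
have hS : \sum_j \sum_k dotv (b j) (b k) ^+ 2 <= n%:R ^+ 3 * C0 ^+ 2.
  have -> : n%:R ^+ 3 * C0 ^+ 2 = \sum_(j < n) n%:R * C0 * (n%:R * C0).
    rewrite sumr_const card_ord -[RHS]mulr_natl; ring.
  apply: ler_sum => j _.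
  have := tr_design_bound (N := [set k : 'I_p | (k < n)%N]%SET) (b j) bounds C00.
  rewrite card_ord_lt// leqnn => /(_ isT).
  rewrite (eq_bigl (fun j : 'I_p => (j < n)%N)); last by move=> k; rewrite inE.
  rewrite (big_ord_narrow np) => h.
  have -> : \sum_(k < n) dotv (b j) (b k) ^+ 2 =
     \sum_(k < n) (X^T *m b j) (widen_ord np k) 0 ^+ 2.
    apply: eq_bigr => k _; congr (_ ^+ 2).
    by rewrite dotvC dotvE mxE; apply: eq_bigr => i _; rewrite !mxE.
  apply: le_trans h _; rewrite ler_wpM2l//; first by rewrite mulr_ge0.
  by have /andP[] := sqn_col_bounds (widen_ord np j).
have := quadratic_chebyshev sigma0 GZ b r0 => h.
apply: le_trans (le_trans h _).
  apply: le_measure; rewrite ?inE.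
  - by apply: measurable_lt_set => //; exact: measurable_tr_noise.
  - apply: measurable_le_set => //; apply: measurableT_comp; first exact: normr_measurable.
    apply: measurable_funB => //; exact: (measurable_sum_lin_sq GZ).
  - move=> w /=; rewrite (big_ord_narrow np) => hw.
    rewrite ler_normr; apply/orP; right.
    rewrite opprB lerBrDr -lerBrDl;
    have -> : \sum_j lin Z (b j) w ^+ 2 = \sum_(i < n) (X^T *m e w) (widen_ord np i) 0 ^+ 2.
      apply: eq_bigr => j _; rewrite lin_dotv dotvE mxE; congr (_ ^+ 2).
      by apply: eq_bigr => i _; rewrite !mxE.
    apply: ltW; apply: lt_le_trans hw _; rewrite -/V /r /c.
    have : sigma ^+ 2 * (n%:R ^+ 2 * kap) <= sigma ^+ 2 * V.
      by rewrite ler_wpM2l// sqr_ge0.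
    nra.
rewrite lee_fin ler_pdivrMr ?exprn_gt0//.
have : 2 * sigma ^+ 4 * (\sum_j \sum_k dotv (b j) (b k) ^+ 2) <=
   2 * sigma ^+ 4 * (n%:R ^+ 3 * C0 ^+ 2).
  by rewrite ler_wpM2l// mulr_ge0// exprn_ge0// ltW.
move=> /le_trans; apply.
rewrite [X in _ <= X * _](_ : _ = 8 * C0 ^+ 2 / kap ^+ 2 / n%:R); last first.
  by field; rewrite (gt_eqF nR) (gt_eqF kap0).
rewrite /r.
have h2 : (n%:R ^+ 2 * kap) ^+ 2 <= V ^+ 2.
  by rewrite ler_pXn2r// nnegrE ?(ltW V0)// mulr_ge0 ?(ltW kap0)// exprn_ge0.
have -> : 8 * C0 ^+ 2 / kap ^+ 2 / n%:R * (sigma ^+ 2 * V / 2) ^+ 2 =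
   2 * C0 ^+ 2 / kap ^+ 2 / n%:R * sigma ^+ 4 * V ^+ 2.
  by field; rewrite (gt_eqF nR) (gt_eqF kap0).
have -> : 2 * sigma ^+ 4 * (n%:R ^+ 3 * C0 ^+ 2) =
  2 * C0 ^+ 2 / kap ^+ 2 / n%:R * sigma ^+ 4 * (n%:R ^+ 2 * kap) ^+ 2.
  by field; rewrite (gt_eqF nR) (gt_eqF kap0).
rewrite ler_wpM2l// !mulr_ge0// ?invr_ge0 ?exprn_ge0// ltW//.
Qed.

Lemma card_sized_le : (#|[set M : {set 'I_p} | #|M| == k2]%SET| <= p ^ k2)%N.
Proof.
rewrite card_draws card_ord.
apply: (@leq_trans (p ^_ k2)); first by rewrite -bin_ffact leq_pmulr// fact_gt0.
rewrite ffact_prod -[X in (_ <= _ ^ X)%N](card_ord k2) -prod_nat_const.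
by apply: leq_prod => i _; exact: leq_subr.
Qed.

(** One term per clause of [noise_bad]: Chebyshev for the norm of the noise, a union over at most
    p^k2 models and n rows of each hat matrix, and Chebyshev for the correlations. *)
Definition noise_rate : R :=
  2 / n%:R + (p%:R ^+ k2 * (n%:R *
    (Num.sqrt 2 * expR (- (t / (4 * k2%:R * sigma ^+ 2))))) +
  8 * C0 ^+ 2 / (kap ^+ 2 * n%:R)).

Lemma noise_bad_prob :
  (P [set w | noise_bad X (e w) c tau t k2] <= (noise_rate)%:E)%E.
Proof.
pose A1 := [set w | tau * n%:R < sqn (e w)].
pose A2 := [set w | exists2 M : {set 'I_p}, M \in [set M : {set 'I_p} | #|M| == k2]%SET &
        t < sqn (hat (subcols X M) *m e w)].
pose A3 := [set w | \sum_(j : 'I_p | (j < n)%N) (X^T *m e w) j 0 ^+ 2 < c * n%:R ^+ 2].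
have nR : 0 < n%:R :> R by rewrite ltr0n.
have U (M : {set 'I_p}) : #|M| = k2 -> (subcols X M)^T *m subcols X M \in unitmx.
  by move=> Mk; apply: Xu; rewrite Mk.
have m1 : measurable A1.
  by apply: measurable_lt_set => //; exact: measurable_sqn_noise.
have m3 : measurable A3.
  by apply: measurable_lt_set => //; exact: measurable_tr_noise.
pose B (M : {set 'I_p}) := if #|M| == k2 then
  [set w | t < sqn (hat (subcols X M) *m e w)] else set0.
have mB M : measurable (B M).
  by rewrite /B; case: eqP => // Mk; case: (hat_tail sigma0 GZ (U _ Mk) t0).
have A2E : A2 = [set w | exists2 M : {set 'I_p},
    M \in [set M : {set 'I_p} | #|M| == k2]%SET & B M w].
  by apply/seteqP; split=> w [M]; rewrite inE => Mk h; exists M; rewrite ?inE//;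
    move: h; rewrite /B Mk.
have m2 : measurable A2 by rewrite A2E; exact: measurable_exists_in.
have -> : [set w | noise_bad X (e w) c tau t k2] = A1 `|` (A2 `|` A3).
  apply/seteqP; split=> w /=.
    by case=> h; [left|right; left|right; right].
  by case=> [h|[h|h]]; [apply: Or31|apply: Or32|apply: Or33].
apply: le_trans (measureU2 _ m1 (measurableU _ _ m2 m3)) _.
rewrite /noise_rate EFinD; apply: leeD.
  have r0 : 0 < sigma ^+ 2 * n%:R by rewrite mulr_gt0// exprn_gt0.
  apply: le_trans (le_trans (sqn_noise_chebyshev r0) _).
    apply: le_measure; rewrite ?inE//.
      apply: measurable_le_set => //; apply: measurableT_comp; first exact: normr_measurable.
      by apply: measurable_funB => //; exact: measurable_sqn_noise.
    move=> w; rewrite /A1 /tau /= => hw.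
    by rewrite ler_normr; apply/orP; left; lra.
  rewrite lee_fin le_eqVlt; apply/orP; left; apply/eqP.
  by field; rewrite (gt_eqF nR) (gt_eqF sigma0).
apply: le_trans (measureU2 _ m2 m3) _.
rewrite EFinD; apply: leeD; last exact: tr_noise_chebyshev.
set q := (n%:R * _); have q0 : 0 <= q.
  by rewrite mulr_ge0// mulr_ge0 ?sqrtr_ge0 ?expR_ge0.
have hB : (P [set w | exists2 M : {set 'I_p},
    M \in [set M : {set 'I_p} | #|M| == k2]%SET & B M w] <=
    (#|[set M : {set 'I_p} | #|M| == k2]%SET|%:R * q)%:E)%E.
  apply: exists_in_bound => // M; rewrite inE => /eqP Mk; rewrite /B (introT eqP Mk).
  have [_ h] := hat_tail sigma0 GZ (U _ Mk) t0; apply: le_trans h _.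
  by rewrite Mk.
rewrite A2E; apply: le_trans hB _.
by rewrite lee_fin ler_wpM2r// -natrX ler_nat card_sized_le.
Qed.
End NoiseProbability.

(** * Normal quantiles and t-statistics *)

Section StandardNormal.
Variable R : realType.
Local Notation N := (@normal_prob R 0 1).

Lemma std_normal_fin_num (A : set R) : measurable A -> N A \is a fin_num.
Proof. by move=> mA; exact: fin_num_measure. Qed.

Lemma normal_peak1_le : normal_peak (1 : R) <= 1 / 2.
Proof.
rewrite /normal_peak div1r lef_pV2 ?posrE//; last first.
  rewrite sqrtr_gt0; move: (@pi_gt0 R) => h; lra.
rewrite -[leLHS]ger0_norm// -sqrtr_sqr ler_wsqrtr//.
move: (@pi_ge2 R); lra.
Qed.

Lemma std_normal_itv_le (a b : R) : a <= b ->
  (N `]a, b]%classic <= ((b - a) / 2)%:E)%E.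
Proof.
move=> ab; rewrite /normal_prob.
have -> : ((b - a) / 2)%:E =
    (\int[lebesgue_measure]_(x in `]a, b]%classic) (1 / 2)%:E)%E.
  by rewrite integral_cst//= lebesgue_measure_itv/= lte_fin; case: ltP => h;
    rewrite -?EFinB -?EFinM; congr EFin; nra.
apply: ge0_le_integral => //.
- by move=> x _; rewrite lee_fin normal_pdf_ge0.
- by apply: measurable_funTS; exact: measurable_normalE.
- move=> x _; rewrite lee_fin; apply: le_trans normal_peak1_le.
  by apply: normal_pdf_ub; rewrite oner_eq0.
Qed.

Lemma measurable_gt_set (a : R) : measurable [set x : R | a < x].
Proof. by apply: measurable_lt_set. Qed.

Lemma std_normal_split (a b : R) : a <= b ->
  N [set x | a < x] = (N `]a, b]%classic + N [set x | (b < x)%R])%E.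
Proof.
move=> ab; rewrite -measureU//; last 2 first.
- exact: measurable_gt_set.
- apply/seteqP; split=> x //= []; rewrite in_itv /= => /andP[_ xb] bx.
  by move: (lt_le_trans bx xb); rewrite ltxx.
congr (N _); apply/seteqP; split=> x /=; rewrite in_itv /=.
  by move=> ax; have [h|h] := leP x b; [left; rewrite ax|right].
by case=> [/andP[]//|]; exact: le_lt_trans.
Qed.

Lemma std_normal_opp (A : set R) : measurable A -> N (-%R @^-1` A) = N A.
Proof.
move=> mA; have n1 : -1 != 0 :> R by rewrite oppr_eq0 oner_eq0.
have := normal_prob_scale ltr01 n1 mA.
rewrite normrN1 mul1r => <-; by congr (N _); apply/seteqP; split=> x /=; rewrite mulN1r.
Qed.

Lemma std_normal_abs (z : R) : 0 <= z ->
  N [set x | z < `|x|] = (2%:E * N [set x | (z < x)%R])%E.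
Proof.
move=> z0; have -> : [set x : R | z < `|x|] =
    [set x | z < x] `|` (-%R @^-1` [set x | z < x]).
  by apply/seteqP; split=> x /=; rewrite lter_normr => /orP.
rewrite measureU; last 3 first.
- exact: measurable_gt_set.
- by apply: measurable_lt_set => //; exact: oppr_measurable.
- by apply/seteqP; split=> x //= -[h1 h2]; lra.
have /= -> := std_normal_opp (measurable_gt_set z).
by rewrite -mule2n muleC mule_natr.
Qed.

Lemma std_normal_half : N [set x | 0 < x] = (1 / 2)%:E.
Proof.
have h := std_normal_abs (lexx 0).
have h0 : N [set 0] = 0%E by rewrite /normal_prob integral_set1.
have h1 : (N [set x | (0 < `|x|)%R] = 1)%E.
  rewrite -(probability_setT (normal_prob 0 1)).
  have -> : [set: R] = [set 0] `|` [set x | 0 < `|x|].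
    apply/seteqP; split=> x //= _; rewrite normr_gt0.
    by have [->|] := eqVneq x 0; [left|right].
  rewrite measureU//; last 2 first.
  - by apply: measurable_lt_set => //; exact: normr_measurable.
  - by apply/seteqP; split=> x //= -[->]; rewrite normr0 ltxx.
  by rewrite [X in (X + _)%E]h0 add0e.
move: h; rewrite h1.
have : N [set x | 0 < x] \is a fin_num by exact: std_normal_fin_num (measurable_gt_set 0).
case: (N [set x | 0 < x]) => // r _; rewrite -EFinM => -[h]; congr EFin; lra.
Qed.

Let F (z : R) := fine (N [set x | z < x]).

Let FE z : N [set x | z < x] = (F z)%:E.
Proof.
by rewrite /F fineK//; exact: std_normal_fin_num (measurable_gt_set z).
Qed.

(** The density is at most 1/2 since pi >= 2. This gives continuity of the tail and prices a
    slightly lowered threshold. *)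
Lemma std_normal_lipschitz (a b : R) : a <= b ->
  F b <= F a <= F b + (b - a) / 2.
Proof.
move=> ab; have := std_normal_split ab; have := std_normal_itv_le ab.
rewrite !FE.
have mI : measurable (`]a, b]%classic : set R) by exact: measurable_itv.
have : N `]a, b]%classic \is a fin_num by exact: std_normal_fin_num mI.
have : (0 <= N `]a, b]%classic)%E by exact: measure_ge0.
case: (N `]a, b]%classic) => // r; rewrite !lee_fin => r0 _ h [->]; lra.
Qed.

Lemma continuous_std_normal_tail : continuous F.
Proof.
move=> x; apply/cvgrPdist_lt => e e0; near=> y.
have : `|x - y| < e by near: y; exact: cvgr_dist_lt.
have [xy|yx] := leP x y.
  have /andP[] := std_normal_lipschitz xy.
  by rewrite !ltr_norml => h1 h2 /andP[h3 h4]; apply/andP; split; lra.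
have /andP[] := std_normal_lipschitz (ltW yx).
by rewrite !ltr_norml => h1 h2 /andP[h3 h4]; apply/andP; split; lra.
Unshelve. all: by end_near.
Qed.

(** [normal_tail] together with exp x >= 1 + x. This polynomial decay is enough to bracket the
    quantiles and to bound them by sqrt (4 / u). *)
Lemma std_normal_tail_le (z : R) : 0 <= z ->
  (1 + z ^+ 2 / 4) * F z <= 1.
Proof.
move=> z0; have := @normal_tail R 1 z ltr01 z0.
rewrite std_normal_abs// FE -EFinM lee_fin expr1n mulr1 => h.
have e0 : 0 < expR (z ^+ 2 / 4) by exact: expR_gt0.
have e1 := expR_ge1Dx (z ^+ 2 / 4).
have s2 : Num.sqrt 2 <= 2 :> R.
  by rewrite -[leRHS]ger0_norm// -sqrtr_sqr ler_wsqrtr//; lra.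
move: h; rewrite expRN -ler_pdivrMr ?invr_gt0// invrK => h.
have F0 : 0 <= F z by rewrite fine_ge0.
apply: le_trans (ler_wpM2r F0 e1) _; nra.
Qed.

(** Existence by the intermediate value theorem: the tail is 1/2 at 0 and at most u at sqrt (4 /
    u). *)
Lemma upper_quantileP (u : R) : 0 < u < 1 / 2 ->
  N [set x | upper_quantile u < x] = u%:E.
Proof.
move=> /andP[u0 u1]; rewrite /upper_quantile.
apply: (@xgetPex _ 0 [set z | N [set x : R | z < x] = u%:E]).
pose b := Num.sqrt (4 / u).
have b0 : 0 <= b by rewrite sqrtr_ge0.
have b2 : b ^+ 2 = 4 / u by rewrite sqr_sqrtr// divr_ge0// ltW.
have F0 : F 0 = 1 / 2 by rewrite /F std_normal_half.
have Fb : F b <= u.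
  have := std_normal_tail_le b0; rewrite b2 => h.
  have Fb0 : 0 <= F b by rewrite fine_ge0.
  rewrite -[leRHS]mulr1 -ler_pdivrMl//.
  apply: le_trans h; rewrite ler_wpM2r//.
  have : 0 < u^-1 by rewrite invr_gt0.
  lra.
have [|c _ Fc] := @IVT R F 0 b u b0 (continuous_subspaceT continuous_std_normal_tail).
  by rewrite ge_min le_max F0 Fb orbT /= (ltW u1).
by exists c; rewrite /= FE Fc.
Qed.

Lemma upper_quantile_ge0 (u : R) : 0 < u < 1 / 2 -> 0 <= upper_quantile u.
Proof.
move=> hu; have /andP[u0 u1] := hu; rewrite leNgt; apply/negP => z0.
have := std_normal_lipschitz (ltW z0); rewrite /F std_normal_half upper_quantileP//=.
lra.
Qed.

Lemma upper_quantile_le (u : R) : 0 < u < 1 / 2 ->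
  upper_quantile u <= Num.sqrt (4 / u).
Proof.
move=> hu; have /andP[u0 u1] := hu.
have z0 := upper_quantile_ge0 hu.
have := std_normal_tail_le z0; rewrite {1}/F upper_quantileP//= => h.
rewrite -[leLHS]ger0_norm// -sqrtr_sqr ler_wsqrtr// ler_pdivlMr//; lra.
Qed.

Lemma std_normal_abs_quantile_le (u y : R) : 0 < u < 1 / 2 ->
  0 <= y <= upper_quantile u ->
  (N [set x | (y < `|x|)%R] <= (2 * u + (upper_quantile u - y))%:E)%E.
Proof.
move=> hu /andP[y0 yz].
rewrite std_normal_abs// FE -EFinM lee_fin.
have /andP[_] := std_normal_lipschitz yz.
rewrite {2}/F upper_quantileP//=; lra.
Qed.

End StandardNormal.

(** Contains every false rejection for a fixed model that includes the signal. The random variance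
    estimate appears only in the first clause; in the second, Gaussian forms face nonrandom
    thresholds. *)
Definition t_test_bad (R : realType) n p (X : 'M[R]_(n, p)) (e : 'cV[R]_n)
    (M D : {set 'I_p}) (z v : R) : Prop :=
  sqn e - sqn (hat (subcols X M) *m e) < v * n%:R \/
  exists2 k : 'I_#|M|, k \in [set k | enum_val k \notin D]%SET &
    z * Num.sqrt v * Num.sqrt (sqn (coef_form (subcols X M) k)) <
    `|dotv (coef_form (subcols X M) k) e|.

Lemma quantile_level (R : realType) (m : nat) (alpha : R) : 0 < alpha < 1 ->
  (0 < m)%N -> 0 < alpha / (2 * m%:R) < 1 / 2.
Proof.
move=> /andP[a0 a1] m0; have mR : 1 <= m%:R :> R by rewrite ler1n.
apply/andP; split; first by rewrite divr_gt0//; lra.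
rewrite ltr_pdivrMr; lra.
Qed.

Lemma cleaned_t_test_bad (R : realType) n p (dat : dataset R n p) (alpha v : R)
    (M : {set 'I_p}) (beta : 'cV[R]_p) :
  let X := design dat in
  0 < alpha < 1 -> 0 <= v -> (#|M| < n)%N -> supp beta \subset M ->
  (subcols X M)^T *m subcols X M \in unitmx ->
  (~: supp beta :&: cleaned dat alpha M)%SET != finset.set0 ->
  t_test_bad X (responses dat - X *m beta) M (supp beta)
    (upper_quantile (alpha / (2 * #|M|%:R))) v.
Proof.
move=> X ha v0 Mn bM Xu /set0Pn[j]; rewrite finset.in_setI finset.in_setC => /andP[jb].
move=> /imsetP[k]; rewrite inE => zk jE.
have m0 : (0 < #|M|)%N by apply/card_gt0P; exists j; rewrite jE enum_valP.
have z0 := upper_quantile_ge0 (quantile_level ha m0).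
rewrite /t_test_bad; set e := responses dat - _.
have yE : responses dat = design dat *m beta + e by rewrite /e addrC subrK.
have [h|h] := ltP (sqn e - sqn (hat (subcols X M) *m e)) (v * n%:R); first by left.
right; exists k; first by rewrite inE -jE.
by apply: t_stat_reject Xu yE bM _ _ _ z0 v0 Mn _ h zk; rewrite -jE.
Qed.

Section TTestProbability.
Context d (Omega : measurableType d) (R : realType) (P : probability Omega R).
Variables (n p : nat) (Z : 'I_n -> Omega -> R) (sigma : R).
Hypothesis sigma0 : 0 < sigma.
Hypothesis GZ : gaussian_family P Z sigma.
Hypothesis n0 : (0 < n)%N.
Variables (X : 'M[R]_(n, p)) (M D : {set 'I_p}) (alpha eta : R).
Hypothesis Xu : (subcols X M)^T *m subcols X M \in unitmx.
Hypothesis M0 : (0 < #|M|)%N.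
Hypothesis ha : 0 < alpha < 1.
Hypothesis heta : 0 < eta < 1.
Let e w := noise_vector Z w.
Let z := upper_quantile (alpha / (2 * #|M|%:R)).
Let v := sigma ^+ 2 * (1 - eta).

Lemma residual_small_prob :
  measurable [set w | sqn (e w) - sqn (hat (subcols X M) *m e w) < v * n%:R] /\
  (P [set w | (sqn (e w) - sqn (hat (subcols X M) *m e w) < v * n%:R)%R] <=
   (8 / (eta ^+ 2 * n%:R) +
    n%:R * (Num.sqrt 2 * expR (- (eta * n%:R / (8 * #|M|%:R)))))%:E)%E.
Proof.
have nR : 0 < n%:R :> R by rewrite ltr0n.
have mR : 0 < #|M|%:R :> R by rewrite ltr0n.
have /andP[e0 e1] := heta.
have s2 : 0 < sigma ^+ 2 by rewrite exprn_gt0.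
have mE : measurable [set w | sqn (e w) - sqn (hat (subcols X M) *m e w) < v * n%:R].
  apply: measurable_lt_set => //; apply: measurable_funB.
    exact: measurable_sqn_noise GZ.
  under eq_fun do rewrite sqn_hat_sum//; under eq_fun do under eq_bigr do rewrite -lin_dotv.
  exact: (measurable_sum_lin_sq GZ).
split=> //.
(* The deficit sigma^2 eta n is shared equally between the fluctuation of |e|^2 and the part of the
   noise absorbed by the model. *)
pose r := sigma ^+ 2 * (eta * n%:R / 2).
have r0 : 0 < r by rewrite mulr_gt0// divr_gt0// mulr_gt0.
have [mT hT] := hat_tail sigma0 GZ Xu (ltW r0).
have hC := sqn_noise_chebyshev sigma0 GZ r0.
have mC : measurable [set w | r <= `|sqn (e w) - sigma ^+ 2 * n%:R|].
  apply: measurable_le_set => //; apply: measurableT_comp; first exact: normr_measurable.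
  by apply: measurable_funB => //; exact: measurable_sqn_noise GZ.
apply: (@le_trans _ _ (P ([set w | r <= `|sqn (e w) - sigma ^+ 2 * n%:R|] `|`
  [set w | r < sqn (hat (subcols X M) *m e w)]))).
  apply: le_measure; rewrite ?inE//; first exact: measurableU.
  move=> w /=; rewrite /v => h.
  have [h1|h1] := ltP r (sqn (hat (subcols X M) *m e w)); first by right.
  by left; rewrite ler_normr; apply/orP; right; move: h h1; rewrite /r; lra.
apply: le_trans (measureU2 _ mC mT) _.
rewrite EFinD; apply: leeD.
  apply: le_trans hC _; rewrite lee_fin le_eqVlt; apply/orP; left; apply/eqP.
  by rewrite /r; field; rewrite (gt_eqF nR) (gt_eqF sigma0) (gt_eqF e0).
apply: le_trans hT _; rewrite lee_fin.
have -> : r / (4 * #|M|%:R * sigma ^+ 2) = eta * n%:R / (8 * #|M|%:R).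
  by rewrite /r; field; rewrite (gt_eqF mR) (gt_eqF sigma0).
exact: lexx.
Qed.

(** The normalized form is standard normal and faces the threshold z sqrt (1 - eta) >= z (1 - eta).
    Lowering the threshold by at most z eta costs at most z eta, by the Lipschitz bound on both
    tails. *)
Lemma coef_large_prob k :
  measurable [set w | z * Num.sqrt v * Num.sqrt (sqn (coef_form (subcols X M) k)) <
    `|dotv (coef_form (subcols X M) k) (e w)|] /\
  (P [set w | (z * Num.sqrt v * Num.sqrt (sqn (coef_form (subcols X M) k)) <
    `|dotv (coef_form (subcols X M) k) (e w)|)%R] <=
   (alpha / #|M|%:R + z * eta)%:E)%E.
Proof.
have mR : 0 < #|M|%:R :> R by rewrite ltr0n.
have /andP[e0 e1] := heta.
set a := coef_form _ k.
have a0 : 0 < sqn a by exact: sqn_coef_form_gt0.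
have hu := quantile_level ha M0.
have z0 : 0 <= z := upper_quantile_ge0 hu.
have E w : dotv a (e w) = lin Z a w by rewrite lin_dotv.
have -> : [set w | z * Num.sqrt v * Num.sqrt (sqn a) < `|dotv a (e w)|] =
  [set w | z * Num.sqrt v * Num.sqrt (sqn a) < `|lin Z a w|].
  by apply/seteqP; split=> w /=; rewrite E.
split; first exact: measurable_lin_gt GZ _ _.
have q0 : 0 < Num.sqrt (sqn a) by rewrite sqrtr_gt0.
have s0 : 0 < sigma * Num.sqrt (sqn a) by rewrite mulr_gt0.
have mB : measurable [set x : R | z * Num.sqrt v * Num.sqrt (sqn a) < `|x|].
  by apply: measurable_lt_set => //; exact: normr_measurable.
rewrite [leLHS](GZ.2 a a0 _ mB).
have := normal_prob_scale ltr01 (lt0r_neq0 s0) mB.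
rewrite (gtr0_norm s0) mulr1 => <-.
pose y := z * Num.sqrt (1 - eta).
have sv : Num.sqrt v = sigma * Num.sqrt (1 - eta).
  by rewrite /v sqrtrM ?sqr_ge0// sqrtr_sqr gtr0_norm.
have -> : (fun x => sigma * Num.sqrt (sqn a) * x) @^-1`
    [set x | z * Num.sqrt v * Num.sqrt (sqn a) < `|x|] = [set x | y < `|x|].
  apply/seteqP; split=> x /=; rewrite normrM (gtr0_norm s0) sv /y;
  rewrite (_ : _ * Num.sqrt (sqn a) =
    sigma * Num.sqrt (sqn a) * (z * Num.sqrt (1 - eta))); try ring;
  by rewrite ltr_pM2l.
have e2 : 1 - eta <= Num.sqrt (1 - eta).
  rewrite -[leLHS]ger0_norm ?subr_ge0 ?(ltW e1)// -sqrtr_sqr ler_wsqrtr//; nra.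
have e3 : Num.sqrt (1 - eta) <= 1.
  by rewrite -[leRHS]sqrtr1 ler_wsqrtr//; lra.
have hy : 0 <= y <= z.
  by rewrite mulr_ge0 ?sqrtr_ge0//= ler_piMr.
apply: le_trans (std_normal_abs_quantile_le hu hy) _.
rewrite lee_fin -/z /y.
have -> : 2 * (alpha / (2 * #|M|%:R)) = alpha / #|M|%:R.
  by field; rewrite (gt_eqF mR).
nra.
Qed.

Lemma t_test_bad_prob :
  (P [set w | t_test_bad X (e w) M D z v] <=
   (8 / (eta ^+ 2 * n%:R) +
    n%:R * (Num.sqrt 2 * expR (- (eta * n%:R / (8 * #|M|%:R)))) +
    (alpha + #|M|%:R * (Num.sqrt (8 * #|M|%:R / alpha) * eta)))%:E)%E.
Proof.
have mR : 0 < #|M|%:R :> R by rewrite ltr0n.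
have /andP[a0 a1] := ha.
have /andP[e0 e1] := heta.
have [m1 h1] := residual_small_prob.
pose B k := [set w | z * Num.sqrt v * Num.sqrt (sqn (coef_form (subcols X M) k)) <
    `|dotv (coef_form (subcols X M) k) (e w)|].
pose K := [set k : 'I_#|M| | enum_val k \notin D]%SET.
have mB k : measurable (B k) by case: (coef_large_prob k).
have m2 := measurable_exists_in K mB.
have := @exists_in_bound _ _ _ P _ K B mB _ (fun k _ => (coef_large_prob k).2).
move=> h2.
have -> : [set w | t_test_bad X (e w) M D z v] =
   [set w | sqn (e w) - sqn (hat (subcols X M) *m e w) < v * n%:R] `|`
   [set w | exists2 k, k \in K & B k w] by [].
apply: le_trans (measureU2 _ m1 m2) _; rewrite EFinD; apply: leeD => //.
apply: le_trans h2 _; rewrite lee_fin.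
have hu := quantile_level ha M0.
have z0 : 0 <= z := upper_quantile_ge0 hu.
have zle : z <= Num.sqrt (8 * #|M|%:R / alpha).
  apply: le_trans (upper_quantile_le hu) _.
  rewrite le_eqVlt; apply/orP; left; apply/eqP; congr Num.sqrt.
  by field; rewrite (gt_eqF mR) (gt_eqF a0).
have KM : #|K|%:R <= #|M|%:R :> R.
  by rewrite ler_nat; apply: leq_trans (max_card _) _; rewrite card_ord.
have az : 0 <= alpha / #|M|%:R + z * eta.
  by rewrite addr_ge0 ?divr_ge0 ?mulr_ge0// ltW.
apply: le_trans (ler_wpM2r az KM) _.
rewrite mulrDr mulrCA divff ?mulr1 ?(gt_eqF mR)// lerD2l ler_wpM2l ?(ltW mR)//.
by rewrite ler_wpM2r// ltW.
Qed.

End TTestProbability.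

(** * Measurability *)

Section FiniteQuantifiers.
Context d (T : measurableType d).

Lemma measurable_exists_fin (I : finType) (A : I -> set T) :
  (forall i, measurable (A i)) -> measurable [set w | exists i, A i w].
Proof.
move=> mA; rewrite (_ : [set w | _] = [set w | exists2 i, i \in [set: I]%SET & A i w]).
  exact: measurable_exists_in.
by apply/seteqP; split=> w /= [i]; exists i; rewrite // finset.in_setT.
Qed.

Lemma measurable_forall_fin (I : finType) (A : I -> set T) :
  (forall i, measurable (A i)) -> measurable [set w | forall i, A i w].
Proof.
move=> mA; rewrite (_ : [set w | _] = ~` [set w | exists i, (~` A i) w]).
  by apply: measurableC; apply: measurable_exists_fin => i; exact: measurableC.
apply/seteqP; split=> w /=; first by move=> h [i]; apply; exact: h.
by move=> h i; apply: contrapT => hi; apply: h; exists i.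
Qed.

Lemma measurable_forall_count (I : countType) (A : I -> set T) :
  (forall i, measurable (A i)) -> measurable [set w | forall i, A i w].
Proof.
move=> mA; rewrite (_ : [set w | _] =
    \bigcap_k (if unpickle k is Some i then A i else setT)).
  by apply: bigcapT_measurable => k; case: unpickle.
apply/seteqP; split=> w h; first by move=> k _; case: unpickle.
by move=> i; have := h (pickle i) Logic.I; rewrite pickleK.
Qed.

Lemma measurable_imply_cst (Q : bool) (A : set T) :
  (Q -> measurable A) -> measurable [set w | Q -> A w].
Proof.
case: Q => mA; last by rewrite (_ : [set w | _] = setT)//; apply/seteqP; split.
rewrite (_ : [set w | _] = A); first exact: mA.
by apply/seteqP; split=> w /=; [apply|move=> ? _].
Qed.

Lemma measurable_and_cst (Q : Prop) (A : set T) :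
  (Q -> measurable A) -> measurable [set w | Q /\ A w].
Proof.
move=> mA; have [q|nq] := pselect Q.
  by rewrite (_ : [set w | _] = A); [exact: mA|apply/seteqP; split=> w //= -[]].
by rewrite (_ : [set w | _] = set0)//; apply/seteqP; split=> w //= -[].
Qed.

End FiniteQuantifiers.

Definition mx_measurable d (T : measurableType d) (R : realType) m n
  (A : T -> 'M[R]_(m, n)) := forall i j, measurable_fun setT (fun w => A w i j).

(** Inversion is expressed through a power of x^2; at 0 both sides are 0. *)
Lemma measurable_inv (R : realType) :
  measurable_fun setT (GRing.inv : R -> R).
Proof.
rewrite (_ : GRing.inv = fun x : R => x * (x ^+ 2) `^ (-1)).
  apply: measurable_funM => //; apply: (measurableT_comp (measurable_powR _)).
  exact: measurable_funX.
apply/funext => x; rewrite powR_inv1 ?sqr_ge0//.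
have [->|x0] := eqVneq x 0; first by rewrite invr0 mul0r.
by field.
Qed.

Section MatrixMeasurability.
Context d (T : measurableType d) (R : realType).

Lemma mx_measurable_cst m n (A : 'M[R]_(m, n)) : mx_measurable (fun _ : T => A).
Proof. by move=> i j; exact: measurable_cst. Qed.

Lemma mx_measurable_mul m n k (A : T -> 'M[R]_(m, n)) (B : T -> 'M[R]_(n, k)) :
  mx_measurable A -> mx_measurable B -> mx_measurable (fun w => A w *m B w).
Proof.
move=> mA mB i j; under eq_fun do rewrite mxE.
by apply: measurable_sum => l; apply: measurable_funM; [exact: mA|exact: mB].
Qed.

Lemma mx_measurable_tr m n (A : T -> 'M[R]_(m, n)) :
  mx_measurable A -> mx_measurable (fun w => (A w)^T).
Proof. by move=> mA i j; under eq_fun do rewrite mxE; exact: mA. Qed.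

Lemma mx_measurable_sub m n (A B : T -> 'M[R]_(m, n)) :
  mx_measurable A -> mx_measurable B -> mx_measurable (fun w => A w - B w).
Proof.
move=> mA mB i j; under eq_fun do rewrite !mxE.
by apply: measurable_funB; [exact: mA|exact: mB].
Qed.

Lemma mx_measurable_subcols m n (A : T -> 'M[R]_(m, n)) (M : {set 'I_n}) :
  mx_measurable A -> mx_measurable (fun w => subcols (A w) M).
Proof. by move=> mA i j; under eq_fun do rewrite mxE; exact: mA. Qed.

Lemma measurable_det n (A : T -> 'M[R]_n) :
  mx_measurable A -> measurable_fun setT (fun w => \det (A w)).
Proof.
move=> mA; apply: measurable_sum => s; apply: measurable_funM => //.
by apply: measurable_prod => i _; exact: mA.
Qed.

Lemma measurable_unitmx n (A : T -> 'M[R]_n) :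
  mx_measurable A -> measurable [set w | A w \in unitmx].
Proof.
move=> mA; rewrite (_ : [set w | _] = ~` [set w | \det (A w) = 0]).
  apply: measurableC; have := measurable_det mA measurableT (measurable_set1 0).
  by rewrite setTI.
by apply/seteqP; split=> w /=; rewrite unitmxE unitfE => /eqP.
Qed.

Lemma mx_measurable_inv n (A : T -> 'M[R]_n) :
  mx_measurable A -> mx_measurable (fun w => invmx (A w)).
Proof.
move=> mA i j; rewrite (_ : (fun w => _) = fun w =>
    if A w \in unitmx then (\det (A w))^-1 * cofactor (A w) j i else A w i j).
  apply: measurable_fun_ifT; last exact: mA.
    apply: (@measurable_fun_bool _ _ _ _ true).
    by rewrite setTI; exact: measurable_unitmx.
  apply: measurable_funM.
    by apply: (measurableT_comp (@measurable_inv R)); exact: measurable_det.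
  rewrite /cofactor; apply: measurable_funM => //; apply: measurable_det => k l.
  by under eq_fun do rewrite !mxE; exact: mA.
by apply/funext => w; rewrite /invmx; case: ifP => // _; rewrite !mxE.
Qed.

Lemma measurable_dotv n (u v : T -> 'cV[R]_n) :
  mx_measurable u -> mx_measurable v ->
  measurable_fun setT (fun w => dotv (u w) (v w)).
Proof.
by move=> mu mv; apply: mx_measurable_mul => //; exact: mx_measurable_tr.
Qed.

Lemma mx_measurable_hat n k (A : T -> 'M[R]_(n, k)) :
  mx_measurable A -> mx_measurable (fun w => hat (A w)).
Proof.
move=> mA; have mt := mx_measurable_tr mA.
apply: mx_measurable_mul => //; apply: mx_measurable_mul => //.
by apply: mx_measurable_inv; exact: mx_measurable_mul.
Qed.

Lemma mx_measurable_coef_form n k (A : T -> 'M[R]_(n, k)) i :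
  mx_measurable A -> mx_measurable (fun w => coef_form (A w) i).
Proof.
move=> mA; have mt := mx_measurable_tr mA.
apply: mx_measurable_mul; last exact: mx_measurable_cst.
apply: mx_measurable_mul => //.
by apply: mx_measurable_inv; exact: mx_measurable_mul.
Qed.

End MatrixMeasurability.

(** Turns an uncountable family of conditions into a countable one: rational vectors approximate
    [v], and a quadratic form changes little. *)
Lemma psd_rational (R : realType) n (Q : 'M[R]_n) :
  (forall r : 'cV[rat]_n, 0 <= dotv (map_mx ratr r) (Q *m map_mx ratr r)) ->
  forall v, 0 <= dotv v (Q *m v).
Proof.
move=> h v; have [K K0 hK] := quadratic_bounded Q.
set u := (Q + Q^T) *m v.
(* Writing the approximation as v + e a with |a|^2 <= n, the error is e (a . u) + e^2 (a . Q a). The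
   first product is at most |u|^2 + n, the second at most K n, and e <= 1. *)
apply: (@le_of_le_add R _ _ (sqn u + n%:R + K * n%:R)).
  by rewrite !addr_ge0 ?sqn_ge0// mulr_ge0// ltW.
move=> e e0 e1.
have near i : {q : rat | `|ratr q - v i 0| <= e}.
  apply: cid; have [|q] := @rat_in_itvoo R (v i 0 - e) (v i 0 + e); first lra.
  by rewrite in_itv /= => /andP[q1 q2]; exists q; rewrite ler_norml; apply/andP; split; lra.
pose r : 'cV[rat]_n := \col_i sval (near i).
have [a rE sa] : exists2 a, map_mx ratr r = v + e *: a & sqn a <= n%:R.
  exists (e^-1 *: (map_mx ratr r - v)).
    by rewrite scalerA divff ?gt_eqF// scale1r addrC subrK.
  rewrite dotvE -[leRHS]mulr1 -[n in leRHS]card_ord -sum1_card natr_sum mulr_suml.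
  apply: ler_sum => i _; rewrite mul1r -expr2 -[leLHS]real_normK ?num_real//.
  rewrite expr_le1//= !mxE normrM normfV (gtr0_norm e0) mulrC ler_pdivrMr// mul1r.
  exact: (svalP (near i)).
have := h r; rewrite rE mulmxDr dotvDl !dotvDr -scalemxAr !dotvZl !dotvZr => h0.
have hu : dotv v (Q *m a) + dotv a (Q *m v) = dotv a u.
  by rewrite [dotv v _]dotv_mulmx dotvC -dotvDr -mulmxDl addrC.
have ha := hK a.
have := sqn_ge0 (u - a); rewrite sqnB [dotv u a]dotvC => hs.
have q0 := sqn_ge0 u; have qa := sqn_ge0 a.
have ha2 : dotv a (Q *m a) <= K * n%:R.
  by apply: le_trans (ler_norm _) (le_trans ha _); rewrite ler_wpM2l// ltW.
have hn : 0 <= K * n%:R by rewrite mulr_ge0// ltW.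
have t1 : e * dotv a u <= e * (sqn u + n%:R) by apply: ler_wpM2l; [exact: ltW|lra].
have t2 : e * (e * dotv a (Q *m a)) <= e * (K * n%:R).
  apply: ler_wpM2l; first exact: ltW.
  have := ler_wpM2l (ltW e0) ha2; nra.
have : 0 <= dotv v (Q *m v) + e * dotv a u + e * (e * dotv a (Q *m a)).
  by rewrite -hu mulrDr; lra.
lra.
Qed.

Lemma measurable_psd d (T : measurableType d) (R : realType) n
    (Q : T -> 'M[R]_n) :
  mx_measurable Q -> measurable [set w | forall v, 0 <= dotv v (Q w *m v)].
Proof.
move=> mQ; rewrite (_ : [set w | _] = [set w | forall r : 'cV[rat]_n,
    0 <= dotv (map_mx ratr r) (Q w *m map_mx ratr r)]); last first.
  by apply/seteqP; split=> w /= h; [move=> r; exact: h|exact: psd_rational].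
apply: measurable_forall_count => r; apply: measurable_le_set => //.
apply: measurable_dotv; first exact: mx_measurable_cst.
by apply: mx_measurable_mul => //; exact: mx_measurable_cst.
Qed.

(** A property of the covariates alone, so that it can be conditioned on while the noise stays
    Gaussian. *)
Definition design_ok (R : realType) n p (X : 'M[R]_(n, p)) (C0 kap : R)
    (k1 : nat) : Prop :=
  design_bounds X C0 kap k1 /\
  forall M : {set 'I_p}, (#|M| <= n)%N ->
    (subcols X M)^T *m subcols X M \in unitmx.

Section DatasetMeasurability.
Context d (T : measurableType d) (R : realType).
Variables (n p : nat) (X : T -> 'M[R]_(n, p)) (e : T -> 'cV[R]_n).
Hypothesis mX : mx_measurable X.
Hypothesis me : mx_measurable e.

Let measurable_sub_sqn (M : {set 'I_p}) (a b : R) :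
  measurable [set w | forall v, a * sqn v <= b * sqn (subcols (X w) M *m v)].
Proof.
pose Q w := b *: ((subcols (X w) M)^T *m subcols (X w) M) - a%:M.
rewrite (_ : [set w | _] = [set w | forall v, 0 <= dotv v (Q w *m v)]).
  apply: measurable_psd; apply: mx_measurable_sub; last exact: mx_measurable_cst.
  move=> i j; under eq_fun do rewrite mxE; apply: measurable_funM => //.
  apply: mx_measurable_mul; last exact: mx_measurable_subcols.
  by apply: mx_measurable_tr; exact: mx_measurable_subcols.
by apply/seteqP; split=> w /= h v; have := h v;
  rewrite /Q mulmxBl dotvBr mul_scalar_mx dotvZr -scalemxAl dotvZr -mulmxA
    [dotv _ (_^T *m _)]dotv_mulmx trmxK subr_ge0.
Qed.

Lemma sparse_quadraticP (x : 'M[R]_(n, p)) (a b : R) k :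
  (forall u, (#|supp u| <= k)%N -> a * sqn u <= b * sqn (x *m u)) <->
  (forall M : {set 'I_p}, (#|M| <= k)%N ->
    forall v, a * sqn v <= b * sqn (subcols x M *m v)).
Proof.
split=> h.
  move=> M Mk v; rewrite -mulmx_extend -(sqn_extend v); apply: h.
  by apply: leq_trans Mk; apply: subset_leq_card; exact: supp_extend.
move=> u uk; have s := fintype.subxx (supp u).
by rewrite -(sqn_subvec s) -(mulmx_subvec x s); exact: h.
Qed.

Lemma measurable_design_ok C0 kap k1 :
  measurable [set w | design_ok (X w) C0 kap k1].
Proof.
have m0 (a b : R) k : measurable
    [set w | forall u, (#|supp u| <= k)%N -> a * sqn u <= b * sqn (X w *m u)].
  rewrite (_ : [set w | _] = [set w | forall M : {set 'I_p}, (#|M| <= k)%N ->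
    forall v, a * sqn v <= b * sqn (subcols (X w) M *m v)]); last first.
    by apply/seteqP; split=> w /= /sparse_quadraticP.
  apply: measurable_forall_fin => M.
  by apply: (measurable_imply_cst (A := [set w | forall v,
    a * sqn v <= b * sqn (subcols (X w) M *m v)])).
(* The upper bound is the same kind of inequality with both coefficients negated, so [m0] covers
   both. *)
rewrite (_ : [set w | _] =
  ([set w | forall u, (#|supp u| <= n)%N -> - (n%:R * C0) * sqn u <= (- 1) * sqn (X w *m u)] `&`
   [set w | forall u, (#|supp u| <= k1)%N -> (n%:R * kap) * sqn u <= 1 * sqn (X w *m u)]) `&`
   [set w | forall M : {set 'I_p}, (#|M| <= n)%N ->
     (subcols (X w) M)^T *m subcols (X w) M \in unitmx]).
  apply: measurableI; first exact: measurableI.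
  apply: measurable_forall_fin => M; apply: measurable_imply_cst => _.
  apply: measurable_unitmx; apply: mx_measurable_mul; last exact: mx_measurable_subcols.
  by apply: mx_measurable_tr; exact: mx_measurable_subcols.
apply/seteqP; split=> w /=.
  move=> [[h1 h2] h3]; split=> //; split=> u hu; last by rewrite mul1r; exact: h2.
  by rewrite mulN1r mulNr lerN2; exact: h1.
move=> [[h1 h2] h3]; split=> //; split=> u hu; last by have := h2 _ hu; rewrite mul1r.
by have := h1 _ hu; rewrite mulN1r mulNr lerN2.
Qed.

Let measurable_sqn_hat (M : {set 'I_p}) :
  measurable_fun setT (fun w => sqn (hat (subcols (X w) M) *m e w)).
Proof.
have m1 : mx_measurable (fun w => hat (subcols (X w) M) *m e w).
  by apply: mx_measurable_mul => //; apply: mx_measurable_hat; exact: mx_measurable_subcols.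
exact: measurable_dotv.
Qed.

Lemma measurable_noise_bad c tau t k2 :
  measurable [set w | noise_bad (X w) (e w) c tau t k2].
Proof.
rewrite (_ : [set w | _] = [set w | tau * n%:R < sqn (e w)] `|`
  ([set w | exists M : {set 'I_p}, M \in [set M : {set 'I_p} | #|M| == k2]%SET /\
        t < sqn (hat (subcols (X w) M) *m e w)] `|`
   [set w | \sum_(j : 'I_p | (j < n)%N) ((X w)^T *m e w) j 0 ^+ 2 < c * n%:R ^+ 2])).
  apply: measurableU; first by apply: measurable_lt_set => //; exact: measurable_dotv.
  apply: measurableU.
    apply: measurable_exists_fin => M; apply: measurable_and_cst => _.
    exact: measurable_lt_set.
  apply: measurable_lt_set => //; under eq_fun do rewrite -big_filter.
  apply: measurable_sum => j; apply: measurable_funX.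
  by apply: mx_measurable_mul => //; exact: mx_measurable_tr.
apply/seteqP; split=> w /=.
  case=> [h|[M h1 h2]|h]; [by left|right; left; by exists M|by right; right].
by case=> [h|[[M [h1 h2]]|h]]; [apply: Or31|apply: Or32; exists M|apply: Or33].
Qed.

Lemma measurable_t_test_bad (M D : {set 'I_p}) z v :
  measurable [set w | t_test_bad (X w) (e w) M D z v].
Proof.
rewrite (_ : [set w | _] =
  [set w | sqn (e w) - sqn (hat (subcols (X w) M) *m e w) < v * n%:R] `|`
  [set w | exists k : 'I_#|M|, k \in [set k | enum_val k \notin D]%SET /\
    z * Num.sqrt v * Num.sqrt (sqn (coef_form (subcols (X w) M) k)) <
    `|dotv (coef_form (subcols (X w) M) k) (e w)|]).
  apply: measurableU.
    by apply: measurable_lt_set => //; apply: measurable_funB => //; exact: measurable_dotv.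
  apply: measurable_exists_fin => k; apply: measurable_and_cst => _.
  have mc : mx_measurable (fun w => coef_form (subcols (X w) M) k).
    by apply: mx_measurable_coef_form; exact: mx_measurable_subcols.
  apply: measurable_lt_set; last first.
    by apply: measurableT_comp; [exact: normr_measurable|exact: measurable_dotv].
  apply: measurable_funM => //.
  apply: measurableT_comp; last exact: measurable_dotv.
  by apply: continuous_measurable_fun; exact: sqrt_continuous.
apply/seteqP; split=> w /=; first by case=> [h|[k h1 h2]]; [left|right; exists k].
by case=> [h|[k [h1 h2]]]; [left|right; exists k].
Qed.

End DatasetMeasurability.

Section Dataset.
Variables (R : realType) (n p : nat).

Lemma mx_measurable_design :
  mx_measurable (fun dat : dataset R n p => design dat).
Proof.
move=> i j; under eq_fun do rewrite mxE.
apply: (measurableT_comp (measurable_tnth j)).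
by apply: (measurableT_comp measurable_fst); exact: measurable_tnth.
Qed.

Lemma mx_measurable_responses :
  mx_measurable (fun dat : dataset R n p => responses dat).
Proof.
move=> i j; under eq_fun do rewrite mxE.
by apply: (measurableT_comp measurable_snd); exact: measurable_tnth.
Qed.

Lemma mx_measurable_noise (beta : 'cV[R]_p) :
  mx_measurable (fun dat : dataset R n p => responses dat - design dat *m beta).
Proof.
apply: mx_measurable_sub; first exact: mx_measurable_responses.
by apply: mx_measurable_mul; [exact: mx_measurable_design|exact: mx_measurable_cst].
Qed.

End Dataset.

(** * The random split *)

Lemma measure_finpartition d (T : measurableType d) (R : realType)
    (mu : {measure set T -> \bar R}) (I : finType) (F : I -> set T) :
  (forall i, measurable (F i)) -> trivIset setT F ->
  (mu [set w | exists i, F i w] = \sum_i mu (F i))%E.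
Proof.
move=> mF tF.
have -> : [set w | exists i, F i w] = \bigcup_(i in [set` index_enum I]) F i.
  by apply/seteqP; split=> w /=; [move=> [i Fi]; exists i => //=; exact: mem_index_enum
    |move=> [i _ Fi]; exists i].
rewrite measure_fin_bigcup//.
- by rewrite -fsbig_seq ?index_enum_uniq.
- exact: sub_trivIset tF.
Qed.

Lemma gaussian_subfamily d (Omega : measurableType d) (R : realType)
    (P : probability Omega R) n (X : 'I_n -> Omega -> R) (sigma : R)
    m (f : 'I_m -> 'I_n) :
  0 < sigma -> (forall i, measurable_fun setT (X i)) ->
  mutually_independent P (fun i => g_sigma_algebra_preimage (X i)) ->
  (forall i, has_law P (X i) (normal_prob 0 sigma)) -> injective f ->
  gaussian_family P (fun i => X (f i)) sigma.
Proof.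
move=> s0 mX iX lX inj; split=> [i|a a0]; first exact: mX.
pose b j := \sum_(i | f i == j) a i 0.
have bf i : b (f i) = a i 0.
  by rewrite /b (big_pred1 i)// => j; rewrite (inj_eq inj).
have sb : \sum_(j <- [seq f i | i <- index_enum 'I_m]) b j ^+ 2 = sqn a.
  by rewrite big_map dotvE; apply: eq_bigr => i _; rewrite bf expr2.
have := @gaussian_combination_seq _ _ _ P n X sigma s0 mX iX lX b
  [seq f i | i <- index_enum 'I_m].
rewrite sb (map_inj_uniq inj) index_enum_uniq => /(_ isT a0) h B mB.
rewrite -h//; congr (P (_ @^-1` B)); apply/funext => w.
by rewrite big_map; apply: eq_bigr => i _; rewrite bf.
Qed.

(** Design and noise are read from separate tuples, because independence is available for the pair
    (covariates, noise) and not for a data set as a whole. *)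
Definition design_of (R : realType) n p (x : n.-tuple (p.-tuple R)) :
  'M[R]_(n, p) := \matrix_(i, j) tnth (tnth x i) j.

Definition col_of (R : realType) n (e : n.-tuple R) : 'cV[R]_n :=
  \col_i tnth e i.

Lemma mx_measurable_design_of (R : realType) n p :
  mx_measurable (fun x : n.-tuple (p.-tuple R) => design_of x).
Proof.
move=> i j; under eq_fun do rewrite mxE.
by apply: (measurableT_comp (measurable_tnth j)); exact: measurable_tnth.
Qed.

Lemma mx_measurable_col_of (R : realType) n :
  mx_measurable (fun e : n.-tuple R => col_of e).
Proof. by move=> i j; under eq_fun do rewrite mxE; exact: measurable_tnth. Qed.

Lemma mx_measurable_comp d1 d2 (T1 : measurableType d1) (T2 : measurableType d2)
    (R : realType) m n (A : T2 -> 'M[R]_(m, n)) (f : T1 -> T2) :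
  mx_measurable A -> measurable_fun setT f -> mx_measurable (A \o f).
Proof. by move=> mA mf i j; exact: measurableT_comp (mA i j) mf. Qed.

Section Sample.
Context d (Omega : measurableType d) (R : realType) (P : probability Omega R).
Variables (p : nat -> nat) (smp : sample P p) (n : nat).
Local Notation N := (3 * n)%N.

Definition slot (t : 'S_N) (g : 'I_3) (i : 'I_n) : 'I_N := t (mxvec_index g i).

Lemma slot_eq t g i g' i' : (slot t g i == slot t g' i') = ((g == g') && (i == i')).
Proof.
rewrite (inj_eq perm_inj).
by rewrite /mxvec_index (inj_eq (@cast_ord_inj _ _ _)) (inj_eq enum_rank_inj) xpair_eqE.
Qed.

Lemma slot_inj t g : injective (slot t g).
Proof. by move=> i j /eqP; rewrite slot_eq eqxx => /eqP. Qed.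

Definition data_at m (f : 'I_m -> 'I_N) (w : Omega) : dataset R m (p n) :=
  subtuple (fun i => observation smp i w) f.

Lemma group_dataE g w :
  group_data smp g n w = data_at (slot (permutation smp n w) g) w.
Proof. by []. Qed.

Definition subdata m (f : 'I_m -> 'I_N) (x : dataset R N (p n)) :
  dataset R m (p n) := subtuple (tnth x) f.

Lemma data_atE m (f : 'I_m -> 'I_N) w : data_at f w = subdata f (all_data smp n w).
Proof. by apply: eq_from_tnth => i; rewrite !tnth_mktuple. Qed.

Lemma measurable_subdata m (f : 'I_m -> 'I_N) : measurable_fun setT (subdata f).
Proof. by apply: measurable_subtuple => i; exact: measurable_tnth. Qed.

Lemma measurable_observation (i : 'I_N) : measurable_fun setT (observation smp i).
Proof. by apply/measurable_fun_pairP; split; exact: measurable_funP. Qed.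

Lemma measurable_all_data : measurable_fun setT (all_data smp n).
Proof. apply: (@measurable_subtuple _ _ _ _ _ _ (observation smp (n := n)) id).
exact: measurable_observation. Qed.

Hypothesis split : random_split smp.

(** The events on which the permutation takes a given value are disjoint and independent of the
    data, so on each of them the permutation may be treated as fixed. *)
Lemma split_mixture (E : 'S_N -> set (dataset R N (p n))) :
  (forall t, measurable (E t)) ->
  measurable [set w | E (permutation smp n w) (all_data smp n w)] /\
  (P [set w | E (permutation smp n w) (all_data smp n w)] =
   \sum_(t : 'S_N) (((3 * n)`!)%:R^-1)%:E * P [set w | E t (all_data smp n w)])%E.
Proof.
move=> mE.
pose F t := [set w | permutation smp n w = t] `&` [set w | E t (all_data smp n w)].
have mD t : measurable [set w | E t (all_data smp n w)].
  exact: measurable_preimage measurable_all_data (mE t).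
have mF t : measurable (F t) by apply: measurableI => //; case: (split t).
have -> : [set w | E (permutation smp n w) (all_data smp n w)] =
    [set w | exists t, F t w].
  apply/seteqP; split=> w /=; first by exists (permutation smp n w).
  by move=> [t [<-]].
split; first exact: measurable_exists_fin.
rewrite (measure_finpartition P mF); last first.
  by move=> t t' _ _ [w [[/= <- _] [/= <- _]]].
apply: eq_bigr => t _; have [_ <- h] := split t.
rewrite -h//; exists (E t); [exact: mE|by rewrite setTI].
Qed.

Lemma sum_permutation_weights (a : \bar R) : (0 <= a)%E ->
  (\sum_(t : 'S_N) (((3 * n)`!)%:R^-1)%:E * a = a)%E.
Proof.
move=> a0; rewrite -ge0_sume_distrl; last by move=> t _; rewrite lee_fin.
rewrite sumEFin sumr_const card_Sn -[_ *+ _]mulr_natr mulVf ?mul1e//.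

Qed.

Lemma split_le (E G : 'S_N -> set (dataset R N (p n))) (a : R) : 0 <= a ->
  (forall t, measurable (E t)) -> (forall t, measurable (G t)) ->
  (forall t, P [set w | E t (all_data smp n w)] <=
     a%:E + P [set w | G t (all_data smp n w)])%E ->
  (P [set w | E (permutation smp n w) (all_data smp n w)] <=
   a%:E + P [set w | G (permutation smp n w) (all_data smp n w)])%E.
Proof.
move=> a0 mE mG h; have [_ ->] := split_mixture mE; have [_ ->] := split_mixture mG.
have <- := @sum_permutation_weights a%:E a0.
rewrite -big_split /=; apply: lee_sum => t _; rewrite -ge0_muleDr//.
by apply: lee_wpmul2l => //; rewrite lee_fin.
Qed.

Lemma split_ge (E : 'S_N -> set (dataset R N (p n))) (a : R) : 0 <= a ->
  (forall t, measurable (E t)) ->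
  (forall t, a%:E <= P [set w | E t (all_data smp n w)])%E ->
  (a%:E <= P [set w | E (permutation smp n w) (all_data smp n w)])%E.
Proof.
move=> a0 mE h; have [_ ->] := split_mixture mE.
have <- := @sum_permutation_weights a%:E a0.
apply: lee_sum => t _; by apply: lee_wpmul2l => //; rewrite lee_fin.
Qed.

Variables (beta : nat -> R) (sigma : R).
Hypothesis sigma0 : 0 < sigma.
Hypothesis model : gaussian_linear_model smp beta sigma.
Let b := coef beta (p n).

Definition cov_at m (f : 'I_m -> 'I_N) w : m.-tuple ((p n).-tuple R) :=
  subtuple (fun i => covariate smp i w) f.

Definition noise_at m (f : 'I_m -> 'I_N) w : m.-tuple R :=
  subtuple (fun i => noise smp i w) f.

Lemma design_data_at m (f : 'I_m -> 'I_N) w :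
  design (data_at f w) = design_of (cov_at f w).
Proof. by apply/matrixP => i j; rewrite !mxE !tnth_mktuple. Qed.

Lemma noise_data_at m (f : 'I_m -> 'I_N) w :
  responses (data_at f w) - design (data_at f w) *m b =
  noise_vector (fun i => noise smp (f i)) w.
Proof.
apply/colP => i; rewrite !mxE tnth_mktuple /=.
have [-> _ _ _] := model n.
rewrite addrAC (eq_bigr (fun j => design (data_at f w) i j * b j 0)) ?subrr ?add0r//.
by move=> j _; rewrite !mxE tnth_mktuple.
Qed.

Lemma col_of_noise_at m (f : 'I_m -> 'I_N) w :
  col_of (noise_at f w) = noise_vector (fun i => noise smp (f i)) w.
Proof. by apply/colP => i; rewrite !mxE tnth_mktuple. Qed.

Lemma gaussian_noise_at m (f : 'I_m -> 'I_N) : injective f ->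
  gaussian_family P (fun i => noise smp (f i) : Omega -> R) sigma.
Proof.
have [_ law indep _] := model n.
by apply: (@gaussian_subfamily _ _ _ _ _ (fun i => noise smp i : Omega -> R)).
Qed.

Lemma indep_cov_noise m (f : 'I_m -> 'I_N) :
  [/\ measurable_fun setT (cov_at f), measurable_fun setT (noise_at f) &
      indep_funs P (cov_at f) (noise_at f)].
Proof.
have mc : measurable_fun setT (cov_at f).
  by apply: measurable_subtuple => i; exact: measurable_funP.
have mn : measurable_fun setT (noise_at f).
  by apply: measurable_subtuple => i; exact: measurable_funP.
split=> // A B mA mB.
have [_ _ _ ind] := model n.
pose allc w := [tuple covariate smp i w | i < N].
pose alln w := [tuple noise smp i w | i < N].
have cE : cov_at f = (fun x => subtuple (tnth x) f) \o allc.
  by apply/funext => w; apply: eq_from_tnth => i; rewrite !tnth_mktuple.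
have nE : noise_at f = (fun x => subtuple (tnth x) f) \o alln.
  by apply/funext => w; apply: eq_from_tnth => i; rewrite !tnth_mktuple.
rewrite cE nE setIC muleC; apply: ind.
  exists ((fun x : N.-tuple R => subtuple (tnth x) f) @^-1` B); last by rewrite setTI.
  apply: measurable_preimage mB.
  by apply: measurable_subtuple => i; exact: measurable_tnth.
exists ((fun x : N.-tuple _ => subtuple (tnth x) f) @^-1` A); last by rewrite setTI.
apply: measurable_preimage mA.
by apply: measurable_subtuple => i; exact: measurable_tnth.
Qed.

Section DataEvents.
Variables (C0 kap : R) (k1 : nat).
Hypothesis n0 : (0 < n)%N.
Let noise_of (dat : dataset R n (p n)) := responses dat - design dat *m b.

Lemma measurable_design_ok_data :
  measurable [set dat : dataset R n (p n) | design_ok (design dat) C0 kap k1].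
Proof. exact: measurable_design_ok (@mx_measurable_design R n (p n)) C0 kap k1. Qed.

(** The covariates are frozen. For an acceptable design the hypothesis bounds the section; for any
    other design the section is empty. *)
Lemma conditional_bound (Q : 'M[R]_(n, p n) -> 'cV[R]_n -> Prop) (f : 'I_n -> 'I_N) r :
  0 <= r ->
  measurable [set xe : n.-tuple ((p n).-tuple R) * n.-tuple R |
    Q (design_of xe.1) (col_of xe.2)] ->
  (forall X, design_ok X C0 kap k1 -> (P [set w | Q X
     (noise_vector (fun i => noise smp (f i) : Omega -> R) w)] <= r%:E)%E) ->
  (P [set w | design_ok (design (data_at f w)) C0 kap k1 /\
      Q (design (data_at f w)) (noise_of (data_at f w))] <= r%:E)%E.
Proof.
move=> r0 mQ h; have [mc mn ind] := indep_cov_noise f.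
pose E := [set xe : n.-tuple ((p n).-tuple R) * n.-tuple R |
  design_ok (design_of xe.1) C0 kap k1] `&`
  [set xe | Q (design_of xe.1) (col_of xe.2)].
have mE : measurable E.
  apply: measurableI => //.
  apply: measurable_design_ok.
  exact: mx_measurable_comp (@mx_measurable_design_of R n (p n)) measurable_fst.
have -> : [set w | design_ok (design (data_at f w)) C0 kap k1 /\
    Q (design (data_at f w)) (noise_of (data_at f w))] =
    [set w | E (cov_at f w, noise_at f w)].
  by apply/seteqP; split=> w /=;
    rewrite /E /noise_of /= noise_data_at col_of_noise_at design_data_at.
apply: indep_bound => // x.
have [ok|nok] := pselect (design_ok (design_of x) C0 kap k1); last first.
  rewrite (_ : [set w | _] = set0) ?measure0 ?lee_fin//.
  by apply/seteqP; split=> w //= -[].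
apply: le_trans (h _ ok); rewrite le_eqVlt; apply/orP; left; apply/eqP; congr (P _).
by apply/seteqP; split=> w; rewrite /E /= col_of_noise_at; [case|].
Qed.

Hypothesis k10 : (0 < k1)%N.
Hypothesis C00 : 0 <= C0.
Hypothesis kap0 : 0 < kap.
Hypothesis np : (n <= p n)%N.

Let noise_rate_ge0 k2 t : 0 <= noise_rate n (p n) sigma C0 kap k2 t.
Proof.
rewrite /noise_rate !addr_ge0 ?divr_ge0 ?mulr_ge0 ?sqrtr_ge0 ?expR_ge0 ?exprn_ge0 ?(ltW kap0)//.
Qed.

Lemma noise_bad_at (f : 'I_n -> 'I_N) (k2 : nat) t :
  injective f -> (k2 <= n)%N -> 0 <= t ->
  (P [set w | design_ok (design (data_at f w)) C0 kap k1 /\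
      noise_bad (design (data_at f w)) (noise_of (data_at f w))
        (sigma ^+ 2 * kap / 2) (2 * sigma ^+ 2) t k2]
   <= (noise_rate n (p n) sigma C0 kap k2 t)%:E)%E.
Proof.
move=> inj k2n t0.
apply: (@conditional_bound (fun X e =>
  noise_bad X e (sigma ^+ 2 * kap / 2) (2 * sigma ^+ 2) t k2)); first exact: noise_rate_ge0.
  apply: measurable_noise_bad.
    exact: mx_measurable_comp (@mx_measurable_design_of R n (p n)) measurable_fst.
  exact: mx_measurable_comp (@mx_measurable_col_of R n) measurable_snd.
move=> X [ok Xu].
exact: (noise_bad_prob sigma0 (gaussian_noise_at inj) n0 ok).
Qed.

Definition test_rate (alpha eta : R) (K : nat) : R :=
  8 / (eta ^+ 2 * n%:R) +
    n%:R * (Num.sqrt 2 * expR (- (eta * n%:R / (8 * K%:R)))) +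
    (alpha + K%:R * (Num.sqrt (8 * K%:R / alpha) * eta)).

Lemma test_rate_ge0 alpha eta K : 0 < alpha < 1 -> 0 < eta < 1 ->
  0 <= test_rate alpha eta K.
Proof.
move=> /andP[/ltW a0 _] /andP[/ltW e0 _]; rewrite /test_rate.
by rewrite !addr_ge0 ?divr_ge0 ?mulr_ge0 ?sqrtr_ge0 ?expR_ge0 ?exprn_ge0.
Qed.

(** Monotonicity in the model size lets the random size be replaced by its largest admissible
    value. *)
Lemma le_test_rate alpha eta (m K : nat) : 0 < alpha < 1 -> 0 < eta < 1 ->
  (0 < m <= K)%N -> test_rate alpha eta m <= test_rate alpha eta K.
Proof.
move=> /andP[a0 a1] /andP[e0 e1] /andP[m0 mK].
have mR : 0 < m%:R :> R by rewrite ltr0n.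
have mKR : m%:R <= K%:R :> R by rewrite ler_nat.
rewrite /test_rate -!addrA lerD2l lerD//.
  rewrite ler_wpM2l// ler_wpM2l ?sqrtr_ge0// ler_expR lerN2.
  rewrite ler_wpM2l ?mulr_ge0 ?(ltW e0)// lef_pV2 ?posrE; lra.
rewrite lerD2l ler_pM ?mulr_ge0 ?sqrtr_ge0 ?(ltW e0)// ler_wpM2r ?(ltW e0)//.
rewrite ler_wsqrtr// ler_wpM2r ?invr_ge0 ?(ltW a0)//; lra.
Qed.

Definition t_test_data (alpha eta : R) (M : {set 'I_(p n)})
    (dat : dataset R n (p n)) :=
  design_ok (design dat) C0 kap k1 /\
  t_test_bad (design dat) (noise_of dat) M (supp b)
    (upper_quantile (alpha / (2 * #|M|%:R))) (sigma ^+ 2 * (1 - eta)).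

Lemma measurable_t_test_data alpha eta M :
  measurable [set dat | t_test_data alpha eta M dat].
Proof.
apply: measurableI; first exact: measurable_design_ok_data.
by apply: measurable_t_test_bad; [exact: mx_measurable_design|exact: mx_measurable_noise].
Qed.

Lemma t_test_bad_at (f : 'I_n -> 'I_N) (M : {set 'I_(p n)}) alpha eta (K : nat) :
  injective f -> (0 < #|M| <= K)%N -> (#|M| <= n)%N ->
  0 < alpha < 1 -> 0 < eta < 1 ->
  (P [set w | t_test_data alpha eta M (data_at f w)]
   <= (test_rate alpha eta K)%:E)%E.
Proof.
move=> inj mK Mn ha he; have /andP[M0 _] := mK.
apply: (@conditional_bound (fun X e =>
  t_test_bad X e M (supp b) (upper_quantile (alpha / (2 * #|M|%:R)))
    (sigma ^+ 2 * (1 - eta)))).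
- exact: test_rate_ge0.
- apply: measurable_t_test_bad.
    exact: mx_measurable_comp (@mx_measurable_design_of R n (p n)) measurable_fst.
  exact: mx_measurable_comp (@mx_measurable_col_of R n) measurable_snd.
- move=> X [_ Xu].
  apply: le_trans (t_test_bad_prob sigma0 (gaussian_noise_at inj) n0 _ (Xu M Mn) M0 ha he) _.
  by rewrite lee_fin; exact: le_test_rate.
Qed.

Hypothesis iid : iid_observations smp.

Definition pair_at (t : 'S_N) w : dataset R n (p n) * dataset R n (p n) :=
  (data_at (slot t stage1) w, data_at (slot t stage2) w).

(** The first two groups are merged into one family of n + n observations, so that independence from
    the third is a statement about two disjoint families. *)
Lemma indep_groups (t : 'S_N) :
  [/\ measurable_fun setT (pair_at t),
      measurable_fun setT (data_at (slot t stage3)) &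
      indep_funs P (pair_at t) (data_at (slot t stage3))].
Proof.
have [ind _] := iid n.
have mobs i : measurable_fun setT (observation smp (n := n) i).
  exact: measurable_observation.
pose f (i : 'I_(n + n)) := match fintype.split i with
  inl j => slot t stage1 j | inr j => slot t stage2 j end.
pose left (x : (n + n).-tuple ((p n).-tuple R * R)) : dataset R n (p n) :=
  subtuple (tnth x) (@lshift n n).
pose right (x : (n + n).-tuple ((p n).-tuple R * R)) : dataset R n (p n) :=
  subtuple (tnth x) (@rshift n n).
have ml : measurable_fun setT left by apply: measurable_subtuple => i; exact: measurable_tnth.
have mr : measurable_fun setT right by apply: measurable_subtuple => i; exact: measurable_tnth.
have mlr : measurable_fun setT (fun x => (left x, right x)).
  exact/measurable_fun_pairP.
have mf : measurable_fun setT (data_at f) by exact: measurable_subtuple.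
have pE : pair_at t = (fun x => (left x, right x)) \o data_at f.
  apply/funext => w; congr (_, _); apply: eq_from_tnth => i; rewrite !tnth_mktuple /f.
    by case: fintype.splitP => j /= h; [congr (observation _ (slot _ _ _) _); apply: ord_inj|
      have := ltn_ord i; rewrite h ltnNge leq_addr].
  case: fintype.splitP => j /= h; first by have := ltn_ord j; rewrite -h ltnNge leq_addr.
  by congr (observation _ (slot _ _ _) _); apply: ord_inj; apply/eqP; rewrite -(eqn_add2l n) h.
split; [|exact: measurable_subtuple|].
  by rewrite pE; exact: measurableT_comp.
rewrite pE; apply: (@indep_funs_comp _ _ _ _ _ _ _ _ _ _ _ _ (data_at f)
  (data_at (slot t stage3)) (fun x => (left x, right x)) id) => //.
apply: indep_subtuples => // i j; rewrite /f.
by case: fintype.splitP => k _; rewrite slot_eq negb_and; apply/orP; left;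
  rewrite -val_eqE /= !inordK.
Qed.

Lemma measurable_t_test_selected
    (Mhat : dataset R n (p n) * dataset R n (p n) -> {set 'I_(p n)})
    alpha eta (K : nat) : (forall M, measurable [set dd | Mhat dd = M]) ->
  measurable [set x : (dataset R n (p n) * dataset R n (p n)) * dataset R n (p n) |
    (0 < #|Mhat x.1| <= K)%N /\ t_test_data alpha eta (Mhat x.1) x.2].
Proof.
move=> mM.
rewrite (_ : [set x | _] = [set x | exists M, (0 < #|(M : {set 'I_(p n)})| <= K)%N /\
    ([set x | Mhat x.1 = M] `&` [set x | t_test_data alpha eta M x.2]) x]); last first.
  apply/seteqP; split=> x /=; first by move=> [h1 h2]; exists (Mhat x.1).
  by move=> [M [h1 [hM h2]]]; split; rewrite hM.
apply: measurable_exists_fin => M; apply: measurable_and_cst => _.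
apply: measurableI.
  exact: measurable_preimage measurable_fst (mM M).
exact: measurable_preimage measurable_snd (measurable_t_test_data alpha eta M).
Qed.

Lemma t_test_selected_at (t : 'S_N)
    (Mhat : dataset R n (p n) * dataset R n (p n) -> {set 'I_(p n)})
    alpha eta (K : nat) :
  (K <= n)%N -> 0 < alpha < 1 -> 0 < eta < 1 ->
  (forall M, measurable [set dd | Mhat dd = M]) ->
  (P [set w | (0 < #|Mhat (pair_at t w)| <= K)%N /\
     t_test_data alpha eta (Mhat (pair_at t w)) (data_at (slot t stage3) w)]
   <= (test_rate alpha eta K)%:E)%E.
Proof.
move=> Kn ha he mM; have [m12 m3 ind] := indep_groups t.
pose E := [set x : (dataset R n (p n) * dataset R n (p n)) * dataset R n (p n) |
  (0 < #|Mhat x.1| <= K)%N /\ t_test_data alpha eta (Mhat x.1) x.2].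
have mE : measurable E by exact: measurable_t_test_selected.
apply: (@indep_bound _ _ _ _ _ _ _ _ (pair_at t) (data_at (slot t stage3)) E) => // x.
have [h|h] := boolP (0 < #|Mhat x| <= K)%N; last first.
  rewrite (_ : [set w | _] = set0) ?measure0 ?lee_fin ?test_rate_ge0//.
  by apply/seteqP; split=> w //= -[/=]; rewrite (negbTE h).
apply: le_trans (t_test_bad_at (M := Mhat x) (f := slot t stage3) (@slot_inj _ _) h _ ha he).
  rewrite le_eqVlt; apply/orP; left; apply/eqP; congr (P _).
  by apply/seteqP; split=> w /=; rewrite /E /=; [case|].
by have /andP[_ hK] := h; exact: leq_trans hK Kn.
Qed.

End DataEvents.

End Sample.

(** * Blocks of large entries *)

(* X^2 + b X has mean 1, although it is at most 1/2 where -b <= X < 1 / (4 b)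
   and at most 2 b^2 where X <= b. *)
Lemma bounded_normalized_prob_ge d (Omega : measurableType d) (R : realType)
    (P : probability Omega R) (X : Omega -> R) (b : R) :
  measurable_fun setT X -> 1 <= b ->
  ('E_P[X] = 0)%E -> ('E_P[fun w => (X w ^+ 2)%R] = 1)%E ->
  P [set w | `|X w| <= b] = 1%E ->
  (((4 * b ^+ 2)^-1)%:E <= P [set w | (1 / (4 * b) <= X w)%R])%E.
Proof.
move=> mX b1; rewrite unlock => EX EX2 Xb.
have b0 : 0 < b by lra.
have mX2 : measurable_fun setT (fun w => X w ^+ 2) by exact: measurable_funX.
have i1 : P.-integrable setT (fun w => (1 : R)%:E) by exact: finite_measure_integrable_cst.
have iX2 : P.-integrable setT (fun w => (X w ^+ 2)%:E).
  apply/integrableP; split; first exact/measurable_EFinP.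
  under eq_integral do rewrite gee0_abs ?lee_fin ?sqr_ge0//.
  by rewrite EX2 ltry.
have iX : P.-integrable setT (fun w => (X w)%:E).
  apply: (@le_integrable _ _ _ _ _ measurableT _ (fun w => (1%:E + (X w ^+ 2)%:E)%E)).
  - exact/measurable_EFinP.
  - move=> w _; rewrite -EFinD /= lee_fin.
    rewrite [leRHS]ger0_norm ?addr_ge0 ?sqr_ge0//.
    by rewrite ler_norml; apply/andP; split; nra.
  - exact: integrableD.
pose A := [set w | 1 / (4 * b) <= X w].
have mA : measurable A by exact: measurable_le_set.
(* Adding b^2 / 4 makes X^2 + b X a square, so the comparison is between nonnegative integrands. *)
have E1 : (\int[P]_w ((X w + b / 2) ^+ 2)%:E = (1 + b ^+ 2 / 4)%:E)%E.
  under eq_integral => w _.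
    rewrite (_ : ((X w + b / 2) ^+ 2)%:E = ((X w ^+ 2)%:E + (b%:E * (X w)%:E + (b ^+ 2 / 4)%:E))%E).
      over.
    by rewrite -EFinM -!EFinD; congr EFin; field.
  have iZ : P.-integrable setT (fun w => (b%:E * (X w)%:E)%E) by exact: integrableZl.
  have ic : P.-integrable setT (fun w => (b ^+ 2 / 4)%:E).
    exact: finite_measure_integrable_cst.
  rewrite integralD//; last exact: integrableD.
  rewrite integralD// integralZl// EX EX2 mule0 add0e.
  by rewrite integral_cst// [X in (_ * X)%E]probability_setT mule1 EFinD.
have E2 : (\int[P]_w ((1 / 2 + b ^+ 2 / 4)%:E + (2 * b ^+ 2)%:E * (\1_A w)%:E) =
    (1 / 2 + b ^+ 2 / 4)%:E + (2 * b ^+ 2)%:E * P A)%E.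
  rewrite ge0_integralD//; last 3 first.
  - by move=> w _; rewrite lee_fin addr_ge0// divr_ge0// sqr_ge0.
  - by move=> w _; rewrite -EFinM lee_fin mulr_ge0// mulr_ge0// sqr_ge0.
  - by apply/measurable_EFinP; apply: measurable_funM.
  rewrite integral_cst// [X in (_ * X)%E]probability_setT mule1; congr (_ + _)%E.
  rewrite ge0_integralZl//; last 2 first.
  - by apply/measurable_EFinP.
  - by rewrite lee_fin mulr_ge0// sqr_ge0.
  by rewrite integral_indic// setIT.
have : ((1 + b ^+ 2 / 4)%:E <= (1 / 2 + b ^+ 2 / 4)%:E + (2 * b ^+ 2)%:E * P A)%E.
  rewrite -E1 -E2; apply: ae_ge0_le_integral => //.
  - by move=> w _; rewrite lee_fin sqr_ge0.
  - by apply/measurable_EFinP; apply: measurable_funX; exact: measurable_funD.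
  - move=> w _; rewrite -EFinM -EFinD lee_fin addr_ge0 ?(ltW b0)//.
      by rewrite addr_ge0// divr_ge0// sqr_ge0.
    by rewrite mulr_ge0// mulr_ge0// sqr_ge0.
  - by apply: emeasurable_funD => //; apply/measurable_EFinP; exact: measurable_funM.
  - have mB : measurable [set w | `|X w| <= b].
      by apply: measurable_le_set => //; exact: measurableT_comp.
    exists (~` [set w | `|X w| <= b]); split.
    + exact: measurableC.
    + by have /= -> := probability_setC P mB; rewrite Xb subee.
    + move=> w; apply: contra_not => /= hw _.
      rewrite -EFinM -EFinD lee_fin indicE.
      have c1 : 1 / (4 * b) <= 1 / 4.
        by rewrite div1r div1r lef_pV2 ?posrE ?mulr_gt0//; lra.
      have c2 : 1 / (4 * b) * b = 1 / 4 by field; rewrite gt_eqF.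
      move: hw; rewrite ler_norml => /andP[h1 h2].
      have [h|h] := leP (1 / (4 * b)) (X w).
        rewrite mem_set//= mulr1; nra.
      rewrite memNset/=; last by rewrite /A /= leNgt h.
      rewrite mulr0 addr0.
      have [x0|x0] := leP (X w) 0; first nra.
      have : X w * b < 1 / 4 by rewrite -c2 ltr_pM2r.
      nra.
have : P A \is a fin_num by exact: fin_num_measure.
rewrite -/A; case: (P A) => // r _.
rewrite -EFinM -EFinD !lee_fin => h.
rewrite -div1r ler_pdivrMr; last by rewrite mulr_gt0// exprn_gt0.
lra.
Qed.

(** A reverse Markov inequality: the number of events that occur is at most n unless n of them occur
    together, and never more than [#|I|]. Take expectations. *)
Lemma exists_many_prob d (Omega : measurableType d) (R : realType)
    (P : probability Omega R) (I : finType) (A : I -> set Omega) (r : R) (n : nat) :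
  (forall i, measurable (A i)) -> (forall i, r%:E <= P (A i))%E ->
  ((#|I|%:R * r)%:E <= n%:R%:E + #|I|%:R%:E *
    P [set w | exists N : {set I}, #|N| = n /\ forall i, i \in N -> A i w])%E.
Proof.
move=> mA hr; set S := [set w | _].
have mS : measurable S.
  apply: measurable_exists_fin => N; apply: measurable_and_cst => _.
  by apply: measurable_forall_fin => i; apply: measurable_imply_cst => _.
have E1 : (\int[P]_w (\sum_i \1_(A i) w)%:E = \sum_i P (A i))%E.
  under eq_integral do rewrite -sumEFin.
  rewrite ge0_integral_sum//; last by move=> i; apply/measurable_EFinP.
  by apply: eq_bigr => i _; rewrite integral_indic// setIT.
have E2 : (\int[P]_w (n%:R%:E + #|I|%:R%:E * (\1_S w)%:E) =
    n%:R%:E + #|I|%:R%:E * P S)%E.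
  rewrite ge0_integralD//; last first.
    by apply/measurable_EFinP; apply: measurable_funM.
  rewrite integral_cst// [X in (_ * X)%E]probability_setT mule1; congr (_ + _)%E.
  rewrite ge0_integralZl//; last by apply/measurable_EFinP.
  by rewrite integral_indic// setIT.
have -> : (#|I|%:R * r)%:E = (\sum_(i : I) r%:E)%E.
  by rewrite sumEFin sumr_const mulr_natl.
apply: (@le_trans _ _ (\sum_i P (A i))%E); first exact: lee_sum.
rewrite -E1 -E2; apply: ge0_le_integral => //.
- by move=> w _; rewrite lee_fin sumr_ge0.
- by apply/measurable_EFinP; apply: measurable_sum => i; exact: measurable_indic.
- by apply: emeasurable_funD => //; apply/measurable_EFinP; exact: measurable_funM.
move=> w _; rewrite -EFinM -EFinD lee_fin.
pose H := [set i | `[< A i w >]]%SET.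
have -> : \sum_i \1_(A i) w = #|H|%:R :> R.
  rewrite -sum1_card natr_sum [RHS]big_mkcond; apply: eq_bigr => i _.
  rewrite indicE inE; case: asboolP => h; first by rewrite mem_set.
  by rewrite memNset.
rewrite indicE; have [h|h] := boolP (w \in S).
  by rewrite mulr1 -[leLHS]add0r lerD// ler_nat max_card.
rewrite mulr0 addr0 ler_nat leqNgt; apply: contra h => h.
rewrite mem_set//; have [B] : exists2 B : {set I}, B \subset H & #|B| = n.
  exists [set i in take n (enum H)]%SET.
    apply/fintype.subsetP => i; rewrite inE => /mem_take; by rewrite mem_enum.
  rewrite cardsE; have /card_uniqP -> : uniq (take n (enum H)) by rewrite take_uniq// enum_uniq.
  by rewrite size_take -cardE h.
move=> /fintype.subsetP BH Bn; exists B; split=> // i /BH; by rewrite inE => /asboolP.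
Qed.

Section DimensionBound.
Context d (Omega : measurableType d) (R : realType) (P : probability Omega R).
Variables (p : nat -> nat) (smp : sample P p) (n : nat).
Local Notation N := (3 * n)%N.
Hypothesis iid : iid_observations smp.
Variables (c q : R).
Hypothesis q0 : 0 <= q.
Hypothesis hq : forall (i : 'I_N) (j : 'I_(p n)),
  (q%:E <= P [set w | (c <= tnth (covariate smp i w) j)%R])%E.

Lemma rows_large_prob m (f : 'I_m -> 'I_N) (K : {set 'I_m}) (j : 'I_(p n)) :
  injective f ->
  ((q ^+ #|K|)%:E <=
   P [set w | forall i, i \in K -> (c <= design (data_at smp f w) i j)%R])%E.
Proof.
move=> inj; have [ind _] := iid n.
pose A i := [set w | c <= tnth (covariate smp i w) j].
have -> : [set w | forall i, i \in K -> c <= design (data_at smp f w) i j] =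
    \bigcap_(i in [set i | i \in (f @: K)%SET]) A i.
  apply/seteqP; split=> w /= h.
    by move=> i' /= /imsetP[i iK ->]; have := h i iK; rewrite mxE tnth_mktuple.
  by move=> i iK; rewrite mxE tnth_mktuple; apply: h; exact: imset_f.
rewrite ind; last first.
  move=> i _; exists [set o : (p n).-tuple R * R | c <= tnth o.1 j].
    apply: measurable_le_set => //.
    by apply: (measurableT_comp (measurable_tnth j)); exact: measurable_fst.
  by rewrite setTI.
have -> : q ^+ #|K| = \prod_(i in (f @: K)%SET) q.
  by rewrite prodr_const card_imset.
suff [] : 0 <= \prod_(i in (f @: K)%SET) q /\
  ((\prod_(i in (f @: K)%SET) q)%:E <= \prod_(i in (f @: K)%SET) P (A i))%E by [].
elim/big_ind2 : _ => [|x1 x2 y1 y2 [h1 h2] [h3 h4]|i _].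
- by [].
- split; first exact: mulr_ge0.
  by rewrite EFinM; apply: lee_pmul; rewrite ?lee_fin.
- by split => //; exact: hq.
Qed.

Definition large_block (k : nat) (dat : dataset R n (p n)) : Prop :=
  exists B : {set 'I_(p n)}, #|B| = n /\
    forall j, j \in B -> forall i : 'I_n, i \in [set i : 'I_n | (i < k)%N]%SET ->
      c <= design dat i j.

Lemma measurable_large_block k : measurable [set dat | large_block k dat].
Proof.
apply: measurable_exists_fin => B; apply: measurable_and_cst => _.
apply: measurable_forall_fin => j.
apply: (measurable_imply_cst (A := [set dat | forall i : 'I_n,
  i \in [set i : 'I_n | (i < k)%N]%SET -> c <= design dat i j])) => _.
apply: measurable_forall_fin => i.
apply: (measurable_imply_cst (A := [set dat : dataset R n (p n) | c <= design dat i j])) => _.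
by apply: measurable_le_set => //; exact: mx_measurable_design.
Qed.

Lemma large_block_prob (f : 'I_n -> 'I_N) (k : nat) : injective f -> (k <= n)%N ->
  (((p n)%:R * q ^+ k)%:E <= n%:R%:E + (p n)%:R%:E *
     P [set w | large_block k (data_at smp f w)])%E.
Proof.
move=> inj kn.
pose A (j : 'I_(p n)) := [set w | forall i : 'I_n,
  i \in [set i : 'I_n | (i < k)%N]%SET -> c <= design (data_at smp f w) i j].
have := @exists_many_prob _ _ _ P _ A (q ^+ k) n.
rewrite card_ord; apply.
  move=> j; apply: measurable_forall_fin => i.
  apply: (measurable_imply_cst (A := [set w | c <= design (data_at smp f w) i j])) => _.
  apply: measurable_le_set => //; under eq_fun do rewrite mxE tnth_mktuple.
  by apply: (measurableT_comp (measurable_tnth j)); exact: measurable_funP.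
move=> j; have := rows_large_prob [set i : 'I_n | (i < k)%N]%SET j inj.
by rewrite card_ord_lt.
Qed.

(** Test the design on the indicator of the block: each of the first k rows contributes at least (n
    c)^2, while the bound allows n C0 n. *)
Lemma large_block_design C0 (k : nat) dat : 0 <= c -> (0 < n)%N -> (k <= n)%N ->
  (forall b, (#|supp b| <= n)%N ->
    sqn (design dat *m b) <= n%:R * C0 * sqn b) ->
  large_block k dat -> k%:R * c ^+ 2 <= C0.
Proof.
move=> c0 n0 kn h [B [Bn hB]].
pose b : 'cV[R]_(p n) := \col_j (j \in B)%:R.
have sb : supp b = B.
  by apply/setP => j; rewrite !inE mxE; case: (j \in B); rewrite ?oner_eq0 ?eqxx.
have nb : sqn b = n%:R.
  rewrite dotvE -[X in _ = X%:R]Bn -sum1_card natr_sum [RHS]big_mkcond; apply: eq_bigr => j _.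
  by rewrite !mxE; case: (j \in B); rewrite ?mulr1 ?mulr0.
have := h b; rewrite sb Bn leqnn nb => /(_ isT) h1.
have nR : 0 < n%:R :> R by rewrite ltr0n.
have h2 : k%:R * (n%:R * c) ^+ 2 <= sqn (design dat *m b).
  have -> : k%:R * (n%:R * c) ^+ 2 =
      \sum_(i in [set i : 'I_n | (i < k)%N]%SET) (n%:R * c) ^+ 2.
    by rewrite sumr_const card_ord_lt// mulr_natl.
  rewrite dotvE [leRHS](bigID (mem [set i : 'I_n | (i < k)%N]%SET)) /=.
  rewrite -[leLHS]addr0; apply: lerD; last first.
    by apply: sumr_ge0 => i _; rewrite -expr2 sqr_ge0.
  apply: ler_sum => i ik; rewrite -expr2 ler_pXn2r// ?nnegrE.
  - rewrite mxE (bigID (mem B)) /= [X in _ + X]big1 ?addr0; last first.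
      by move=> j /negbTE jB; rewrite [b _ _]mxE jB mulr0.
    have -> : n%:R * c = \sum_(j in B) c by rewrite sumr_const Bn mulr_natl.
    by apply: ler_sum => j jB; rewrite [b _ _]mxE jB mulr1; exact: hB.
  - by rewrite mulr_ge0.
  - rewrite mxE; apply: sumr_ge0 => j _; rewrite [b _ _]mxE.
    by have [jB|] := boolP (j \in B); rewrite ?mulr0// mulr1; exact: le_trans (hB _ jB _ ik).
have : k%:R * c ^+ 2 * n%:R ^+ 2 <= C0 * n%:R ^+ 2.
  rewrite (_ : k%:R * c ^+ 2 * n%:R ^+ 2 = k%:R * (n%:R * c) ^+ 2); last by ring.
  rewrite (_ : C0 * n%:R ^+ 2 = n%:R * C0 * n%:R); last by ring.
  exact: le_trans h2 h1.
by rewrite ler_pM2r// exprn_gt0.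
Qed.

End DimensionBound.

(** * Events of probability tending to one *)

Lemma limn_esup_lt_near (R : realType) (u : nat -> \bar R) (a : \bar R) :
  (limn_esup u < a)%E -> \forall n \near \oo, (u n < a)%E.
Proof.
rewrite /limn_esup limf_esupE => /ereal_inf_lt[_ [V Vn <-] h].
apply: filterS Vn => n Vn; apply: le_lt_trans h.
by apply: ereal_sup_ubound; exists n.
Qed.

Lemma limn_esup_le_near (R : realType) (u : nat -> \bar R) (a : \bar R) :
  (\forall n \near \oo, (u n <= a)%E) -> (limn_esup u <= a)%E.
Proof.
move=> h; rewrite /limn_esup limf_esupE.
apply: (@le_trans _ _ (ereal_sup [set u n | n in [set n | (u n <= a)%E]])).
  by apply: ereal_inf_lbound; exists [set n | (u n <= a)%E].
by apply: ge_ereal_sup => _ [n ? <-].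
Qed.

Lemma limn_einf_gt_near (R : realType) (u : nat -> \bar R) (a : \bar R) :
  (a < limn_einf u)%E -> \forall n \near \oo, (a < u n)%E.
Proof.
move=> h; have := @limn_esup_lt_near R (-%E \o u) (- a)%E.
rewrite limn_esupN lteN2 => /(_ h); apply: filterS => n /=.
by rewrite lteN2.
Qed.

(** A one-sided form of convergence to 0 that passes to smaller sequences and to sums without
    finiteness conditions. *)
Definition vanishing (R : realType) (u : nat -> \bar R) : Prop :=
  forall eps : R, 0 < eps -> \forall n \near \oo, (u n <= eps%:E)%E.

Lemma vanishing_cvg1 d (Omega : measurableType d) (R : realType)
    (P : probability Omega R) (E : nat -> set Omega) :
  (forall n, measurable (E n)) -> vanishing (fun n => P (~` E n)) ->
  P (E n) @[n --> \oo] --> 1%E.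
Proof.
move=> mE h.
have fin n : P (E n) \is a fin_num by exact: fin_num_measure.
have -> : (fun n => P (E n)) = EFin \o (fun n => fine (P (E n))).
  by apply/funext => n /=; rewrite fineK.
apply: cvg_EFin; first by near=> n.
apply/cvgrPdist_le => e e0; near=> n.
have : (P (~` E n) <= e%:E)%E by near: n; exact: h.
have /= -> := probability_setC P (mE n).
have := probability_le1 P (mE n).
have := measure_ge0 P (E n).
rewrite /= -(fineK (fin n)) -EFinB !lee_fin => h0 h1 h2.
by rewrite ger0_norm//; lra.
Unshelve. all: by end_near.
Qed.

(** The events that all [E k] with k >= n hold increase to a set of probability 1; continuity from
    below applies to them. *)
Lemma ae_near_vanishing d (Omega : measurableType d) (R : realType)
    (P : probability Omega R) (E : nat -> set Omega) :
  (forall n, measurable (E n)) ->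
  (\forall w \ae P, \forall n \near \oo, E n w) ->
  vanishing (fun n => P (~` E n)).
Proof.
move=> mE h e e0.
pose F n := \bigcap_(k in [set k | (n <= k)%N]) E k.
have mF n : measurable (F n) by apply: bigcap_measurableType => k _.
have mU : measurable (\bigcup_n F n) by exact: bigcup_measurable.
have PU : P (\bigcup_n F n) = 1%E.
  have : P (~` \bigcup_n F n) = 0%E.
    have [A [mA A0 hA]] := h.
    apply/eqP; rewrite -measure_le0 -A0; apply: le_measure; rewrite ?inE;
      [exact: measurableC|exact: mA|].
    by move=> w hw; apply: hA => /= -[k _ hk]; apply: hw; exists k.
  have /= -> := probability_setC P mU.
  have : P (\bigcup_n F n) \is a fin_num by exact: fin_num_measure.
  by case: (P _) => // r _; rewrite -EFinB => -[h1]; congr EFin; lra.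
have homF : {homo F : n m / (n <= m)%N >-> (n <= m)%O}.
  move=> n m nm; apply/subsetPset => w Fw k /= mk; apply: Fw => /=.
  exact: leq_trans mk.
have cF : P (F n) @[n --> \oo] --> 1%E.
  by rewrite -PU; exact: nondecreasing_cvg_mu.
have /fine_cvgP[_ /cvgrPdist_le/(_ e e0)] := cF.
apply: filterS => n /= hn.
have fF : P (F n) \is a fin_num by exact: fin_num_measure.
apply: (@le_trans _ _ (P (~` F n))).
  apply: le_measure; rewrite ?inE; [exact: measurableC|exact: measurableC|].
  by apply: subsetC => w; apply => /=.
have /= -> := probability_setC P (mF n).
rewrite -(fineK fF) -EFinB lee_fin; exact: le_trans (ler_norm _) hn.
Qed.

Lemma vanishing_le (R : realType) (u v : nat -> \bar R) :
  (\forall n \near \oo, (u n <= v n)%E) -> vanishing v -> vanishing u.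
Proof.
by move=> h hv e e0; near=> n; apply: (@le_trans _ _ (v n)); near: n => //; exact: hv.
Unshelve. all: by end_near.
Qed.

Lemma vanishingD (R : realType) (u v : nat -> \bar R) :
  vanishing u -> vanishing v -> vanishing (fun n => u n + v n)%E.
Proof.
move=> hu hv e e0; have e2 : 0 < e / 2 by rewrite divr_gt0.
near=> n; rewrite (_ : e = e / 2 + e / 2); last by field.
by rewrite EFinD; apply: leeD; near: n; [exact: hu|exact: hv].
Unshelve. all: by end_near.
Qed.

Lemma unitmx_of_eig (R : realType) n p (X : 'M[R]_(n, p)) (M : {set 'I_p}) :
  (0 < n)%N -> (#|M| <= n <= p)%N -> 0 < min_sparse_eig X n ->
  (subcols X M)^T *m subcols X M \in unitmx.
Proof.
move=> n0 /andP[Mn np] h; rewrite unitmxE unitfE; apply/negP => /det0P[v v0 vA].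
have : sqn (subcols X M *m v^T) = 0.
  rewrite dotv_mulmx mulmxA.
  have -> : (subcols X M)^T *m subcols X M *m v^T =
      (v *m ((subcols X M)^T *m subcols X M))^T by rewrite !trmx_mul trmxK.
  by rewrite vA trmx0 dotvC dotv0.
have := @min_sparse_eig_sqn _ _ _ X n (extend v^T) n0.
rewrite mulmx_extend sqn_extend => /(_ _)/[swap] ->.
rewrite np andbT (leq_trans _ Mn) ?subset_leq_card ?supp_extend// => /(_ isT).
have v1 : 0 < sqn v^T.
  by rewrite lt_def sqn_ge0 sqn_eq0 andbT -(inj_eq (@trmx_inj _ _ _)) trmxK trmx0.
by rewrite leNgt mulr_gt0// mulr_gt0// ltr0n.
Qed.

Lemma design_ok_of_eig (R : realType) n p (X : 'M[R]_(n, p)) C0 kap k1 :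
  (0 < n <= p)%N -> (k1 <= p)%N ->
  max_sparse_eig X n <= C0 -> kap <= min_sparse_eig X k1 ->
  0 < min_sparse_eig X n -> design_ok X C0 kap k1.
Proof.
move=> /andP[n0 np] k1p h1 h2 h3; split; last first.
  by move=> M Mn; apply: unitmx_of_eig => //; rewrite Mn.
split=> b hb.
  have hm : sqn (X *m b) <= n%:R * max_sparse_eig X n * sqn b.
    by apply: max_sparse_eig_sqn => //; rewrite hb.
  by apply: le_trans hm _; rewrite ler_wpM2r ?sqn_ge0// ler_wpM2l.
apply: le_trans (_ : _ <= n%:R * min_sparse_eig X k1 * sqn b) _.
  by rewrite ler_wpM2r ?sqn_ge0// ler_wpM2l.
by apply: min_sparse_eig_sqn => //; rewrite hb.
Qed.

Section EigenvalueAssumption.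
Context d (Omega : measurableType d) (R : realType) (P : probability Omega R).
Variables (p : nat -> nat) (smp : sample P p) (C0 C1 kappa : R).
Hypothesis split : random_split smp.
Hypothesis np : forall n, (0 < n)%N -> (n < p n)%N.
Hypothesis eig : sparse_eig_bounds smp C0 C1 kappa.

Definition eig_size (n : nat) : nat := Num.truncn (C1 * ln (n%:R : R)).

Lemma measurable_group_event g n (E : set (dataset R n (p n))) : measurable E ->
  measurable [set w | E (group_data smp g n w)].
Proof.
move=> mE.
have m0 t : measurable [set x : dataset R (3 * n) (p n) | E (subdata (slot t g) x)].
  by apply: measurable_preimage mE; exact: measurable_subdata.
have [m1 _] := split_mixture split m0.
rewrite (_ : [set w | _] = [set w | E (subdata (slot (permutation smp n w) g)
  (all_data smp n w))])//.
by apply/seteqP; split=> w /=; rewrite -data_atE.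
Qed.

Hypothesis eig_size_p : \forall n \near \oo, (eig_size n <= p n)%N.

(** The slack from [C0] to [C0 + 1] and from [kappa] to [kappa / 2] turns the limsup and liminf
    bounds into inequalities that hold eventually. *)
Lemma design_ok_vanishing g : vanishing (fun n =>
  P (~` [set w | design_ok (design (group_data smp g n w)) (C0 + 1) (kappa / 2) (eig_size n)])).
Proof.
apply: ae_near_vanishing.
  move=> n.
  have mE : measurable [set dat : dataset R n (p n) |
      design_ok (design dat) (C0 + 1) (kappa / 2) (eig_size n)].
    exact: measurable_design_ok_data.
  exact: (measurable_group_event g mE).
have [C00 C10 kap0 /(_ g)[h1 h2 h3]] := eig.
have h3' : \forall w \ae P, forall n, (0 < n)%N ->
    0 < min_sparse_eig (design (group_data smp g n w)) n.
  apply/ae_foralln => n.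
  by case: n => [|n]; [apply: aeW|apply: filterS (h3 n.+1 isT)].
near=> w.
have e1 : \forall n \near \oo,
    ((max_sparse_eig (design (group_data smp g n w)) n)%:E < (C0 + 1)%:E)%E.
  apply: limn_esup_lt_near; apply: (@le_lt_trans _ _ C0%:E); first by near: w.
  by rewrite lte_fin ltrDl.
have e2 : \forall n \near \oo,
    ((kappa / 2)%:E <
     (min_sparse_eig (design (group_data smp g n w)) (eig_size n))%:E)%E.
  apply: limn_einf_gt_near; apply: (@lt_le_trans _ _ kappa%:E); last by near: w.
  by rewrite lte_fin; lra.
have e3 : forall n, (0 < n)%N -> 0 < min_sparse_eig (design (group_data smp g n w)) n.
  by near: w.
near=> n.
have n0 : (0 < n)%N by near: n; exact: nbhs_infty_gt.
apply: design_ok_of_eig.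
- by rewrite n0 ltnW// np.
- by near: n.
- by apply: ltW; rewrite -lte_fin; near: n.
- by apply: ltW; rewrite -lte_fin; near: n.
- exact: e3.
Unshelve. all: by end_near.
Qed.

Variable B : R.
Hypothesis iid : iid_observations smp.
Hypothesis normalized : normalized_bounded_covariates smp B.

(* Among more than a large multiple of n columns, with probability bounded
   below, n have all of their first k entries above a constant; such a block
   makes the largest sparse eigenvalue exceed its bound. *)
Lemma dimension_linear :
  exists2 C : R, 0 < C & \forall n \near \oo, (p n)%:R <= C * n%:R.
Proof.
have [C00 C10 kap0 _] := eig.
have [B0 normB] := normalized.
pose b := Num.max B 1.
have b1 : 1 <= b by rewrite le_max lexx orbT.
have b0 : 0 < b by lra.
pose c := 1 / (4 * b).
have c0 : 0 < c by rewrite divr_gt0// mulr_gt0.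
pose q := (4 * b ^+ 2)^-1.
have q0 : 0 < q by rewrite invr_gt0 mulr_gt0// exprn_gt0.
have hq n (i : 'I_(3 * n)) (j : 'I_(p n)) :
    (q%:E <= P [set w | (c <= tnth (covariate smp i w) j)%R])%E.
  have [E1 E2 E3] := normB n i j.
  have mX : measurable_fun setT (fun w => tnth (covariate smp i w) j).
    by apply: (measurableT_comp (measurable_tnth j)); exact: measurable_funP.
  apply: bounded_normalized_prob_ge => //.
  have mabs : measurable_fun setT (fun w => `|tnth (covariate smp i w) j|).
    by apply: (measurableT_comp _ mX); exact: normr_measurable.
  apply/eqP; rewrite eq_le probability_le1 ?[in X in X && _]/=//; last exact: measurable_le_set.
  rewrite -E3; apply: le_measure; rewrite ?inE;
    [exact: measurable_le_set|exact: measurable_le_set|].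
  by move=> w /= h; rewrite le_max h.
(* Enough rows for a block to violate the bound C0 + 1; k does not depend on n, so q^k is a fixed
   positive number. *)
pose k := (Num.truncn ((C0 + 1) / c ^+ 2)).+1.
have kc : C0 + 1 < k%:R * c ^+ 2.
  rewrite -ltr_pdivrMr ?exprn_gt0//; exact: truncnS_gt.
have qk : 0 < q ^+ k by rewrite exprn_gt0.
exists (2 / q ^+ k); first by rewrite divr_gt0.
have q4 : 0 < q ^+ k / 4 by rewrite divr_gt0.
near=> n.
have n0 : (0 < n)%N by near: n; exact: nbhs_infty_gt.
have kn : (k <= n)%N by near: n; exact: nbhs_infty_ge.
have hV : (P (~` [set w | design_ok (design (group_data smp stage1 n w))
   (C0 + 1) (kappa / 2) (eig_size n)]) <= (q ^+ k / 4)%:E)%E.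
  by near: n; exact: design_ok_vanishing.
have pR : 0 < (p n)%:R :> R by rewrite ltr0n (leq_trans _ (np n0)).
have nR : 0 < n%:R :> R by rewrite ltr0n.
(* A lower bound for the probability of a block. A block forces the design to be unacceptable, which
   has probability at most q^k / 4; comparison bounds p / n. *)
pose r := q ^+ k - n%:R / (p n)%:R.
have [r0|r0] := ltP r 0.
  move: r0; rewrite /r subr_lt0 ltr_pdivlMr// => h.
  rewrite mulrAC ler_pdivlMr//; have := ltr0n R n; lra.
pose E t := [set x : dataset R (3 * n) (p n) | large_block c k (subdata (slot t stage1) x)].
have mE t : measurable (E t).
  apply: measurable_preimage; [exact: measurable_subdata|exact: measurable_large_block].
have hr : (r%:E <= P [set w | E (permutation smp n w) (all_data smp n w)])%E.
  apply: split_ge => // t.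
  have := large_block_prob iid (ltW q0) (hq n) (@slot_inj n t stage1) kn.
  rewrite (_ : [set w | E t (all_data smp n w)] =
    [set w | large_block c k (data_at smp (slot t stage1) w)]); last first.
    by apply/seteqP; split=> w /=; rewrite /E /= data_atE.
  have mL : measurable [set w | large_block c k (data_at smp (slot t stage1) w)].
    apply: measurable_preimage (measurable_large_block c k).
    by apply: measurable_subtuple => i; exact: measurable_observation.
  have : P [set w | large_block c k (data_at smp (slot t stage1) w)] \is a fin_num.
    exact: fin_num_measure.
  case: (P _) => // x _; rewrite -EFinM -EFinD !lee_fin /r => h.
  by rewrite lerBlDr -(ler_pM2l pR) mulrDr [X in _ <= _ + X]mulrCA divff ?mulr1 1?addrC// gt_eqF.
have hle : (P [set w | E (permutation smp n w) (all_data smp n w)] <= (q ^+ k / 4)%:E)%E.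
  apply: le_trans hV; apply: le_measure; rewrite ?inE.
  - by case: (split_mixture split mE).
  - apply: measurableC; apply: (measurable_group_event _ (measurable_design_ok_data _ _ _)).
  - move=> w /=; rewrite /E /= -data_atE -group_dataE => hL [[hd _] _].
    have := large_block_design (ltW c0) n0 kn hd hL.
    by rewrite leNgt kc.
have : r <= q ^+ k / 4 by rewrite -lee_fin; exact: le_trans hr hle.
rewrite /r => h.
have : q ^+ k / 2 <= n%:R / (p n)%:R by lra.
by rewrite ler_pdivlMr// => h2; rewrite mulrAC ler_pdivlMr//; lra.
Unshelve. all: by end_near.
Qed.

End EigenvalueAssumption.

(** * Asymptotics *)

Section Asymptotics.
Variable R : realType.
Implicit Types (M G : R).

Lemma near_ln_ge M : \forall n \near \oo, M <= ln (n%:R : R).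
Proof.
near=> n; have h : expR M <= n%:R by near: n; exact: nbhs_infty_ger.
rewrite -[leLHS]expRK ler_ln ?posrE ?expR_gt0//.
exact: lt_le_trans (expR_gt0 _) h.
Unshelve. all: by end_near.
Qed.

Lemma near_sqrt_ge M : \forall n \near \oo, M <= Num.sqrt (n%:R : R).
Proof.
near=> n; have h : M ^+ 2 <= n%:R by near: n; exact: nbhs_infty_ger.
by apply: le_trans (ler_norm _) _; rewrite -sqrtr_sqr ler_wsqrtr.
Unshelve. all: by end_near.
Qed.

Lemma ln_pow_lt (y : R) k : 0 < y -> ln (y ^+ k) <= k%:R * y.
Proof.
move=> y0; rewrite lnXn// -[ln y *+ k]mulr_natl ler_wpM2l//.
rewrite {1}(_ : y = 1 + (y - 1)); last by ring.
by apply: le_trans (le_ln1Dx _) _; lra.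
Qed.

Lemma near_ln_cube G : \forall n \near \oo,
  G * ln (n%:R : R) ^+ 3 <= Num.sqrt (n%:R : R).
Proof.
near=> n.
have n1 : 1 <= n%:R :> R by near: n; exact: nbhs_infty_ger.
have n0 : 0 < n%:R :> R by lra.
have h : (`|G| * 8 ^+ 3) ^+ 8 <= n%:R by near: n; exact: nbhs_infty_ger.
(* With y = n^(1/8), ln n <= 8 y, so the cube of the logarithm is of order y^3 against sqrt n =
   y^4. *)
pose y := Num.sqrt (Num.sqrt (Num.sqrt (n%:R : R))).
have y0 : 0 < y by rewrite !sqrtr_gt0.
have y4 : Num.sqrt (n%:R : R) = y ^+ 4.
  by rewrite -[4%N]/(2 * 2)%N exprM !sqr_sqrtr ?sqrtr_ge0.
have y8 : n%:R = y ^+ 8.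
  by rewrite -[8%N]/(4 * 2)%N exprM -y4 sqr_sqrtr ?(ltW n0).
have Gy : `|G| * 8 ^+ 3 <= y.
  by move: h; rewrite y8 ler_pXn2r// nnegrE ?(ltW y0)// mulr_ge0 ?exprn_ge0.
have l0 : 0 <= ln (n%:R : R) by exact: ln_ge0.
have l8 : ln (n%:R : R) <= 8 * y by rewrite y8; exact: ln_pow_lt.
have l3 : ln (n%:R : R) ^+ 3 <= 8 ^+ 3 * y ^+ 3.
  apply: le_trans (_ : (8 * y) ^+ 3 <= _).
    by rewrite ler_pXn2r// nnegrE mulr_ge0// ltW.
  by rewrite exprMn.
rewrite y4; apply: le_trans (_ : `|G| * ln n%:R ^+ 3 <= _).
  by rewrite ler_wpM2r ?exprn_ge0// ler_norm.
apply: le_trans (ler_wpM2l (normr_ge0 G) l3) _.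
rewrite mulrA [X in _ <= X]exprS ler_wpM2r// exprn_ge0// ltW.
Unshelve. all: by end_near.
Qed.

Lemma sqrt_nat_le n : Num.sqrt (n%:R : R) <= n%:R.
Proof.
case: n => [|n]; first by rewrite sqrtr0.
rewrite -[leRHS]ger0_norm// -sqrtr_sqr ler_wsqrtr// -natrX ler_nat.
by rewrite expnS expn1 leq_pmull.
Qed.

Lemma near_ln_le D (s : nat) : \forall n \near \oo,
  D * ln (n%:R : R) + s%:R <= Num.sqrt (n%:R : R).
Proof.
near=> n.
have h : (`|D| + s%:R) * ln (n%:R : R) ^+ 3 <= Num.sqrt (n%:R : R).
  by near: n; exact: near_ln_cube.
have l1 : 1 <= ln (n%:R : R) by near: n; exact: near_ln_ge.
apply: le_trans h; rewrite mulrDl; apply: lerD.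
  apply: (@le_trans _ _ (`|D| * ln n%:R)).
    by rewrite ler_wpM2r ?ler_norm//; lra.
  rewrite ler_wpM2l//; rewrite -[leLHS]mulr1 exprS ler_wpM2l ?expr_ge1//; lra.
by rewrite -[leLHS]mulr1 ler_wpM2l// expr_ge1//; lra.
Unshelve. all: by end_near.
Qed.

Lemma near_truncn_add_le D (s : nat) : 0 <= D -> \forall n \near \oo,
  (Num.truncn (D * ln (n%:R : R)) + s <= n)%N.
Proof.
move=> D0; near=> n.
have l1 : 1 <= ln (n%:R : R) by near: n; exact: near_ln_ge.
have h : D * ln (n%:R : R) + s%:R <= Num.sqrt (n%:R : R) by near: n; exact: near_ln_le.
rewrite -(ler_nat R) natrD; apply: le_trans (le_trans h (sqrt_nat_le n)).
by rewrite lerD2r truncn_le mulr_ge0//; lra.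
Unshelve. all: by end_near.
Qed.

(** The choice l0^2 = c makes l0^2 n / 2 half of n c, with the other terms of order sqrt n; T1 = 1 /
    l0 then makes T1 l0 sqrt n = t. The constants l and th each give away a quarter of D n = n kap
    psi^2 in [tn_signal], and K is then large enough for [tn_sparse] at L = l n. *)
Lemma near_tuning (A C0 C1 kap c tau B1 psi : R) (s : nat) :
  0 < A -> 0 < C0 -> 0 < C1 -> 0 < kap -> 0 < c -> 0 <= tau -> 0 <= B1 -> 0 < psi ->
  exists (K : nat) (l l0 T1 th : R), \forall n \near \oo,
    tuning n (Num.truncn (C1 * ln (n%:R : R)))
      (Num.truncn (A * ln (n%:R : R)) + s) s K C0 kap c tau
      (Num.sqrt (n%:R : R)) (l * n%:R) B1 (l0 * Num.sqrt (n%:R : R)) T1 th psi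
      (A * ln (n%:R : R)).
Proof.
move=> A0 C00 C10 kap0 c0 tau0 B10 psi0.
pose D := kap * psi ^+ 2.
have D0 : 0 < D by rewrite mulr_gt0// exprn_gt0.
pose l0 := Num.sqrt c.
have l00 : 0 < l0 by rewrite sqrtr_gt0.
have l02 : l0 ^+ 2 = c by rewrite sqr_sqrtr// ltW.
pose T1 := l0^-1.
have T10 : 0 < T1 by rewrite invr_gt0.
have TT : 0 < 2 * B1 + T1 by lra.
pose l := D / (16 * (B1 + 1)).
have B11 : 0 < 16 * (B1 + 1) by lra.
have l_gt0 : 0 < l by rewrite divr_gt0.
have lB : 4 * l * B1 <= D / 4.
  rewrite /l (_ : 4 * (D / (16 * (B1 + 1))) * B1 = D / 4 * (B1 / (B1 + 1))); last first.
    by field; lra.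
  rewrite ler_piMr ?divr_ge0 ?(ltW D0)// ler_pdivrMr; lra.
pose th := Num.min psi (D / (8 * (C0 * (2 * B1 + T1)))).
have CT : 0 < 8 * (C0 * (2 * B1 + T1)) by rewrite mulr_gt0// mulr_gt0.
have th0 : 0 < th by rewrite lt_min psi0 divr_gt0.
have thpsi : th <= psi by rewrite ge_min lexx.
have thD : 2 * (C0 * (th * (2 * B1 + T1))) <= D / 4.
  have : th <= D / (8 * (C0 * (2 * B1 + T1))) by rewrite ge_min lexx orbT.
  rewrite ler_pdivlMr//; nra.
pose K := Num.truncn (8 * (C0 * (C0 * B1 ^+ 2 + tau)) / l ^+ 2).
have l2 : 0 < l ^+ 2 by rewrite exprn_gt0.
have KK : 8 * (C0 * (C0 * B1 ^+ 2 + tau)) < K.+1%:R * l ^+ 2.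
  by rewrite -ltr_pdivrMr//; exact: truncnS_gt.
exists K, l, l0, T1, th.
near=> n; pose x := Num.sqrt (n%:R : R).
have n0 : (0 < n)%N by near: n; exact: nbhs_infty_gt.
have nR : 0 < n%:R :> R by rewrite ltr0n.
have x0 : 0 < x by rewrite sqrtr_gt0.
have x2 : x ^+ 2 = n%:R by rewrite sqr_sqrtr// ltW.
have ln1 : 1 <= ln (n%:R : R) by near: n; exact: near_ln_ge.
have k1_ge M : M <= C1 * ln (n%:R : R) - 1 -> M <= (Num.truncn (C1 * ln (n%:R : R)))%:R.
  have := truncnS_gt (C1 * ln (n%:R : R)); rewrite -natr1; lra.
split=> //.
- exact: ltW.
- by rewrite mulr_ge0// ltW.
- exact: mulr_gt0.
- by near: n; apply: near_truncn_add_le; exact: ltW.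
- by move=> m hm; rewrite leq_add2r truncn_ge_nat// mulr_ge0//; lra.
- have : K%:R / A <= ln (n%:R : R) by near: n; exact: near_ln_ge.
  by rewrite ler_pdivrMr// mulrC.
- by near: n; exact: nbhs_infty_gt.
- rewrite -(ler_nat R); apply: k1_ge.
  have : ((K + s)%:R + 1) / C1 <= ln (n%:R : R) by near: n; exact: near_ln_ge.
  by rewrite ler_pdivrMr// mulrC; lra.
- rewrite exprMn (_ : 4 * _ = 8 * (C0 * (C0 * B1 ^+ 2 + tau)) * n%:R ^+ 2); last by ring.
  by rewrite [X in _ < X]mulrA ltr_pM2r// exprn_gt0.
- rewrite exprMn l02 -/x x2.
  have : (4 * C0 * (4 + 2 * l0 * B1) + 1) / c <= Num.sqrt (n%:R : R).
    by near: n; exact: near_sqrt_ge.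
  rewrite -/x.
  rewrite ler_pdivrMr// => h.
  have : (4 * C0 * (4 + 2 * l0 * B1) + 1) * x <= x * c * x by rewrite ler_pM2r.
  rewrite -x2; nra.
- by rewrite /T1 mulrA mulVf ?mul1r// gt_eqF.
- apply: k1_ge.
  have : ((2 * B1 + T1) / th + 1) / C1 <= ln (n%:R : R) by near: n; exact: near_ln_ge.
  by rewrite ler_pdivrMr// mulrC; lra.
- have : 17 / D <= Num.sqrt (n%:R : R).
    by near: n; exact: near_sqrt_ge.
  rewrite -/x.
  rewrite ler_pdivrMr// => h.
  have h1 : 17 * x <= x * D * x by rewrite ler_pM2r.
  have h2 : 4 * l * B1 * n%:R <= D / 4 * n%:R by rewrite ler_pM2r.
  have h3 : 2 * (C0 * (th * (2 * B1 + T1))) * n%:R <= D / 4 * n%:R by rewrite ler_pM2r.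
  have hD : n%:R * kap * psi ^+ 2 = x * D * x by rewrite /D -x2; ring.
  rewrite hD.
  have -> : 2 * (4 * x + 2 * (l * n%:R) * B1) + 2 * (n%:R * C0 * (th * (2 * B1 + T1))) =
    8 * x + 4 * l * B1 * n%:R + 2 * (C0 * (th * (2 * B1 + T1))) * n%:R by ring.
  have h4 : D * n%:R = x * D * x by rewrite -x2; ring.
  lra.
- have : (7 + 4 * C0 / kap) / D <= Num.sqrt (n%:R : R).
    by near: n; exact: near_sqrt_ge.
  rewrite -/x.
  rewrite ler_pdivrMr// => h.
  have h1 : (7 + 4 * C0 / kap) * x <= x * D * x by rewrite ler_pM2r.
  have hD : n%:R * kap * psi ^+ 2 = x * D * x by rewrite /D -x2; ring.
  rewrite hD -/x; apply: lt_le_trans h1.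
  have -> : 2 * (3 * x + 2 * (C0 * x / kap)) = (6 + 4 * C0 / kap) * x by ring.
  by rewrite ltr_pM2r//; lra.
Unshelve. all: by end_near.
Qed.

Lemma exp_rate_le (n : nat) (y : R) : (0 < n)%N -> 2 * ln (n%:R : R) <= y ->
  n%:R * (Num.sqrt 2 * expR (- y)) <= 2 / n%:R.
Proof.
move=> n0 h; have nR : 0 < n%:R :> R by rewrite ltr0n.
have s2 : Num.sqrt 2 <= 2 :> R.
  by rewrite -[leRHS]ger0_norm// -sqrtr_sqr ler_wsqrtr//; lra.
rewrite mulrCA; apply: ler_pM; rewrite ?sqrtr_ge0 ?mulr_ge0 ?expR_ge0//.
rewrite -[X in X * _](@lnK R n%:R) ?posrE// -[X in _ <= X^-1](@lnK R n%:R) ?posrE//.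
rewrite -expRN -expRD ler_expR; lra.
Qed.

Lemma near_noise_rate (A C C0 kap sigma eps : R) (s : nat) (p : nat -> nat) :
  0 < A -> 0 < kap -> 0 < sigma -> 0 < eps ->
  (forall n, (0 < n)%N -> (n < p n)%N) ->
  (\forall n \near \oo, (p n)%:R <= C * n%:R) ->
  \forall n \near \oo, noise_rate n (p n) sigma C0 kap
    (Num.truncn (A * ln (n%:R : R)) + s) (Num.sqrt n%:R) <= eps.
Proof.
move=> A0 kap0 s0 eps0 np hp.
pose D := A + s%:R.
have D0 : 0 < D by rewrite ltr_wpDr.
pose C' := Num.max C 1.
have C'1 : 1 <= C' by rewrite le_max lexx orbT.
pose E := ln C' + 1.
have E1 : 1 <= E by rewrite lerDr ln_ge0.
near=> n.
have n0 : (0 < n)%N by near: n; exact: nbhs_infty_gt.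
have nR : 0 < n%:R :> R by rewrite ltr0n.
have l1 : 1 <= ln (n%:R : R) by near: n; exact: near_ln_ge.
have hA : A^-1 <= ln (n%:R : R) by near: n; exact: near_ln_ge.
have hG : 4 * D * sigma ^+ 2 * (D * E + 2) * ln (n%:R : R) ^+ 3 <=
    Num.sqrt (n%:R : R) by near: n; exact: near_ln_cube.
have hpn : (p n)%:R <= C * n%:R by near: n.
have he : (4 + 8 * C0 ^+ 2 / kap ^+ 2) / eps <= n%:R by near: n; exact: nbhs_infty_ger.
move: l1 hA hG; set x := Num.sqrt _; set l := ln _ => l1 hA hG.
set k2 := (_ + s)%N.
have k2D : k2%:R <= D * l.
  rewrite /k2 natrD mulrDl; apply: lerD; first by rewrite truncn_le mulr_ge0//; lra.
  by rewrite -[leLHS]mulr1 ler_wpM2l.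
have k21 : 1 <= k2%:R :> R.
  rewrite ler1n /k2 addn_gt0; apply/orP; left.
  by rewrite truncn_gt0 -ler_pdivrMl ?mulr1.
have pR : 1 <= (p n)%:R :> R by rewrite ler1n (leq_trans _ (np n n0)).
have pR0 : 0 < (p n)%:R :> R by lra.
have lp : ln (p n)%:R <= E * l.
  apply: (@le_trans _ _ (ln (C' * n%:R))).
    rewrite ler_ln ?posrE//; last by rewrite mulr_gt0//; lra.
    by apply: le_trans hpn _; rewrite ler_pM2r// le_max lexx.
  rewrite lnM ?posrE//; last by lra.
  have : 0 <= ln C' by exact: ln_ge0.
  rewrite /E -/l; nra.
have lp0 : 0 <= ln (p n)%:R :> R by exact: ln_ge0.
pose y := x / (4 * k2%:R * sigma ^+ 2).
have s2 : 0 < sigma ^+ 2 by rewrite exprn_gt0.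
(* The union factor p^k2 is exp (k2 ln p). Multiplying by the denominator of y brings a third factor
   of order log n, whence the cube of the logarithm. *)
have hy : k2%:R * ln (p n)%:R + 2 * l <= y.
  rewrite ler_pdivlMr; last by rewrite mulr_gt0// mulr_gt0//; lra.
  apply: le_trans hG.
  have h1 : k2%:R * ln (p n)%:R <= D * l * (E * l) by apply: ler_pM => //; lra.
  have h2 : k2%:R * ln (p n)%:R + 2 * l <= (D * E + 2) * l ^+ 2 by nra.
  have h3 : 4 * k2%:R * sigma ^+ 2 <= 4 * (D * l) * sigma ^+ 2.
    by rewrite ler_pM2r//; lra.
  apply: le_trans (ler_pM _ _ h2 h3) _.
  - by rewrite addr_ge0// mulr_ge0//; lra.
  - by rewrite mulr_ge0 ?(ltW s2)//; lra.
  - by rewrite le_eqVlt; apply/orP; left; apply/eqP; ring.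
rewrite /noise_rate -/y.
have -> : (p n)%:R ^+ k2 * (n%:R * (Num.sqrt 2 * expR (- y))) =
    n%:R * (Num.sqrt 2 * expR (- (y - k2%:R * ln (p n)%:R))).
  by rewrite opprB expRD expRM_natl lnK ?posrE// mulrCA [_ ^+ k2 * (_ * _)]mulrCA.
have : n%:R * (Num.sqrt 2 * expR (- (y - k2%:R * ln (p n)%:R))) <= 2 / n%:R.
  by apply: exp_rate_le => //; rewrite -/l; lra.
move: (n%:R * _) => u hu.
have -> : 8 * C0 ^+ 2 / (kap ^+ 2 * n%:R) = (8 * C0 ^+ 2 / kap ^+ 2) / n%:R.
  by field; rewrite (gt_eqF nR) (gt_eqF kap0).
have : (4 + 8 * C0 ^+ 2 / kap ^+ 2) / n%:R <= eps.
  by rewrite ler_pdivrMr// [eps * _]mulrC -ler_pdivrMr.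
rewrite mulrDl; lra.
Unshelve. all: by end_near.
Qed.

(** The rate n^(-1/4) satisfies two opposite demands: the variance estimate needs eta^2 n to
    diverge, and the lowered thresholds cost of order (log n)^(3/2) eta, which must vanish. *)
Definition test_eta (n : nat) : R := (Num.sqrt (Num.sqrt (n%:R : R)))^-1.

Lemma near_test_eta : \forall n \near \oo, 0 < test_eta n < 1.
Proof.
near=> n; have h : 2 <= n%:R :> R by near: n; exact: nbhs_infty_ger.
have q : 1 < Num.sqrt (Num.sqrt (n%:R : R)).
  rewrite -[ltLHS]sqrtr1 ltr_sqrt ?sqrtr_gt0; last lra.
  rewrite -[ltLHS]sqrtr1 ltr_sqrt; lra.
rewrite /test_eta invr_gt0 invf_lt1 ?q ?andbT; lra.
Unshelve. all: by end_near.
Qed.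

Lemma near_test_rate (A alpha eps : R) : 0 < A -> 0 < alpha < 1 -> 0 < eps ->
  \forall n \near \oo,
    test_rate n alpha (test_eta n) (Num.truncn (A * ln (n%:R : R))) <= alpha + eps.
Proof.
move=> A0 /andP[a0 a1] e0.
near=> n.
have n0 : (0 < n)%N by near: n; exact: nbhs_infty_gt.
have nR : 0 < n%:R :> R by rewrite ltr0n.
have l1 : 1 <= ln (n%:R : R) by near: n; exact: near_ln_ge.
have hA : A^-1 <= ln (n%:R : R) by near: n; exact: near_ln_ge.
have h1 : 16 * A * ln (n%:R : R) ^+ 3 <=
    Num.sqrt (n%:R : R) by near: n; exact: near_ln_cube.
have h2 : (8 * A ^+ 3 / (alpha * (eps / 2) ^+ 2)) * ln (n%:R : R) ^+ 3 <= Num.sqrt (n%:R : R).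
  by near: n; exact: near_ln_cube.
have h3 : 10 / (eps / 2) <= Num.sqrt (n%:R : R) by near: n; exact: near_sqrt_ge.
have h4 : 1 <= Num.sqrt (n%:R : R) by near: n; exact: near_sqrt_ge.
set K := Num.truncn _; set eta := test_eta n.
move: l1 hA h1 h2 h3 h4; pose x := Num.sqrt (n%:R : R); pose y := Num.sqrt x.
pose l := ln (n%:R : R); rewrite -/x -/l => l1 hA h1 h2 h3 h4.
have x0 : 0 < x by lra.
have y0 : 0 < y by rewrite sqrtr_gt0.
have y2 : y ^+ 2 = x by rewrite sqr_sqrtr// ltW.
have x2 : x ^+ 2 = n%:R by rewrite sqr_sqrtr// ltW.
have y1 : 1 <= y by rewrite -[leLHS]sqrtr1 ler_wsqrtr.
have etaE : eta = y^-1 by [].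
have KA : K%:R <= A * l by rewrite truncn_le -/l mulr_ge0//; lra.
have K1 : 1 <= K%:R :> R.
  by rewrite ler1n truncn_gt0 -ler_pdivrMl ?mulr1.
rewrite /test_rate etaE.
have t1 : 8 / (y^-1 ^+ 2 * n%:R) = 8 / x.
  by rewrite -x2 -y2; field; rewrite gt_eqF.
have t2 : n%:R * (Num.sqrt 2 * expR (- (y^-1 * n%:R / (8 * K%:R)))) <= 2 / n%:R.
  apply: exp_rate_le => //; rewrite -/l ler_pdivlMr; last by lra.
  have -> : y^-1 * n%:R = y * x by rewrite -x2 -y2; field; rewrite gt_eqF.
  have : x <= y * x by rewrite ler_peMl// ltW.
  have : 2 * l * (8 * K%:R) <= 16 * A * l ^+ 2 by nra.
  have : 16 * A * l ^+ 2 <= 16 * A * l ^+ 3.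
    by rewrite ler_wpM2l ?mulr_ge0 ?(ltW A0)// ler_weXn2l.
  lra.
have t3 : 2 / n%:R <= 2 / x.
  rewrite ler_pM2l// lef_pV2 ?posrE// -x2 expr2 ler_peMl//; exact: ltW.
have t4 : K%:R * (Num.sqrt (8 * K%:R / alpha) * y^-1) <= eps / 2.
  have e2 : 0 < eps / 2 by lra.
  rewrite mulrA ler_pdivrMr//.
  have K0 : 0 <= K%:R :> R by [].
  (* Under a square root, the power K^(3/2) becomes K^3, which [near_ln_cube] controls. *)
  rewrite -[X in X * _]ger0_norm// -sqrtr_sqr -sqrtrM ?sqr_ge0//.
  have -> : eps / 2 * y = Num.sqrt ((eps / 2) ^+ 2 * x).
    by rewrite sqrtrM ?sqr_ge0// sqrtr_sqr ger0_norm// ltW.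
  rewrite ler_wsqrtr//.
  have -> : K%:R ^+ 2 * (8 * K%:R / alpha) = 8 * K%:R ^+ 3 / alpha by ring.
  have K3 : K%:R ^+ 3 <= (A * l) ^+ 3.
    by rewrite ler_pXn2r// nnegrE mulr_ge0//; lra.
  apply: (@le_trans _ _ (8 * (A * l) ^+ 3 / alpha)).
    by rewrite ler_pM2r ?invr_gt0//; lra.
  have ee : 0 < (eps / 2) ^+ 2 by rewrite exprn_gt0.
  have := ler_wpM2l (ltW ee) h2; congr (_ <= _).
  by field; rewrite (gt_eqF a0) (gt_eqF e0).
have : 10 / x <= eps / 2 by rewrite ler_pdivrMr// mulrC -ler_pdivrMr//; lra.
rewrite t1; lra.
Unshelve. all: by end_near.
Qed.

End Asymptotics.

(** * The three conclusions *)

Section CleanedMeasurability.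
Variables (R : realType) (n p : nat) (M : {set 'I_p}).

Let mx_measurable_S :
  mx_measurable (fun dat : dataset R n p => subcols (design dat) M).
Proof. by apply: mx_measurable_subcols; exact: mx_measurable_design. Qed.

Let mx_measurable_G : mx_measurable (fun dat : dataset R n p =>
  invmx ((subcols (design dat) M)^T *m subcols (design dat) M)).
Proof.
apply: mx_measurable_inv; apply: mx_measurable_mul => //.
exact: mx_measurable_tr.
Qed.

Lemma mx_measurable_ls_coef :
  mx_measurable (fun dat : dataset R n p => ls_coef dat M).
Proof.
apply: mx_measurable_mul => //; apply: mx_measurable_mul.
  exact: mx_measurable_tr.
exact: mx_measurable_responses.
Qed.

Lemma measurable_residual_variance :
  measurable_fun setT (fun dat : dataset R n p => residual_variance dat M).
Proof.
apply: measurable_funM => //; apply: measurable_sum => i.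
apply: measurable_funX; apply: measurable_funB; first exact: mx_measurable_responses.
apply: mx_measurable_mul; first exact: mx_measurable_design.
apply: mx_measurable_mul; first exact: mx_measurable_cst.
exact: mx_measurable_ls_coef.
Qed.

Lemma measurable_t_stat k :
  measurable_fun setT (fun dat : dataset R n p => @t_stat R n p dat M k).
Proof.
have ms : measurable_fun setT (Num.sqrt : R -> R).
  by apply: continuous_measurable_fun; exact: sqrt_continuous.
apply: measurable_funM; first exact: mx_measurable_ls_coef.
apply: (measurableT_comp (@measurable_inv R)); apply: measurable_funM.
  by apply: (measurableT_comp ms); exact: measurable_residual_variance.
by apply: (measurableT_comp ms); exact: mx_measurable_G.
Qed.

Lemma measurable_cleaned alpha (D : {set 'I_p}) :
  measurable [set dat : dataset R n p |
    (~: D :&: cleaned dat alpha M)%SET != finset.set0].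
Proof.
rewrite (_ : [set dat | _] = [set dat | exists k : 'I_#|M|, (enum_val k \notin D) /\
    (upper_quantile (alpha / (2 * #|M|%:R)) < `|t_stat dat k|)]).
  apply: measurable_exists_fin => k; apply: measurable_and_cst => _.
  apply: measurable_lt_set => //; apply: measurableT_comp; first exact: normr_measurable.
  exact: measurable_t_stat.
apply/seteqP; split=> dat /=.
  move=> /set0Pn[j]; rewrite finset.in_setI finset.in_setC => /andP[jD /imsetP[k]].
  by rewrite inE => hk jE; exists k; rewrite -jE.
move=> [k [kD hk]]; apply/set0Pn; exists (enum_val k).
rewrite finset.in_setI finset.in_setC kD /=; apply/imsetP; exists k => //.
by rewrite inE.
Qed.

End CleanedMeasurability.

Lemma min_signal_bound (R : realType) (beta : nat -> R) (s : nat) :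
  (0 < min_signal beta s)%E ->
  exists2 psi : R, 0 < psi & forall j, (j < s)%N -> psi <= `|beta j|.
Proof.
move=> h; have lb j : (j < s)%N -> (min_signal beta s <= `|beta j|%:E)%E.
  by move=> js; apply: ereal_inf_lbound; exists j.
move: h lb; case: (min_signal beta s) => [r|_|//].
  by rewrite lte_fin => r0 lb; exists r => // j /lb; rewrite lee_fin.
(* The infinite case is that of no signal coordinate, where any positive number serves. *)
by move=> lb; exists 1 => // j /lb.
Qed.

Lemma coef_signal_bounds (R : realType) (p : nat) (beta : nat -> R) (s : nat) psi :
  (s <= p)%N -> (forall j, (beta j != 0) = (j < s)%N) ->
  (forall j, (j < s)%N -> psi <= `|beta j|) ->
  signal_bounds (coef beta p) s (\sum_(j < s) `|beta j|) psi.
Proof.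
move=> sp hs hpsi; split.
- rewrite -[X in (_ <= X)%N](card_ord_lt sp); apply: subset_leq_card.
  by apply/fintype.subsetP => j; rewrite !inE mxE hs.
- rewrite /l1norm (bigID (fun j : 'I_p => (j < s)%N)) /= [X in _ + X]big1 ?addr0.
    by rewrite (big_ord_narrow sp); apply: ler_sum => j _; rewrite mxE.
  by move=> j js; rewrite mxE; move: js; rewrite -hs negbK => /eqP ->; rewrite normr0.
- by move=> j; rewrite inE mxE hs => /hpsi.
Qed.

Lemma measurable_superset dT (T : measurableType dT) n (D0 : {set 'I_n})
    (S : T -> {set 'I_n}) : (forall M, measurable [set x | S x = M]) ->
  measurable [set x | D0 \subset S x].
Proof.
move=> mS; rewrite (_ : [set x | _] =
    [set x | exists M, (D0 \subset (M : {set 'I_n}) : Prop) /\ [set x | S x = M] x]).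
  by apply: measurable_exists_fin => M; apply: measurable_and_cst.
apply/seteqP; split=> x /=; first by exists (S x).
by move=> [M [h ->]].
Qed.

(** * Typical data sets and the limits of probabilities *)

Section Assembly.
Context d (Omega : measurableType d) (R : realType) (P : probability Omega R).
Variables (p : nat -> nat) (smp : sample P p).
Hypothesis split : random_split smp.

Definition triple_data n w : (dataset R n (p n) * dataset R n (p n)) * dataset R n (p n) :=
  ((group_data smp stage1 n w, group_data smp stage2 n w), group_data smp stage3 n w).

Let sub3 n (t : 'S_(3 * n)) (x : dataset R (3 * n) (p n)) :=
  ((subdata (slot t stage1) x, subdata (slot t stage2) x), subdata (slot t stage3) x).

Let sub3_triple n w :
  sub3 (permutation smp n w) (all_data smp n w) = triple_data n w.
Proof. by rewrite /sub3 -!data_atE. Qed.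

Let measurable_sub3 n t : measurable_fun setT (@sub3 n t).
Proof.
apply/measurable_fun_pairP; split; last exact: measurable_subdata.
by apply/measurable_fun_pairP; split; exact: measurable_subdata.
Qed.

Lemma measurable_triple_event n E : measurable E ->
  measurable [set w | E (triple_data n w)].
Proof.
move=> mE.
have mF t : measurable [set x | E (@sub3 n t x)].
  exact: measurable_preimage (@measurable_sub3 n t) mE.
have -> : [set w | E (triple_data n w)] =
   [set w | E (@sub3 n (permutation smp n w) (all_data smp n w))].
  by apply/seteqP; split=> w /=; rewrite sub3_triple.
by case: (split_mixture split mF).
Qed.

Lemma triple_event_le n E (r : R) : 0 <= r -> measurable E ->
  (forall t, (P [set w | E (pair_at smp t w, data_at smp (slot t stage3) w)] <= r%:E)%E) ->
  (P [set w | E (triple_data n w)] <= r%:E)%E.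
Proof.
move=> r0 mE h.
have mF t : measurable [set x | E (@sub3 n t x)].
  exact: measurable_preimage (@measurable_sub3 n t) mE.
have -> : [set w | E (triple_data n w)] =
   [set w | E (@sub3 n (permutation smp n w) (all_data smp n w))].
  by apply/seteqP; split=> w /=; rewrite sub3_triple.
have := @split_le _ _ _ _ _ _ _ split (fun t => [set x | E (@sub3 n t x)])
  (fun _ => set0) r r0 mF (fun _ => measurable0).
rewrite measure0 adde0; apply => t.
apply: le_trans (h t); rewrite le_eqVlt; apply/orP; left; apply/eqP; congr (P _).
by apply/seteqP; split=> w /=; rewrite /sub3 -!data_atE.
Qed.

Variables (beta : nat -> R) (s : nat) (sigma C0 C1 kappa B A : R).
Hypothesis np : forall n, (0 < n)%N -> (n < p n)%N.
Hypothesis iid : iid_observations smp.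
Hypothesis sigma0 : 0 < sigma.
Hypothesis model : gaussian_linear_model smp beta sigma.
Hypothesis signal : sparse_signal p beta s.
Hypothesis eig : sparse_eig_bounds smp C0 C1 kappa.
Hypothesis normalized : normalized_bounded_covariates smp B.
Hypothesis A0 : 0 < A.

Let c := sigma ^+ 2 * (kappa / 2) / 2.
Let tau := 2 * sigma ^+ 2.
Let k2 n := (Num.truncn (A * ln (n%:R : R)) + s)%N.

Let eig_pos : [/\ 0 < C0, 0 < C1 & 0 < kappa].
Proof. by case: eig. Qed.

Lemma eig_size_le_dimension : \forall n \near \oo, (eig_size C1 n <= p n)%N.
Proof.
have [_ C10 _] := eig_pos; near=> n.
have n0 : (0 < n)%N by near: n; exact: nbhs_infty_gt.
have h : (eig_size C1 n + 0 <= n)%N by near: n; apply: near_truncn_add_le; exact: ltW.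
by rewrite addn0 in h; apply: leq_trans h _; apply: ltnW; exact: np.
Unshelve. all: by end_near.
Qed.

Let ok_design n (dat : dataset R n (p n)) :=
  design_ok (design dat) (C0 + 1) (kappa / 2) (eig_size C1 n).

Let bad_noise n (dat : dataset R n (p n)) :=
  noise_bad (design dat) (responses dat - design dat *m coef beta (p n))
    c tau (Num.sqrt n%:R) (k2 n).

Definition typical n (dat : dataset R n (p n)) : Prop :=
  ok_design dat /\ ~ bad_noise dat.

Let measurable_ok n : measurable [set dat : dataset R n (p n) | ok_design dat].
Proof. exact: measurable_design_ok_data. Qed.

Let measurable_bad n : measurable [set dat : dataset R n (p n) | bad_noise dat].
Proof.
by apply: measurable_noise_bad; [exact: mx_measurable_design|exact: mx_measurable_noise].
Qed.

Lemma measurable_typical n : measurable [set dat : dataset R n (p n) | typical dat].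
Proof.
by apply: measurableI; [exact: measurable_ok|apply: measurableC; exact: measurable_bad].
Qed.

Lemma typical_vanishing g :
  vanishing (fun n => P (~` [set w | typical (group_data smp g n w)])).
Proof.
have [C00 C10 kap0] := eig_pos.
have h1 := design_ok_vanishing split np eig eig_size_le_dimension g.
have [C Cpos hC] := dimension_linear split np eig eig_size_le_dimension iid normalized.
have h2 : vanishing (fun n => (noise_rate n (p n) sigma (C0 + 1) (kappa / 2) (k2 n)
    (Num.sqrt n%:R))%:E).
  move=> e e0; apply: filterS (@near_noise_rate R A C (C0 + 1) (kappa / 2) sigma e s p
    A0 _ sigma0 e0 np hC); last by lra.
  by move=> n; rewrite lee_fin.
apply: vanishing_le (vanishingD h1 h2); near=> n.
have n0 : (0 < n)%N by near: n; exact: nbhs_infty_gt.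
have k10 : (0 < eig_size C1 n)%N.
  rewrite /eig_size truncn_gt0 -ler_pdivrMl// mulr1; near: n; exact: near_ln_ge.
have k2n : (k2 n <= n)%N by near: n; apply: near_truncn_add_le; exact: ltW.
have kap20 : 0 < kappa / 2 by lra.
have C010 : 0 <= C0 + 1 by lra.
pose rate := noise_rate n (p n) sigma (C0 + 1) (kappa / 2) (k2 n) (Num.sqrt n%:R).
have rate0 : 0 <= rate.
  rewrite /rate /noise_rate !addr_ge0 ?divr_ge0 ?mulr_ge0 ?sqrtr_ge0 ?expR_ge0 ?exprn_ge0//;
  exact: ltW.
(* The design can fail only as the eigenvalue assumption allows for the random group; bad noise is
   bounded at each fixed permutation, and only together with an acceptable design. *)
pose E t := [set x | (fun dat => ok_design dat /\ bad_noise dat) (@subdata R p n n (slot t g) x)].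
have mE t : measurable (E t).
  apply: (measurable_preimage (A := [set dat | ok_design dat] `&` [set dat | bad_noise dat])).
    exact: measurable_subdata.
  by apply: measurableI; [exact: measurable_ok|exact: measurable_bad].
have hE := @split_le _ _ _ _ _ _ _ split E (fun _ => set0) rate rate0 mE (fun _ => measurable0).
have m1 := measurable_group_event split g (measurable_ok (n := n)).
have m2 : measurable [set w | E (permutation smp n w) (all_data smp n w)].
  by case: (split_mixture split mE).
apply: (@le_trans _ _ (P ((~` [set w | ok_design (group_data smp g n w)]) `|`
    [set w | E (permutation smp n w) (all_data smp n w)]))).
  apply: le_measure; rewrite ?inE.
  - apply: measurableC.
    exact: (measurable_group_event split g (measurable_typical (n := n))).
  - by apply: measurableU => //; exact: measurableC.
  - move=> w /= /not_andP[h|/contrapT h]; first by left.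
    have [h'|h'] := pselect (ok_design (group_data smp g n w)); last by left.
    by right; rewrite /E /= -data_atE -group_dataE.
apply: le_trans (measureU2 _ _ _) _ => //; first exact: measurableC.
apply: leeD => //.
rewrite measure0 adde0 in hE; apply: hE => t.
apply: le_trans (noise_bad_at sigma0 model (f := slot t g) n0 k10 C010 kap20 (ltnW (np n0))
   (@slot_inj _ _ _) k2n (sqrtr_ge0 _)).
rewrite le_eqVlt; apply/orP; left; apply/eqP; congr (P _).
by apply/seteqP; split=> w /=; rewrite /E /= -data_atE.
Unshelve. all: by end_near.
Qed.

Variables (alpha : R).
Hypothesis halpha : 0 < alpha < 1.
Variable betat : forall n, dataset R n (p n) -> R -> 'cV[R]_(p n).
Hypothesis lasso : forall n (d1 : dataset R n (p n)) (lam : R), 0 <= lam ->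
  is_argmin setT (lasso_objective d1 lam) (betat d1 lam).
Let Ssel n (d1 : dataset R n (p n)) (lam : R) := supp (betat d1 lam).
Let D n := supp (coef beta (p n)).

Let favourable n : Prop := exists (K : nat) (L l0 T1 th psi : R),
    [/\ tuning n (eig_size C1 n) (k2 n) s K (C0 + 1) (kappa / 2) c tau
          (Num.sqrt (n%:R : R)) L (\sum_(j < s) `|beta j|) l0 T1 th psi
          (A * ln (n%:R : R)),
        signal_bounds (coef beta (p n)) s (\sum_(j < s) `|beta j|) psi &
        forall dat : dataset R n (p n), typical dat ->
          good_data dat (coef beta (p n)) (eig_size C1 n) (k2 n) (C0 + 1) (kappa / 2)
            c tau (Num.sqrt n%:R)].

Let near_favourable : \forall n \near \oo, favourable n.
Proof.
have [C00 C10 kap0] := eig_pos.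
have [sp hs /min_signal_bound[psi psi0 hpsi]] := signal.
have c0 : 0 < c by rewrite /c divr_gt0// mulr_gt0 ?exprn_gt0//; lra.
have tau0 : 0 <= tau by rewrite /tau mulr_ge0// sqr_ge0.
have C010 : 0 < C0 + 1 by lra.
have kap20 : 0 < kappa / 2 by lra.
have B10 : 0 <= \sum_(j < s) `|beta j| by exact: sumr_ge0.
have [K [l [l0 [T1 [th h]]]]] := near_tuning s A0 C010 C10 kap20 c0 tau0 B10 psi0.
near=> n; exists K, (l * n%:R), (l0 * Num.sqrt n%:R), T1, th, psi.
have n0 : (0 < n)%N by near: n; exact: nbhs_infty_gt.
have k2n : (k2 n <= n)%N by near: n; apply: near_truncn_add_le; exact: ltW.
split; first by near: n.
  by apply: coef_signal_bounds => //; exact: sp.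
move=> dat [[ok units] nb]; split=> //.
by apply: noise_not_bad => //; rewrite k2n ltnW// np.
Unshelve. all: by end_near.
Qed.

Let triple_vanishing
    (E : forall n, set ((dataset R n (p n) * dataset R n (p n)) * dataset R n (p n))) :
  (forall n, measurable (E n)) ->
  (\forall n \near \oo, forall x, typical x.1.1 -> typical x.1.2 -> E n x) ->
  vanishing (fun n => P (~` [set w | E n (triple_data n w)])).
Proof.
move=> mE h.
apply: vanishing_le (vanishingD (typical_vanishing stage1) (typical_vanishing stage2)).
near=> n.
have mt g : measurable (~` [set w | typical (group_data smp g n w)]).
  apply: measurableC.
  exact: (measurable_group_event split g (measurable_typical (n := n))).
apply: le_trans (measureU2 P (mt stage1) (mt stage2)).
apply: le_measure; rewrite ?inE.
- by apply: measurableC; exact: measurable_triple_event.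
- by apply: measurableU; exact: mt.
- move=> w /= hw; apply: contrapT => /not_orP[/contrapT h1 /contrapT h2]; apply: hw.
  have hn : forall x, typical x.1.1 -> typical x.1.2 -> E n x by near: n.
  exact: hn.
Unshelve. all: by end_near.
Qed.

Variable lamstar : forall n, dataset R n (p n) -> R.
Variable lamhat : forall n, dataset R n (p n) -> dataset R n (p n) -> R.
Hypothesis hstar : forall n (d1 : dataset R n (p n)),
  is_argmin (admissible n A (betat (n := n) d1))
    (fun lam => true_loss d1 (coef beta (p n)) (ls_fit d1 (Ssel d1 lam)))
    (lamstar d1).
Hypothesis hhat : forall n (d1 d2 : dataset R n (p n)),
  is_argmin (admissible n A (betat (n := n) d1))
    (fun lam => prediction_loss d2 (ls_fit d1 (Ssel d1 lam)))
    (lamhat d1 d2).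
Hypothesis measurable_star : forall n (M : {set 'I_(p n)}), measurable
  [set d1 : dataset R n (p n) | Ssel d1 (lamstar d1) = M].
Hypothesis measurable_hat : forall n (M : {set 'I_(p n)}), measurable
  [set dd : dataset R n (p n) * dataset R n (p n) |
    Ssel dd.1 (lamhat dd.1 dd.2) = M].

Lemma true_loss_selection :
  P [set w | D n \subset Ssel (group_data smp stage1 n w)
    (lamstar (group_data smp stage1 n w))] @[n --> \oo] --> 1%E.
Proof.
pose E n := [set x : (dataset R n (p n) * dataset R n (p n)) * dataset R n (p n) |
  D n \subset Ssel x.1.1 (lamstar x.1.1)].
have mE n : measurable (E n).
  have m1 : measurable [set d1 : dataset R n (p n) | D n \subset Ssel d1 (lamstar d1)].
    exact: measurable_superset (@measurable_star n).
  exact: measurable_preimage measurable_fst (measurable_preimage measurable_fst m1).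
apply: vanishing_cvg1 => [n|]; first exact: (measurable_triple_event (mE n)).
apply: (triple_vanishing mE).
apply: filterS near_favourable => n [K [L [l0 [T1 [th [psi [tun sig good]]]]]]] x t1 _.
exact: (true_loss_overfits tun sig (good _ t1) (@lasso n x.1.1) (@hstar n x.1.1)).
Qed.

Let hat_superset n :=
  [set x : (dataset R n (p n) * dataset R n (p n)) * dataset R n (p n) |
    D n \subset Ssel x.1.1 (lamhat x.1.1 x.1.2)].

Let measurable_hat_superset n : measurable (@hat_superset n).
Proof.
have m1 : measurable [set dd : dataset R n (p n) * dataset R n (p n) |
    D n \subset Ssel dd.1 (lamhat dd.1 dd.2)].
  exact: measurable_superset (@measurable_hat n).
exact: measurable_preimage measurable_fst m1.
Qed.

Let hat_vanishing :
  vanishing (fun n => P (~` [set w | hat_superset (triple_data n w)])).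
Proof.
apply: (triple_vanishing measurable_hat_superset).
apply: filterS near_favourable => n [K [L [l0 [T1 [th [psi [tun sig good]]]]]]] x t1 t2.
exact: (cross_validation_overfits tun sig (good _ t1) (@lasso n x.1.1) (good _ t2)
  (@hhat n x.1.1 x.1.2)).
Qed.

Lemma cross_validation_selection :
  P [set w | D n \subset Ssel (group_data smp stage1 n w)
    (lamhat (group_data smp stage1 n w) (group_data smp stage2 n w))]
    @[n --> \oo] --> 1%E.
Proof.
apply: vanishing_cvg1 => [n|]; first exact: (measurable_triple_event (@measurable_hat_superset n)).
exact: hat_vanishing.
Qed.

Let Shat n w := Ssel (group_data smp stage1 n w)
  (lamhat (group_data smp stage1 n w) (group_data smp stage2 n w)).

Lemma family_wise_error :
  (limn_esup (fun n => P [set w |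
     (~: D n :&: cleaned (group_data smp stage3 n w) alpha (Shat n w) != finset.set0)%SET])
   <= alpha%:E)%E.
Proof.
have /andP[a0 a1] := halpha.
pose Mhat n (dd : dataset R n (p n) * dataset R n (p n)) :=
  Ssel dd.1 (lamhat dd.1 dd.2).
have mM n (M : {set 'I_(p n)}) : measurable [set dd | Mhat n dd = M].
  exact: measurable_hat.
pose K n := Num.truncn (A * ln (n%:R : R)).
pose F n := [set x : (dataset R n (p n) * dataset R n (p n)) * dataset R n (p n) |
  (~: D n :&: cleaned x.2 alpha (Mhat n x.1) != finset.set0)%SET].
have mF n : measurable (F n).
  rewrite (_ : F n = [set x | exists M, ([set x | Mhat n x.1 = M] `&`
     [set x | (~: D n :&: cleaned x.2 alpha M != finset.set0)%SET]) x]); last first.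
    apply/seteqP; split=> x /=; first by exists (Mhat n x.1).
    by move=> [M [hM h]]; rewrite /F /= hM.
  apply: measurable_exists_fin => M; apply: measurableI.
    exact: measurable_preimage measurable_fst (mM n M).
  exact: measurable_preimage measurable_snd (measurable_cleaned M alpha (D n)).
pose G n := [set x : (dataset R n (p n) * dataset R n (p n)) * dataset R n (p n) |
  (0 < #|Mhat n x.1| <= K n)%N /\
  t_test_data beta sigma (C0 + 1) (kappa / 2) (eig_size C1 n) alpha (test_eta R n)
    (Mhat n x.1) x.2].
have mG n : measurable (G n) by exact: measurable_t_test_selected.
have hT := typical_vanishing stage3.
apply/lee_addgt0Pr => e e0; apply: limn_esup_le_near.
have e2 : 0 < e / 2 by rewrite divr_gt0.
near=> n.
have n0 : (0 < n)%N by near: n; exact: nbhs_infty_gt.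
have Kn : (K n + 1 <= n)%N by near: n; apply: near_truncn_add_le; exact: ltW.
have l1 : 1 <= ln (n%:R : R) by near: n; exact: near_ln_ge.
have heta : 0 < test_eta R n < 1 by near: n; exact: near_test_eta.
have hrate : test_rate n alpha (test_eta R n) (K n) <= alpha + e / 2.
  by near: n; exact: near_test_rate.
have hV : (P (~` [set w | hat_superset (triple_data n w)]) +
    P (~` [set w | typical (group_data smp stage3 n w)]) <= (e / 2)%:E)%E.
  by near: n; exact: (vanishingD hat_vanishing hT).
have mt : measurable (~` [set w | typical (group_data smp stage3 n w)]).
  apply: measurableC.
  exact: (measurable_group_event split stage3 (measurable_typical (n := n))).
have mHw : measurable (~` [set w | hat_superset (triple_data n w)]).
  by apply: measurableC; exact: (measurable_triple_event (@measurable_hat_superset n)).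
have mGw : measurable [set w | G n (triple_data n w)] by exact: (measurable_triple_event (mG n)).
have hG : (P [set w | G n (triple_data n w)] <= (alpha + e / 2)%:E)%E.
  apply: le_trans (_ : _ <= (test_rate n alpha (test_eta R n) (K n))%:E)%E _; last first.
    by rewrite lee_fin.
  apply: triple_event_le => //; first exact: test_rate_ge0.
  have KN : (K n <= n)%N by rewrite ltnW// -addn1.
  move=> t; exact: (t_test_selected_at sigma0 model (C0 + 1) (kappa / 2)
    (eig_size C1 n) n0 iid t KN halpha heta (mM n)).
(* A false rejection needs a lost signal, an atypical third group, or [t_test_bad] for a nonempty
   model of admissible size that contains the signal. *)
apply: (@le_trans _ _ (P ([set w | G n (triple_data n w)] `|`
  ((~` [set w | hat_superset (triple_data n w)]) `|`
   (~` [set w | typical (group_data smp stage3 n w)]))))).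
  apply: le_measure; rewrite ?inE.
  - exact: (measurable_triple_event (mF n)).
  - by apply: measurableU => //; exact: measurableU.
  - move=> w /= hw; apply: contrapT => /not_orP[hG' /not_orP[/contrapT hH' /contrapT ht]].
    apply: hG'; rewrite /G /=.
    have [adm _] := @hhat n (group_data smp stage1 n w) (group_data smp stage2 n w).
    have [_ cardS] := adm.
    have cardK : (#|Shat n w| <= K n)%N.
      by rewrite /K truncn_ge_nat// mulr_ge0 ?(ltW A0)//; lra.
    have cardn : (#|Shat n w| < n)%N by rewrite (leq_ltn_trans cardK)// -addn1.
    have [ok _] := ht; have [_ units] := ok.
    split.
      (* A rejected covariate comes from an index in ['I_#|M|], so the selected model is nonempty
         and its quantile level is well defined. *)
      rewrite cardK andbT; have /set0Pn[j] := hw.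
      rewrite finset.in_setI => /andP[_ /imsetP[k _ _]].
      exact: leq_ltn_trans (leq0n k) (ltn_ord k).
    split=> //; apply: cleaned_t_test_bad => //.
      rewrite mulr_ge0 ?sqr_ge0// subr_ge0; have /andP[_] := heta; exact: ltW.
    by apply: units; exact: ltnW.
apply: le_trans (measureU2 P mGw (measurableU _ _ mHw mt)) _.
rewrite (_ : alpha%:E + e%:E = (alpha + e / 2)%:E + (e / 2)%:E)%E; last first.
  by rewrite -!EFinD; congr EFin; field.
apply: leeD => //; apply: le_trans (measureU2 P mHw mt) hV.
Unshelve. all: by end_near.
Qed.

End Assembly.

Theorem theorem4p1 (R : realType) (d : measure_display)
    (Omega : measurableType d) (P : probability Omega R)
    (p : nat -> nat) (smp : sample P p) (beta : nat -> R) (s : nat)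
    (sigma c1 c2 C0 C1 kappa B A alpha : R)
    (betat : forall n, dataset R n (p n) -> R -> 'cV[R]_(p n))
    (lamstar : forall n, dataset R n (p n) -> R)
    (lamhat : forall n, dataset R n (p n) -> dataset R n (p n) -> R) :
  (forall n, (0 < n)%N -> (n < p n)%N) ->
  iid_observations smp ->
  random_split smp ->
  0 < sigma ->
  gaussian_linear_model smp beta sigma ->
  dimension_growth p c1 c2 ->
  sparse_signal p beta s ->
  sparse_eig_bounds smp C0 C1 kappa ->
  normalized_bounded_covariates smp B ->
  0 < A ->
  0 < alpha < 1 ->
  (* the lasso estimator and its selected set, computed from D_1 *)
  (forall n (d1 : dataset R n (p n)) (lam : R), 0 <= lam ->
     is_argmin setT (lasso_objective d1 lam) (betat n d1 lam)) ->
  let Ssel n (d1 : dataset R n (p n)) (lam : R) := supp (betat n d1 lam) in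
  (* minimizer of the true loss over Lambda_n *)
  (forall n (d1 : dataset R n (p n)),
     is_argmin (admissible n A (betat n d1))
       (fun lam => true_loss d1 (coef beta (p n)) (ls_fit d1 (Ssel n d1 lam)))
       (lamstar n d1)) ->
  (* minimizer of the cross-validated loss over Lambda_n *)
  (forall n (d1 d2 : dataset R n (p n)),
     is_argmin (admissible n A (betat n d1))
       (fun lam => prediction_loss d2 (ls_fit d1 (Ssel n d1 lam)))
       (lamhat n d1 d2)) ->
  (* the selected models are measurable functions of the data *)
  (forall n (M : {set 'I_(p n)}), measurable
     [set d1 : dataset R n (p n) | Ssel n d1 (lamstar n d1) = M]) ->
  (forall n (M : {set 'I_(p n)}), measurable
     [set dd : dataset R n (p n) * dataset R n (p n) |
       Ssel n dd.1 (lamhat n dd.1 dd.2) = M]) ->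
  let data g n w := group_data smp g n w in
  let D n := supp (coef beta (p n)) in
  let Sstar n w := Ssel n (data stage1 n w) (lamstar n (data stage1 n w)) in
  let Shat n w := Ssel n (data stage1 n w)
    (lamhat n (data stage1 n w) (data stage2 n w)) in
  let Dhat n w := cleaned (data stage3 n w) alpha (Shat n w) in
  [/\ P [set w | D n \subset Sstar n w] @[n --> \oo] --> 1%E,
      P [set w | D n \subset Shat n w] @[n --> \oo] --> 1%E &
      (limn_esup (fun n =>
         P [set w | (~: D n :&: Dhat n w != finset.set0)%SET]) <= alpha%:E)%E].
Proof.
move=> np iid split sigma0 model _ signal eig normalized A0 halpha lasso Ssel
  hstar hhat mstar mhat data D Sstar Shat Dhat; split.
- exact: (true_loss_selection split np iid sigma0 model signal eig normalized A0
    lasso hstar mstar).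
- exact: (cross_validation_selection split np iid sigma0 model signal eig normalized A0
    lasso hhat mhat).
- exact: (family_wise_error split np iid sigma0 model signal eig normalized A0
    halpha lasso hhat mhat).
Qed.
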